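(* For every positive integer $n$ and every partition $\lambda=(\lambda_1,\lambda_2,\dots,\lambda_n)$ with $\lambda_1\ge\dots\ge\lambda_n=0$, the ice crystal $\mathcal{M}(\lambda)$ (the set of 5-vertex ice models with boundary condition $\lambda$, equipped with the maps $\mathrm{wt},\tilde e_i,\tilde f_i$, $i\in I$) is isomorphic, as an $\mathfrak{sl}_n$-crystal, to the irreducible highest weight crystal $\mathcal{B}(\lambda)$ corresponding to the irreducible representation of $\mathfrak{sl}_n$ with highest weight $\lambda$.
   Context: Setting. $n$ is a positive integer, $\lambda=(\lambda_1\ge\dots\ge\lambda_n=0)$ is a partition (weakly decreasing integers, last part $0$), $s=\lambda_1+n$, $I=\{1,\dots,n-1\}$, $\mathbb{N}=\{0,1,2,\dots\}$. Ice models. An $n\times s$ ice model $M$ is a rectangular lattice with $n$ rows and $s$ columns of vertices and a sign ($+$ or $-$) on each edge adjacent to a vertex (including the boundary edges). Columns are numbered $1,\dots,s$ from left to right; rows are numbered $n,n-1,\dots,1$ from top to bottom (row $1$ is the bottom row). $M_{i,j}$ is the vertex in row $i$, column $j$, and $M_{i,j}^{\uparrow},M_{i,j}^{\leftarrow},M_{i,j}^{\rightarrow},M_{i,j}^{\downarrow}$ are the signs on its top, left, right, bottom edges; thus $M_{i,j}^{\rightarrow}=M_{i,j+1}^{\leftarrow}$ and $M_{i+1,j}^{\downarrow}=M_{i,j}^{\uparrow}$. The valid vertex configurations, written $(\uparrow,\leftarrow,\rightarrow,\downarrow)$, are: type 1 $(+,+,+,+)$; type 2 $(+,-,-,+)$;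 type 3 $(+,-,+,-)$; type 4 $(-,+,-,+)$; type 5 $(-,-,-,-)$. A 5-vertex ice model is one all of whose vertices are valid. $\mathcal{M}(\lambda)$ is the set of $n\times s$ 5-vertex ice models $M$ with: $M_{n,q}^{\uparrow}=-$ iff $q=\lambda_1+j-\lambda_j$ for some $j\in\{1,\dots,n\}$; $M_{p,1}^{\leftarrow}=+$ for $1\le p\le n$; $M_{1,q}^{\downarrow}=+$ for $1\le q\le s$; $M_{p,s}^{\rightarrow}=-$ for $1\le p\le n$. Boxes. $\beta(M)$ is the set of $(p,q)$, $1\le p\le n$, $1\le q\le s$, with $M_{p,q}$ of type 2; its elements are the boxes of $M$. Signatures. For $i\in I$, list the boxes $(p,q)\in\beta(M)$ with $p\in\{i,i+1\}$ in increasing order for $(p,q)\preceq(p',q')\iff q<q'$ or ($q=q'$ and $p\le p'$), and write the letter $\mathsf L$ for a box in row $i$ and $\mathsf R$ for a box in row $i+1$. The resulting word is the $i$-signature $\sigma_i(M)$. The reduced $i$-signature $\sigma_i^{\mathrm{red}}(M)$ is obtained by repeatedly deleting (adjacent) subwords $\mathsf L\mathsf R$ until a word $\mathsf R^{a}\mathsf L^{b}$ remains; each surviving letter corresponds to a box. Crystal operators $\tilde f_i,\tilde e_i:\mathcal{M}(\lambda)\to\mathcal{M}(\lambda)\cup\{0\}$. If $\mathsf L$ does not occur in $\sigma_i^{\mathrm{red}}(M)$, $\tilde f_i(M)=0$. Otherwise let $(i,q)$ be the box of the first $\mathsf L$ in $\sigma_i^{\mathrm{red}}(M)$; then $q\ge2$,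 the edge signs $M_{i+1,q-1}^{\rightarrow},M_{i,q-1}^{\rightarrow},M_{i,q-1}^{\uparrow},M_{i,q}^{\uparrow}$ (the four interior edges of the $2\times2$ block in rows $i,i+1$ and columns $q-1,q$) are $+,-,-,+$ respectively, and $\tilde f_i(M)$ is $M$ with these four signs replaced by $-,+,+,-$ and all other signs unchanged. If $\mathsf R$ does not occur in $\sigma_i^{\mathrm{red}}(M)$, $\tilde e_i(M)=0$. Otherwise let $(i+1,q)$ be the box of the last $\mathsf R$ in $\sigma_i^{\mathrm{red}}(M)$; then $q+1\le s$, the signs $M_{i+1,q}^{\rightarrow},M_{i,q}^{\rightarrow},M_{i,q}^{\uparrow},M_{i,q+1}^{\uparrow}$ are $-,+,+,-$ respectively, and $\tilde e_i(M)$ is $M$ with these replaced by $+,-,-,+$ and all other signs unchanged. (In each case the result again lies in $\mathcal{M}(\lambda)$.) Weights. $P=\big(\bigoplus_{i=1}^n\mathbb{Z}\epsilon_i\big)/\mathbb{Z}(\epsilon_1+\dots+\epsilon_n)$ is the weight lattice of $\mathfrak{sl}_n$, where $\epsilon_i$ reads the $i$-th diagonal entry; $\alpha_i=\epsilon_i-\epsilon_{i+1}$. The partition $\lambda$ is identified with the dominant weight $\sum_{i}\lambda_i\epsilon_i$. $\mathrm{wt}(M)=\sum_{i=1}^n a_i^M\epsilon_i$, $a_i^M=|\{(p,q)\in\beta(M):p=i\}|$. Isomorphism. An isomorphism of crystals is a bijection $\psi$ preserving $\mathrm{wt}$ and commuting with all $\tilde e_i,\tilde f_i$ (with $\psi(0)=0$).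 The crystal $\mathcal{B}(\lambda)$. This is Kashiwara's crystal of the irreducible $U_q(\mathfrak{sl}_n)$-module $V_q(\lambda)$ over $\mathbb{C}(q)$ with highest weight $\lambda$ and highest weight vector $v_\lambda$. Explicitly: each weight vector $u$ is uniquely $u=\sum_k f_i^{(k)}u_k$ with $e_iu_k=0$ (divided powers, and $f_i^{(k)}u_k=0$ only if $u_k=0$); the Kashiwara operators are $\tilde f_iu=\sum_k f_i^{(k+1)}u_k$, $\tilde e_iu=\sum_{k\ge1}f_i^{(k-1)}u_k$. Let $A_0\subset\mathbb{C}(q)$ be the rational functions regular at $q=0$ and $L(\lambda)$ the $A_0$-span of all $\tilde f_{i_1}\cdots\tilde f_{i_r}v_\lambda$. Then $\mathcal{B}(\lambda)$ is the set of nonzero images of these vectors in $L(\lambda)/qL(\lambda)$, with the induced operators $\tilde e_i,\tilde f_i$ and weights. *)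

(* Defs.v *)
From HB Require Import structures.
From mathcomp Require Import all_boot all_order all_algebra.
From mathcomp Require Import generic_quotient ring_quotient fraction complex.
From mathcomp Require Import boolp classical_sets functions reals.

Set Implicit Arguments.
Unset Strict Implicit.
Unset Printing Implicit Defensive.

Import GRing.Theory Num.Theory.

Local Open Scope ring_scope.
Local Open Scope quotient_scope.
Local Open Scope classical_set_scope.

(* Rows, columns and the elements of I are counted from 0, so that i : 'I_n.-1
   stands for the element i+1 of {1, .., n-1}. *)

Lemma ltn_succ_pred n (i : 'I_n.-1) : (i.+1 < n)%N.
Proof. by case: n i => [[] //|n] i; rewrite ltnS ltn_ord. Qed.

Definition fst_idx n (i : 'I_n.-1) : 'I_n := Ordinal (ltnW (ltn_succ_pred i)).
Definition snd_idx n (i : 'I_n.-1) : 'I_n := Ordinal (ltn_succ_pred i).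

(** * Weight lattice of sl_n *)

Definition diag_rV n : {pred 'rV[int]_n} :=
  fun x => [forall i, forall j, x 0 i == x 0 j].

Lemma diag_rV_zmod_closed n : zmod_closed (@diag_rV n).
Proof.
split=> [|x y /forallP xD /forallP yD].
  by apply/forallP => i; apply/forallP => j; rewrite !mxE.
apply/forallP => i; apply/forallP => j; rewrite !mxE.
by rewrite (eqP (forallP (xD i) j)) (eqP (forallP (yD i) j)).
Qed.

HB.instance Definition _ n :=
  GRing.isZmodClosed.Build 'rV[int]_n (@diag_rV n) (@diag_rV_zmod_closed n).

Definition weight_lattice n := Quotient.quot (@diag_rV n).
HB.instance Definition _ n := GRing.Zmodule.on (weight_lattice n).
HB.instance Definition _ n := EqQuotient.on (weight_lattice n).

Definition eps n (i : 'I_n) : weight_lattice n :=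
  \pi_(weight_lattice n) (delta_mx 0 i).

Definition alpha n (i : 'I_n.-1) : weight_lattice n :=
  eps (fst_idx i) - eps (snd_idx i).

(* The pairing with the simple coroot h_i; independent of the representative. *)
Definition coroot n (i : 'I_n.-1) (mu : weight_lattice n) : int :=
  repr mu 0 (fst_idx i) - repr mu 0 (snd_idx i).

Lemma coroot_pi n (i : 'I_n.-1) (x : 'rV[int]_n) :
  coroot i (\pi_(weight_lattice n) x) = x 0 (fst_idx i) - x 0 (snd_idx i).
Proof.
rewrite /coroot; set y := repr _.
have : y == x %[mod weight_lattice n] by rewrite reprK.
rewrite -Quotient.idealrBE => /forallP/(_ (fst_idx i))/forallP/(_ (snd_idx i)).
rewrite !mxE => /eqP h; apply/eqP; rewrite subr_eq addrAC -addrA -h.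
by rewrite addrCA subrr addr0.
Qed.

Definition partition_weight n (lam : n.-tuple nat) : weight_lattice n :=
  \sum_(i < n) eps i *+ tnth lam i.

(** * Crystals *)

(* A crystal is given inside an ambient type containing its zero, the result
   of an undefined application of an operator. *)
Record crystal n := Crystal {
  cr_type :> Type;
  cr_zero : cr_type;
  cr_elts : set cr_type;
  cr_wt : cr_type -> weight_lattice n;
  cr_e : 'I_n.-1 -> cr_type -> cr_type;
  cr_f : 'I_n.-1 -> cr_type -> cr_type }.

Arguments cr_zero {n} _.
Arguments cr_elts {n} _ _.
Arguments cr_wt {n} _ _.
Arguments cr_e {n} _ _ _.
Arguments cr_f {n} _ _ _.

Definition crystal_isomorphic n (A B : crystal n) : Prop :=
  exists psi : A -> B,
    [/\ psi (cr_zero A) = cr_zero B,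
        set_bij (cr_elts A) (cr_elts B) psi,
        forall x, cr_elts A x -> cr_wt B (psi x) = cr_wt A x,
        forall i x, cr_elts A x -> psi (cr_e A i x) = cr_e B i (psi x)
      & forall i x, cr_elts A x -> psi (cr_f A i x) = cr_f B i (psi x)].

(** * Five-vertex ice models *)

(* Signs are booleans: + is true and - is false. The vertical edge (p, q) is
   the bottom edge of vertex (p, q), and the horizontal edge (p, q) is its left
   edge; rows are counted from bottom to top. *)
Notation sgP := true.
Notation sgN := false.

Definition ice n s : Type :=
  {ffun 'I_n.+1 * 'I_s -> bool} * {ffun 'I_n * 'I_s.+1 -> bool}.

Definition up n s (M : ice n s) (p : 'I_n) (q : 'I_s) : bool :=
  M.1 (lift ord0 p, q).
Definition left n s (M : ice n s) (p : 'I_n) (q : 'I_s) : bool :=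
  M.2 (p, widen_ord (leqnSn s) q).
Definition right n s (M : ice n s) (p : 'I_n) (q : 'I_s) : bool :=
  M.2 (p, lift ord0 q).
Definition down n s (M : ice n s) (p : 'I_n) (q : 'I_s) : bool :=
  M.1 (widen_ord (leqnSn n) p, q).

Definition vertex n s (M : ice n s) p q : bool * bool * bool * bool :=
  (up M p q, left M p q, right M p q, down M p q).

Definition type1 := (sgP, sgP, sgP, sgP).
Definition type2 := (sgP, sgN, sgN, sgP).
Definition type3 := (sgP, sgN, sgP, sgN).
Definition type4 := (sgN, sgP, sgN, sgP).
Definition type5 := (sgN, sgN, sgN, sgN).

Definition five_vertex n s (M : ice n s) : Prop :=
  forall p q, vertex M p q \in [:: type1; type2; type3; type4; type5].

Definition ncols n (lam : n.-tuple nat) : nat := (nth 0 lam 0 + n)%N.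

(* Subtracting the common offset 1 of the column q and of the index j, the
   condition q = lam_1 + j - lam_j keeps its form. *)
Definition ice_models n (lam : n.-tuple nat) : set (ice n (ncols lam)) :=
  [set M | [/\ five_vertex M,
     forall (p : 'I_n) (q : 'I_(ncols lam)), p.+1 = n ->
       (up M p q = sgN <->
        exists j : 'I_n, (q : nat) = (nth 0 lam 0 + j - tnth lam j)%N),
     forall (p : 'I_n) (q : 'I_(ncols lam)), (q : nat) = 0%N ->
       left M p q = sgP,
     forall (p : 'I_n) (q : 'I_(ncols lam)), (p : nat) = 0%N ->
       down M p q = sgP
   & forall (p : 'I_n) (q : 'I_(ncols lam)), q.+1 = ncols lam ->
       right M p q = sgN]].

Arguments ice_models {n} lam _.

Definition is_box n s (M : ice n s) (p : 'I_n) (q : 'I_s) : bool :=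
  vertex M p q == type2.

Variant letter := L | R.

Definition is_L (x : letter) := if x is L then true else false.

(* Each letter is paired with the column of its box. *)
Definition signature n s (M : ice n s) (i : 'I_n.-1) : seq (letter * 'I_s) :=
  flatten [seq (if is_box M (fst_idx i) q then [:: (L, q)] else [::]) ++
               (if is_box M (snd_idx i) q then [:: (R, q)] else [::])
          | q <- enum 'I_s].

(* Deletes the first adjacent subword L R, if any. *)
Fixpoint delete_LR s (w : seq (letter * 'I_s)) : seq (letter * 'I_s) :=
  match w with
  | (L, _) :: ((R, _) :: w') => w'
  | x :: w' => x :: delete_LR w'
  | [::] => [::]
  end.

Definition reduced_signature n s (M : ice n s) (i : 'I_n.-1) :=
  let w := signature M i in iter (size w) (@delete_LR s) w.

(* f_i acts on the block of rows i, i+1 and columns q-1, q. *)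
Definition flip_f n s (M : ice n s) (i : 'I_n.-1) (q : 'I_s) : ice n s :=
  ([ffun x : 'I_n.+1 * 'I_s =>
      if (x.1 == i.+1 :> nat) && (x.2.+1 == q :> nat) then sgP
      else if (x.1 == i.+1 :> nat) && (x.2 == q) then sgN
      else M.1 x],
   [ffun x : 'I_n * 'I_s.+1 =>
      if (x.1 == snd_idx i) && (x.2 == q :> nat) then sgN
      else if (x.1 == fst_idx i) && (x.2 == q :> nat) then sgP
      else M.2 x]).

(* e_i acts on the block of rows i, i+1 and columns q, q+1. *)
Definition flip_e n s (M : ice n s) (i : 'I_n.-1) (q : 'I_s) : ice n s :=
  ([ffun x : 'I_n.+1 * 'I_s =>
      if (x.1 == i.+1 :> nat) && (x.2 == q) then sgN
      else if (x.1 == i.+1 :> nat) && (x.2 == q.+1 :> nat) then sgP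
      else M.1 x],
   [ffun x : 'I_n * 'I_s.+1 =>
      if (x.1 == snd_idx i) && (x.2 == q.+1 :> nat) then sgP
      else if (x.1 == fst_idx i) && (x.2 == q.+1 :> nat) then sgN
      else M.2 x]).

Definition ice_f n s (i : 'I_n.-1) (M : ice n s) : option (ice n s) :=
  if [seq x.2 | x <- reduced_signature M i & is_L x.1] is q :: _
  then Some (flip_f M i q) else None.

Definition ice_e n s (i : 'I_n.-1) (M : ice n s) : option (ice n s) :=
  if [seq x.2 | x <- reduced_signature M i & ~~ is_L x.1] is q :: qs
  then Some (flip_e M i (last q qs)) else None.

Definition ice_wt n s (M : ice n s) : weight_lattice n :=
  \sum_(i < n) eps i *+ #|[set q | is_box M i q]%SET|.

Definition ice_crystal n (lam : n.-tuple nat) : crystal n :=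
  {| cr_type := option (ice n (ncols lam));
     cr_zero := None;
     cr_elts := [set Some M | M in ice_models lam];
     cr_wt := oapp (@ice_wt n (ncols lam)) 0;
     cr_e := fun i => obind (ice_e i);
     cr_f := fun i => obind (ice_f i) |}.

(** * Modules over U_q(sl_n) *)

Definition cartan n (i j : 'I_n.-1) : int :=
  if i == j then 2
  else if (i.+1 == j :> nat) || (j.+1 == i :> nat) then -1 else 0.

(* A U_q(sl_n)-module is a vector space with operators satisfying the defining
   relations of the generators e_i, f_i, K_i, K_i^-1. *)
Record uq_module (F : fieldType) (q : F) (n : nat) := UqModule {
  uq_space :> lmodType F;
  uq_e : 'I_n.-1 -> {linear uq_space -> uq_space};
  uq_f : 'I_n.-1 -> {linear uq_space -> uq_space};
  uq_K : 'I_n.-1 -> {linear uq_space -> uq_space};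
  uq_Kinv : 'I_n.-1 -> {linear uq_space -> uq_space};
  uq_KKinv : forall i u, uq_K i (uq_Kinv i u) = u;
  uq_KinvK : forall i u, uq_Kinv i (uq_K i u) = u;
  uq_KC : forall i j u, uq_K i (uq_K j u) = uq_K j (uq_K i u);
  uq_Ke : forall i j u,
    uq_K i (uq_e j (uq_Kinv i u)) = q ^ cartan i j *: uq_e j u;
  uq_Kf : forall i j u,
    uq_K i (uq_f j (uq_Kinv i u)) = q ^ (- cartan i j) *: uq_f j u;
  uq_ef : forall i j u,
    uq_e i (uq_f j u) - uq_f j (uq_e i u) =
    if i == j then (q - q^-1)^-1 *: (uq_K i u - uq_Kinv i u) else 0;
  uq_eC : forall i j u, cartan i j = 0 ->
    uq_e i (uq_e j u) = uq_e j (uq_e i u);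
  uq_fC : forall i j u, cartan i j = 0 ->
    uq_f i (uq_f j u) = uq_f j (uq_f i u);
  uq_eS : forall i j u, cartan i j = -1 ->
    uq_e i (uq_e i (uq_e j u)) - (q + q^-1) *: uq_e i (uq_e j (uq_e i u))
      + uq_e j (uq_e i (uq_e i u)) = 0;
  uq_fS : forall i j u, cartan i j = -1 ->
    uq_f i (uq_f i (uq_f j u)) - (q + q^-1) *: uq_f i (uq_f j (uq_f i u))
      + uq_f j (uq_f i (uq_f i u)) = 0 }.

Arguments uq_e {F q n _} _.
Arguments uq_f {F q n _} _.
Arguments uq_K {F q n _} _.
Arguments uq_Kinv {F q n _} _.

Definition uq_submodule (F : fieldType) (q : F) n (V : uq_module q n) (W : set V) : Prop :=
  [/\ W 0,
      forall (a : F) u w, W u -> W w -> W (a *: u + w),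
      forall i u, W u -> W (uq_e i u) /\ W (uq_f i u)
    & forall i u, W u -> W (uq_K i u) /\ W (uq_Kinv i u)].

Definition uq_irreducible (F : fieldType) (q : F) n (V : uq_module q n) : Prop :=
  (exists u : V, u != 0) /\
  forall W : set V, uq_submodule W -> W = [set 0] \/ W = setT.

Definition weight_vector (F : fieldType) (q : F) n (V : uq_module q n)
    (mu : weight_lattice n) (u : V) : Prop :=
  forall i, uq_K i u = q ^ coroot i mu *: u.

Definition highest_weight_vector (F : fieldType) (q : F) n (V : uq_module q n)
    (mu : weight_lattice n) (v : V) : Prop :=
  [/\ v != 0, weight_vector mu v & forall i, uq_e i v = 0].

(** * Kashiwara operators *)

Definition qint (F : fieldType) (q : F) (k : nat) : F :=
  (q ^+ k - q ^- k) / (q - q^-1).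

Definition qfact (F : fieldType) (q : F) (k : nat) : F :=
  \prod_(j < k) qint q j.+1.

Definition divided_f (F : fieldType) (q : F) n (V : uq_module q n) i (k : nat) (u : V) : V :=
  (qfact q k)^-1 *: iter k (uq_f i) u.

(* The decomposition u = sum_k f_i^(k) u_k of a vector u of weight mu. The u_k
   are weight vectors too, of the only possible weight: the decomposition would
   not be unique otherwise. *)
Definition string_decomposition (F : fieldType) (q : F) n (V : uq_module q n) i
    (mu : weight_lattice n) (u : V) (us : seq V) : Prop :=
  [/\ weight_vector mu u,
      u = \sum_(0 <= k < size us) divided_f i k us`_k
    & forall k, (k < size us)%N ->
        [/\ weight_vector (mu + alpha i *+ k) us`_k,
            uq_e i us`_k = 0
          & divided_f i k us`_k = 0 -> us`_k = 0]].

Definition kashiwara_f_wt (F : fieldType) (q : F) n (V : uq_module q n) i (u w : V) : Prop :=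
  exists mu us, string_decomposition i mu u us /\
    w = \sum_(0 <= k < size us) divided_f i k.+1 us`_k.

Definition kashiwara_e_wt (F : fieldType) (q : F) n (V : uq_module q n) i (u w : V) : Prop :=
  exists mu us, string_decomposition i mu u us /\
    w = \sum_(1 <= k < size us) divided_f i k.-1 us`_k.

(* Extension by additivity of an operator given by its graph G on the weight
   vectors, in a module spanned by its weight vectors. *)
Definition additive_extension (F : fieldType) (q : F) n (V : uq_module q n)
    (G : V -> V -> Prop) (u : V) : V :=
  xget 0 [set w | exists s : seq (V * V),
    [/\ forall x, x \in s -> G x.1 x.2,
        u = \sum_(x <- s) x.1
      & w = \sum_(x <- s) x.2]].

Definition kashiwara_f (F : fieldType) (q : F) n (V : uq_module q n) i : V -> V :=
  additive_extension (kashiwara_f_wt i).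
Definition kashiwara_e (F : fieldType) (q : F) n (V : uq_module q n) i : V -> V :=
  additive_extension (kashiwara_e_wt i).

(** * The crystal of an irreducible highest weight module *)

Notation ratfrac K := {fraction {poly K}}.

Definition qvar (K : fieldType) : ratfrac K := tofrac 'X.

Definition regular0 (K : fieldType) : set (ratfrac K) :=
  [set x | exists a b : {poly K}, b.[0] != 0 /\ x = tofrac a / tofrac b].

(* The vectors f_{i_1} .. f_{i_r} v for the Kashiwara operators f_i *)
Definition f_monomials (K : fieldType) n (V : uq_module (qvar K) n) (v : V)
    : set V :=
  [set u | exists s : seq 'I_n.-1,
     u = foldr (fun i x => kashiwara_f i x) v s].

Definition lattice (K : fieldType) n (V : uq_module (qvar K) n) (v : V)
    : set V :=
  [set u | exists s : seq (ratfrac K * V),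
     (forall x, x \in s -> regular0 x.1 /\ f_monomials v x.2) /\
     u = \sum_(x <- s) x.1 *: x.2].

Definition q_lattice (K : fieldType) n (V : uq_module (qvar K) n) (v : V)
    : set V :=
  [set qvar K *: u | u in lattice v].

(* Elements of lattice v / q_lattice v are represented as cosets, i.e. as
   subsets of V. *)
Definition coset_mod (K : fieldType) n (V : uq_module (qvar K) n) (v u : V)
    : set V :=
  [set w | q_lattice v (w - u)].

Definition induced (K : fieldType) n (V : uq_module (qvar K) n) (v : V)
    (T : V -> V) (C : set V) : set V :=
  [set w | exists2 u, C u & q_lattice v (w - T u)].

(* The weight of the class of a weight vector *)
Definition coset_wt (K : fieldType) n (V : uq_module (qvar K) n) (C : set V)
    : weight_lattice n :=
  xget 0 [set mu | exists2 u, C u & weight_vector mu u].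

Definition kashiwara_crystal (K : fieldType) n (V : uq_module (qvar K) n)
    (v : V) : crystal n :=
  {| cr_type := set V;
     cr_zero := coset_mod v 0;
     cr_elts := [set C | exists u,
       [/\ f_monomials v u, C = coset_mod v u & C <> coset_mod v 0]];
     cr_wt := @coset_wt K n V;
     cr_e := fun i => induced v (kashiwara_e i);
     cr_f := fun i => induced v (kashiwara_f i) |}.

(* Main.v *)
From HB Require Import structures.
Require Import Defs.
From mathcomp Require Import all_boot all_order all_algebra.
From mathcomp Require Import complex reals.
From mathcomp Require Import generic_quotient ring_quotient fraction boolp classical_sets functions.
From mathcomp Require Import fingroup perm ring zify.

(* The rows of the boxes of an ice model, read along antidiagonals, form a word
   on which the operators e_i and f_i act by the signature rule, that is, as on
   the crystal of a tensor power of the vector representation.  A model killed by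
   all e_i is unique, and moving up by the e_i shows that its word w generates
   the words of all models, and that a model is determined by its word.

   On the quantum side, for each highest weight word w of length N, a highest
   weight vector of the N-th tensor power congruent to w modulo q is built by
   induction on N, with lowering operators; the modules generated by these
   vectors are pairwise orthogonal for an invariant form that is orthonormal on
   words.  On bases of the tensor power adapted to the i-strings, the Kashiwara
   operators preserve the standard lattice and act modulo q as the operators on
   words.  The irreducible module V is identified with the module generated by
   the vector of w, so that its crystal consists of the words generated by w. *)

Set Implicit Arguments.
Unset Strict Implicit.
Unset Printing Implicit Defensive.

Import Order.TTheory GRing.Theory Num.Theory.
Local Open Scope ring_scope.

(** * Valuation rings and quantum integers *)

(** The argument presupposes neither the existence of crystal bases nor complete reducibility. Both
    are replaced by one fact: a matrix congruent to the identity modulo q is invertible over the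
    regular elements, so a family of vectors congruent to the words is a basis of the standard
    lattice. Two kinds of such families occur. The string decompositions for different i are
    unrelated, so there is one adapted basis for each i, with explicit coefficients. The other
    family consists of Kashiwara monomials applied to the highest weight vectors. Orthogonality lets
    a vector of one submodule be expanded in the monomials of that submodule alone, with
    coefficients that stay regular; this identifies the lattice generated in V by the Kashiwara
    monomials with the trace of the standard lattice on the submodule. Only the valuation properties
    of the functions regular at 0 enter, which is why the field is kept abstract: non-regular
    elements have their inverse in the ideal generated by q, and 1/q is not regular. *)

Record valuation_ring_at (F : fieldType) (q : F) (reg : F -> Prop) : Prop := {
  vr1 : reg 1;
  vrB : forall x y, reg x -> reg y -> reg (x - y);
  vrM : forall x y, reg x -> reg y -> reg (x * y);
  vrq : reg q;
  vr_val : forall x, ~ reg x -> exists2 y, reg y & x^-1 = q * y;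
  vr_qV : ~ reg q^-1 }.

Section ValuationRing.
Variables (F : fieldType) (q : F) (reg : F -> Prop).
Hypothesis vr : valuation_ring_at q reg.

Definition vanishing (x : F) := exists2 y, reg y & x = q * y.
Local Notation van := vanishing.

Lemma reg0 : reg 0. Proof. by rewrite -(subrr 1); apply: (vrB vr); apply: (vr1 vr). Qed.

Lemma regN x : reg x -> reg (- x).
Proof. by rewrite -sub0r => ?; apply: (vrB vr) => //; apply: reg0. Qed.

Lemma regD x y : reg x -> reg y -> reg (x + y).
Proof. by move=> rx ry; rewrite -(opprK y); apply: (vrB vr) => //; apply: regN. Qed.

Lemma reg_sum I (r : seq I) (P : pred I) (E : I -> F) :
  (forall i, P i -> reg (E i)) -> reg (\sum_(i <- r | P i) E i).
Proof. by move=> rE; elim/big_ind: _ => //; [apply: reg0 | apply: regD]. Qed.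

Lemma reg_prod I (r : seq I) (P : pred I) (E : I -> F) :
  (forall i, P i -> reg (E i)) -> reg (\prod_(i <- r | P i) E i).
Proof. by move=> rE; elim/big_ind: _ => //; [apply: (vr1 vr) | apply: (vrM vr)]. Qed.

Lemma regX x k : reg x -> reg (x ^+ k).
Proof.
move=> rx; elim: k => [|k IH]; first by rewrite expr0; apply: (vr1 vr).
by rewrite exprS; apply: (vrM vr).
Qed.

Lemma vanW x : van x -> reg x.
Proof. by case=> y ry ->; apply: (vrM vr) => //; apply: (vrq vr). Qed.

Lemma van0 : van 0. Proof. by exists 0; [apply: reg0 | rewrite mulr0]. Qed.

Lemma vanD x y : van x -> van y -> van (x + y).
Proof.
by move=> [u ru ->] [w rw ->]; exists (u + w); rewrite ?mulrDr //; apply: regD.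
Qed.

Lemma vanMl x y : reg x -> van y -> van (x * y).
Proof.
by move=> rx [w rw ->]; exists (x * w); [apply: (vrM vr) | rewrite mulrCA].
Qed.

Lemma vanMr x y : van x -> reg y -> van (x * y).
Proof. by move=> ? ?; rewrite mulrC; apply: vanMl. Qed.

Lemma vanN x : van x -> van (- x).
Proof. by move=> [y ry ->]; exists (- y); [apply: regN | rewrite mulrN]. Qed.

Lemma vanB x y : van x -> van y -> van (x - y).
Proof. by move=> vx vy; apply: vanD => //; apply: vanN. Qed.

Lemma van_sum I (r : seq I) (P : pred I) (E : I -> F) :
  (forall i, P i -> van (E i)) -> van (\sum_(i <- r | P i) E i).
Proof. by move=> rE; elim/big_ind: _ => //; [apply: van0 | apply: vanD]. Qed.

Lemma q_neq0 : q != 0.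
Proof. by apply/eqP => q0; apply: (vr_qV vr); rewrite q0 invr0; apply: reg0. Qed.

Lemma van_q x : reg x -> van (q * x). Proof. by exists x. Qed.

Lemma van_qX k : van (q ^+ k.+1).
Proof. by rewrite exprS; apply: van_q; apply: regX; apply: (vrq vr). Qed.

Lemma not_van1 : ~ van 1.
Proof.
move=> [y ry e]; apply: (vr_qV vr); suff -> : q^-1 = y by [].
by rewrite -[LHS]mulr1 e mulKf // q_neq0.
Qed.

Lemma cong1_neq0 x : van (x - 1) -> x != 0.
Proof.
move=> vx; apply/eqP => x0; apply: not_van1.
by move: vx; rewrite x0 sub0r => /vanN; rewrite opprK.
Qed.

Lemma reg_cong1 x : van (x - 1) -> reg x.
Proof. by move=> /vanW rx; rewrite -(subrK 1 x); apply: regD => //; apply: (vr1 vr). Qed.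

Lemma reg_inv x : reg x -> ~ van x -> reg x^-1.
Proof.
move=> rx nvx; apply: contrapT => /(vr_val vr) [y ry]; rewrite invrK => e.
by apply: nvx; exists y.
Qed.

Lemma reg_inv_cong1 x : van (x - 1) -> reg x^-1.
Proof.
move=> vx; apply: reg_inv; first exact: reg_cong1.
move=> vx'; apply: not_van1; rewrite (_ : 1 = x - (x - 1)); first exact: vanB.
by rewrite opprB addrCA subrr addr0.
Qed.

Lemma cong1V x : van (x - 1) -> van (x^-1 - 1).
Proof.
move=> vx; have x0 := cong1_neq0 vx.
rewrite (_ : x^-1 - 1 = - (x^-1 * (x - 1))).
  by apply/vanN/vanMl => //; apply: reg_inv_cong1.
by rewrite mulrBr mulVf // mulr1 opprB.
Qed.

Lemma cong1M x y : van (x - 1) -> van (y - 1) -> van (x * y - 1).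
Proof.
move=> vx vy; rewrite (_ : _ - 1 = x * (y - 1) + (x - 1)).
  by apply: vanD => //; apply: vanMl => //; apply: reg_cong1.
by rewrite mulrBr mulr1 addrA subrK.
Qed.

Lemma cong1_prod I (r : seq I) (P : pred I) (E : I -> F) :
  (forall i, P i -> van (E i - 1)) -> van (\prod_(i <- r | P i) E i - 1).
Proof.
move=> rE; elim/big_ind: _ => //; last exact: cong1M.
by rewrite subrr; apply: van0.
Qed.

Lemma q_exp_neq1 k : (0 < k)%N -> q ^+ k != 1.
Proof.
case: k => // k _; apply/eqP => e; apply: (vr_qV vr).
rewrite (_ : q^-1 = q ^+ k); first by apply: regX; apply: (vrq vr).
by rewrite -[LHS]mulr1 -e exprS mulKf // q_neq0.
Qed.

Lemma q_expz_neq1 (m : int) : m != 0 -> q ^ m != 1.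
Proof.
case: m => [[|k]|k] // _; first by rewrite -exprnP q_exp_neq1.
by rewrite NegzE -exprnN invr_eq1 q_exp_neq1.
Qed.

Lemma q_expz_neq0 (m : int) : q ^ m != 0.
Proof. by rewrite expfz_neq0 // q_neq0. Qed.

(** Weights can therefore be read off from the eigenvalues of the [K] operators. *)
Lemma q_expzI : injective (fun m : int => q ^ m).
Proof.
move=> m p /= e; apply/eqP; rewrite -subr_eq0; apply: contraT => /q_expz_neq1.
by rewrite expfzDr ?q_neq0 // e -expfzDr ?q_neq0 // subrr expr0z eqxx.
Qed.

(** Take for [c] the inverse of an entry of least valuation: along the list, the current [c] is kept
    as long as the new entry becomes regular after scaling, and is replaced by the inverse of that
    entry otherwise. *)
Lemma exists_primitive_scaling (s : seq F) :
  has (fun x => x != 0) s ->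
  exists c, [/\ c != 0, forall x, x \in s -> reg (c * x)
                      & exists2 x, x \in s & ~ van (c * x)].
Proof.
elim: s => //= x s IH; case: (boolP (has _ s)) => [hs _|hs]; last first.
  rewrite orbF => x0; exists x^-1; split; first by rewrite invr_eq0.
    move=> y; rewrite inE => /orP[/eqP ->|ys]; first by rewrite mulVf //; apply: (vr1 vr).
    move/hasPn/(_ _ ys): hs; rewrite negbK => /eqP ->; rewrite mulr0; exact: reg0.
  exists x; first by rewrite inE eqxx.
  by rewrite mulVf //; apply: not_van1.
have [c [c0 rc [y ys nvy]]] := IH hs.
case: (pselect (reg (c * x))) => [rx|nrx].
  exists c; split=> //; last by exists y => //; rewrite inE ys orbT.
  by move=> z; rewrite inE => /orP[/eqP ->|/rc].
have x0 : x != 0 by apply/eqP => x0; apply: nrx; rewrite x0 mulr0; apply: reg0.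
exists x^-1; split; first by rewrite invr_eq0.
  move=> z; rewrite inE => /orP[/eqP ->|/rc rz]; first by rewrite mulVf //; apply: (vr1 vr).
  have [u ru eu] := vr_val vr nrx.
  have -> : x^-1 * z = (q * u) * (c * z).
    by rewrite -eu invfM mulrACA mulVf ?mul1r.
  by apply: (vrM vr) => //; apply: (vrM vr) => //; apply: (vrq vr).
by exists x; rewrite ?inE ?eqxx // mulVf //; apply: not_van1.
Qed.

(** The quantum integer at an arbitrary integer, since it will be evaluated at weights. *)
Definition br (m : int) : F := (q ^ m - q ^ (- m)) / (q - q^-1).

Lemma q_qV_neq0 : q - q^-1 != 0.
Proof.
rewrite subr_eq0; apply: contraTneq (q_exp_neq1 (isT : (0 < 2)%N)) => e.
by rewrite negbK expr2 {1}e mulVf // q_neq0.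
Qed.

Lemma br_qint k : br k%:Z = qint q k.
Proof. by rewrite /br /qint -exprnP -exprnN. Qed.

Lemma br0 : br 0 = 0. Proof. by rewrite /br oppr0 subrr mul0r. Qed.
Lemma br1 : br 1 = 1.
Proof. by rewrite /br expr1z exprN1 divff // q_qV_neq0. Qed.
Lemma brN m : br (- m) = - br m.
Proof. by rewrite /br opprK -mulNr opprB. Qed.

Lemma br_neq0 m : m != 0 -> br m != 0.
Proof.
move=> m0; rewrite mulf_neq0 ?invr_eq0 ?q_qV_neq0 // subr_eq0.
apply: contraNneq m0 => /q_expzI e; apply/eqP; lia.
Qed.

(* [gq k = q^(k-1) [k]] is congruent to 1 modulo q, so ratios of quantum
   integers are, up to powers of q, units congruent to 1. *)
Definition gq (k : nat) : F := \sum_(j < k) q ^+ (2 * j).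

Lemma gq0 : gq 0 = 0. Proof. exact: big_ord0. Qed.
Lemma gqS k : gq k.+1 = 1 + q ^+ 2 * gq k.
Proof.
rewrite /gq big_ord_recl muln0 expr0 mulr_sumr; congr (_ + _).
by apply: eq_bigr => j _; rewrite -exprD -mulnS.
Qed.
Lemma gqSr k : gq k.+1 = gq k + q ^+ (2 * k).
Proof. by rewrite /gq big_ord_recr. Qed.

Lemma reg_gq k : reg (gq k).
Proof. by apply: reg_sum => j _; apply: regX; apply: (vrq vr). Qed.

Lemma gq_cong1 k : van (gq k.+1 - 1).
Proof.
rewrite gqS addrAC subrr add0r expr2 -mulrA; apply: van_q.
by apply: (vrM vr); [apply: (vrq vr) | apply: reg_gq].
Qed.

Lemma gq_neq0 k : gq k.+1 != 0. Proof. exact/cong1_neq0/gq_cong1. Qed.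

Lemma gqE k : (q ^+ 2 - 1) * gq k = q ^+ (2 * k) - 1.
Proof.
elim: k => [|k IH]; first by rewrite gq0 mulr0 muln0 expr0 subrr.
by rewrite gqSr mulrDr IH mulnS exprD; ring.
Qed.

Lemma gq_br k : gq k = q ^ (k%:Z - 1) * br k%:Z.
Proof.
have q0 := q_neq0.
rewrite /br expfzDr // exprN1 -exprnN -exprnP.
have h : q ^+ 2 - 1 != 0 by rewrite subr_eq0 q_exp_neq1.
apply: (mulfI h); rewrite gqE mulnC exprM.
have qk0 : q ^+ k != 0 by rewrite expf_neq0.
have h2 := q_qV_neq0.
have -> : q ^- k = (q ^+ k)^-1 by [].
move: (q ^+ k) qk0 => u u0.
field.
by rewrite u0 q0 -expr2 h.
Qed.

Lemma reg_det m (A : 'M[F]_m) : (forall i j, reg (A i j)) -> reg (\det A).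
Proof.
move=> rA; apply: reg_sum => s _; apply: (vrM vr); last by apply: reg_prod.
by apply: regX; apply: regN; apply: (vr1 vr).
Qed.

(** In the Leibniz expansion the identity contributes a product of entries congruent to 1; any other
    permutation moves some index, hence its product has a vanishing factor. *)
Lemma det_cong1 m (A : 'M[F]_m) :
  (forall i j, van (A i j - (i == j)%:R)) -> van (\det A - 1).
Proof.
move=> vA; have rA i j : reg (A i j).
  rewrite -(subrK (i == j)%:R (A i j)); apply: regD; first exact: vanW.
  by case: (_ == _); [apply: (vr1 vr) | apply: reg0].
rewrite /determinant (bigD1 (1%g : 'S_m)) //= odd_perm1 expr0 mul1r addrAC.
apply: vanD.
  by apply: cong1_prod => i _; rewrite perm1; move: (vA i i); rewrite eqxx.
apply: van_sum => s s1; apply: vanMl.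
  by apply: regX; apply: regN; apply: (vr1 vr).
have [i si] : exists i, s i != i.
  apply/existsP; apply: contraNT s1; rewrite negb_exists => /forallP e.
  by apply/eqP/permP => i; rewrite perm1; apply/eqP; rewrite -[_ == _]negbK.
rewrite (bigD1 i) //=; apply: vanMr; last by apply: reg_prod.
by move: (vA i (s i)); rewrite eq_sym (negPf si) subr0.
Qed.

(** The determinant is a unit of the regular ring, so the cofactor formula gives a regular inverse
    C, and C - 1 = - C (A - 1) vanishes modulo q. Matrices indexed by a finite type are used because
    the indices will be words of a fixed length. *)
Lemma inverse_kernel_cong1 (T : finType) (A : T -> T -> F) :
  (forall a b, van (A a b - (a == b)%:R)) ->
  exists C : T -> T -> F,
    [/\ forall a b, van (C a b - (a == b)%:R),
        forall a b, \sum_c A a c * C c b = (a == b)%:R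
      & forall a b, \sum_c C a c * A c b = (a == b)%:R].
Proof.
move=> vA; pose M := \matrix_(i < #|T|, j < #|T|) A (enum_val i) (enum_val j).
have vM i j : van (M i j - (i == j)%:R).
  by rewrite mxE; have := vA (enum_val i) (enum_val j); rewrite (inj_eq enum_val_inj).
have d1 := det_cong1 vM.
have uM : M \in unitmx by rewrite unitmxE unitfE; apply: cong1_neq0.
have rA a b : reg (A a b).
  rewrite -(subrK (a == b)%:R (A a b)); apply: regD; first exact: vanW.
  by case: (_ == _); [apply: (vr1 vr) | apply: reg0].
have rC i j : reg (invmx M i j).
  rewrite /invmx uM !mxE; apply: (vrM vr); first exact: reg_inv_cong1.
  rewrite /cofactor; apply: (vrM vr).
    by apply: regX; apply: regN; apply: (vr1 vr).
  by apply: reg_det => k l; rewrite !mxE; apply: rA.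
have sumE (f : T -> F) : \sum_c f c = \sum_(k < #|T|) f (enum_val k).
  by rewrite (reindex _ (onW_bij _ (@enum_val_bij T))).
exists (fun a b => invmx M (enum_rank a) (enum_rank b)); split=> a b.
- pose i := enum_rank a; pose j := enum_rank b.
  rewrite -/i -/j -(inj_eq enum_rank_inj) -/i -/j.
  have -> : invmx M i j - (i == j)%:R = - (invmx M *m (M - 1%:M)) i j.
    by rewrite mulmxBr mulVmx // mulmx1 !mxE opprB.
  by apply: vanN; rewrite mxE; apply: van_sum => k _; apply: vanMl => //; rewrite !mxE; have := vM k j; rewrite mxE.
- rewrite sumE -(inj_eq enum_rank_inj).
  have /matrixP/(_ (enum_rank a) (enum_rank b)) := mulmxV uM.
  by rewrite !mxE => <-; apply: eq_bigr => k _; rewrite enum_valK !mxE enum_rankK.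
- rewrite sumE -(inj_eq enum_rank_inj).
  have /matrixP/(_ (enum_rank a) (enum_rank b)) := mulVmx uM.
  by rewrite !mxE => <-; apply: eq_bigr => k _; rewrite enum_valK !mxE enum_rankK.
Qed.

End ValuationRing.

(** * Rational functions regular at 0 *)

Section RationalFractions.
Variable K : fieldType.

Lemma fraction_quotient (R : idomainType) (x : {fraction R}) :
  exists a b : R, b != 0 /\ x = tofrac a / tofrac b.
Proof.
elim/quotW: x => r; exists r.1, r.2; have d0 := denom_ratioP r; split=> //.
have t0 : tofrac r.2 != 0 by rewrite tofrac_eq0.
apply: (mulIf t0); rewrite divfK //.
unlock FracField.tofrac; rewrite -[LHS]FracField.pi_mul.
apply/eqmodP; rewrite /= FracField.equivfE /FracField.mulf /=.
by rewrite !numden_Ratio ?mulr1 ?oner_eq0 // mulrC.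
Qed.

(** Cancel common factors X from a quotient a/b, by induction on the size of b. When b(0) is 0 but
    a(0) is not, writing b = b' X makes the inverse equal to X times the regular b'/a. *)
Lemma regular0_or_inverse (x : ratfrac K) :
  regular0 x \/ exists2 y, regular0 y & x^-1 = qvar K * y.
Proof.
have [a [b [b0 ->]]] := fraction_quotient x.
have [m] := ubnP (size b).
elim: m a b b0 => // m IH a b b0 sb.
have [bX|bX] := eqVneq b.[0] 0; last by left; exists a, b.
have /factor_theorem [b' eb] : root b 0 by apply/rootP.
rewrite subr0 in eb.
have X0 : tofrac 'X != 0 :> ratfrac K by rewrite tofrac_eq0 polyX_eq0.
have b'0 : b' != 0 by apply: contraNneq b0 => b'0; rewrite eb b'0 mul0r.
have sb' : (size b' < m)%N by move: sb; rewrite eb size_mulX.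
have [aX|aX] := eqVneq a.[0] 0.
  have /factor_theorem [a' ea] : root a 0 by apply/rootP.
  rewrite subr0 in ea.
  rewrite (_ : tofrac a / tofrac b = tofrac a' / tofrac b'); first exact: IH.
  by rewrite ea eb !rmorphM /= -mulf_div divff // mulr1.
right; exists (tofrac b' / tofrac a); first by exists b', a.
by rewrite invf_div eb rmorphM /= mulrA [tofrac b' * _]mulrC.
Qed.

Lemma regular0_valuation_ring : valuation_ring_at (qvar K) (@regular0 K).
Proof.
split.
- by exists 1, 1; rewrite hornerE oner_eq0 divr1 rmorph1.
- move=> _ _ [a [b [b0 ->]]] [c [d [d0 ->]]].
  exists (a * d - c * b), (b * d); rewrite hornerM mulf_neq0 //; split=> //.
  have nz (p : {poly K}) : p.[0] != 0 -> tofrac p != 0 :> ratfrac K.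
    by rewrite tofrac_eq0; apply: contraNneq => ->; rewrite horner0.
  by rewrite rmorphB !rmorphM /= -[in LHS]mulNr addf_div ?nz // mulNr.
- move=> _ _ [a [b [b0 ->]]] [c [d [d0 ->]]].
  exists (a * c), (b * d); rewrite hornerM mulf_neq0 //; split=> //.
  by rewrite !rmorphM /= mulf_div.
- by exists 'X, 1; rewrite hornerE oner_eq0 rmorph1 divr1.
- by move=> x nrx; case: (regular0_or_inverse x).
(* If 1/X were a/b, then b = a X would vanish at 0. *)
- move=> [a [b [b0 e]]].
  have X0 : tofrac 'X != 0 :> ratfrac K by rewrite tofrac_eq0 polyX_eq0.
  have t0 : tofrac b != 0 :> ratfrac K.
    by rewrite tofrac_eq0; apply: contraNneq b0 => ->; rewrite horner0.
  suff /eqP : tofrac b == tofrac (a * 'X) :> ratfrac K.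
    move=> /eqP; rewrite tofrac_eq => /eqP eb.
    by move: b0; rewrite eb hornerM hornerX mulr0 eqxx.
  have ea : tofrac a = (tofrac 'X)^-1 * tofrac b :> ratfrac K.
    by rewrite -[LHS](divfK t0) -e.
  by rewrite rmorphM /= ea mulrAC (mulVf X0) mul1r.
Qed.

End RationalFractions.

(** * Tensor powers of the vector representation *)

Lemma fst_neq_snd n (i : 'I_n.-1) : (fst_idx i == snd_idx i) = false.
Proof. by apply/eqP => /(congr1 val) /= /eqP; rewrite eqn_leq ltnn andbF. Qed.

Lemma snd_neq_fst n (i : 'I_n.-1) : (snd_idx i == fst_idx i) = false.
Proof. by rewrite eq_sym fst_neq_snd. Qed.

Lemma fst_idx_inj n (i j : 'I_n.-1) : (fst_idx i == fst_idx j) = (i == j).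
Proof. by []. Qed.

Lemma snd_idx_inj n (i j : 'I_n.-1) : (snd_idx i == snd_idx j) = (i == j).
Proof. by []. Qed.

Section LetterWeights.
Variable n : nat.
Local Notation word := (seq 'I_n).
Local Notation idx := 'I_n.-1.

(** The pairing of the i-th simple coroot with the weight [eps k] of a letter; [wwt] is the same for
    a word. *)
Definition lwt (i : idx) (k : 'I_n) : int :=
  (k == fst_idx i)%:Z - (k == snd_idx i)%:Z.

Definition wwt (i : idx) (w : word) : int := \sum_(k <- w) lwt i k.

Lemma wwt_cons i k w : wwt i (k :: w) = lwt i k + wwt i w.
Proof. exact: big_cons. Qed.

Lemma lwt_fst i : lwt i (fst_idx i) = 1.
Proof. by rewrite /lwt eqxx fst_neq_snd. Qed.
Lemma lwt_snd i : lwt i (snd_idx i) = -1.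
Proof. by rewrite /lwt eqxx snd_neq_fst. Qed.

Lemma lwt_cartan i j : lwt i (fst_idx j) - lwt i (snd_idx j) = cartan i j.
Proof.
rewrite /lwt /cartan -!val_eqE /=.
by do 6?[case: eqP => ? /=] => //; lia.
Qed.

Lemma lwtC i j : lwt i (fst_idx j) - lwt i (snd_idx j) =
  lwt j (fst_idx i) - lwt j (snd_idx i).
Proof.
by rewrite !lwt_cartan /cartan [j == i]eq_sym orbC.
Qed.

End LetterWeights.

Section TensorPower.
Variables (F : fieldType) (q : F) (n : nat).
Hypothesis q0 : q != 0.

Local Notation word := (seq 'I_n).
Local Notation idx := 'I_n.-1.
(* All tensor powers of the vector representation at once: a function on words
   is a family of tensors, one for each length.  The head of a word is the last
   tensor factor, and f and e act on a product by f (x) 1 + K (x) f and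
   e (x) K^-1 + 1 (x) e. *)
Definition tensors := word -> F^o.
HB.instance Definition _ := GRing.Lmodule.on tensors.
Local Notation X := tensors.

Lemma tD (x y : X) w : (x + y) w = x w + y w. Proof. by []. Qed.
Lemma tN (x : X) w : (- x) w = - x w. Proof. by []. Qed.
Lemma tB (x y : X) w : (x - y) w = x w - y w. Proof. by []. Qed.
Lemma tZ c (x : X) w : (c *: x) w = c * x w. Proof. by []. Qed.
Lemma t0 w : (0 : X) w = 0. Proof. by []. Qed.
Definition tE := (tD, tB, tN, tZ, t0).

Lemma tsum I (r : seq I) (P : pred I) (E : I -> X) w :
  (\sum_(i <- r | P i) E i) w = \sum_(i <- r | P i) E i w.
Proof. by elim/big_rec2: _ => // i u v _ <-. Qed.

(** [slice] and [tens] remove and add the last tensor factor. Identities between operators are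
    proved slice by slice, by induction on the word at which they are evaluated. *)
Definition slice (k : 'I_n) (x : X) : X := fun z => x (k :: z).
Definition tens (k : 'I_n) (x : X) : X :=
  fun w => if w is l :: z then (if l == k then x z else 0) else 0.

Definition Kop (i : idx) (x : X) : X := fun w => q ^ wwt i w * x w.
Definition Kiop (i : idx) (x : X) : X := fun w => q ^ (- wwt i w) * x w.

Fixpoint fword (i : idx) (w : word) (x : X) : F :=
  if w is k :: z then
    fword i z (slice k x) +
    (if k == snd_idx i then Kop i (slice (fst_idx i) x) z else 0)
  else 0.
Definition fop (i : idx) (x : X) : X := fun w => fword i w x.

Fixpoint eword (i : idx) (w : word) (x : X) : F :=
  if w is k :: z then
    q ^ (- lwt i k) * eword i z (slice k x) +
    (if k == fst_idx i then x (snd_idx i :: z) else 0)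
  else 0.
Definition eop (i : idx) (x : X) : X := fun w => eword i w x.

Lemma fop_linear i : linear (fop i).
Proof.
move=> c x y; apply/funext => w; rewrite /fop tD tZ.
elim: w x y => [|k w IH] x y /=; first by rewrite mulr0 addr0.
have -> : slice k (c *: x + y) = c *: slice k x + slice k y by [].
rewrite IH mulrDr addrACA; congr (_ + _); case: ifP => _; last by rewrite mulr0 addr0.
by rewrite /Kop /slice !tE; ring.
Qed.
HB.instance Definition _ i := GRing.isLinear.Build F X X *:%R (fop i) (fop_linear i).

Lemma eop_linear i : linear (eop i).
Proof.
move=> c x y; apply/funext => w; rewrite /eop tD tZ.
elim: w x y => [|k w IH] x y /=; first by rewrite mulr0 addr0.
have -> : slice k (c *: x + y) = c *: slice k x + slice k y by [].
rewrite IH !mulrDr [c * (_ * _)]mulrCA addrACA; congr (_ + _).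
by case: ifP => _; rewrite ?tE // mulr0 addr0.
Qed.
HB.instance Definition _ i := GRing.isLinear.Build F X X *:%R (eop i) (eop_linear i).

Lemma Kop_linear i : linear (Kop i).
Proof. by move=> c x y; apply/funext => w; rewrite /Kop !tE; ring. Qed.
HB.instance Definition _ i := GRing.isLinear.Build F X X *:%R (Kop i) (Kop_linear i).
Lemma Kiop_linear i : linear (Kiop i).
Proof. by move=> c x y; apply/funext => w; rewrite /Kiop !tE; ring. Qed.
HB.instance Definition _ i := GRing.isLinear.Build F X X *:%R (Kiop i) (Kiop_linear i).
Lemma slice_linear k : linear (slice k).
Proof. by []. Qed.
HB.instance Definition _ k := GRing.isLinear.Build F X X *:%R (slice k) (slice_linear k).
Lemma tens_linear k : linear (tens k).
Proof.
move=> c x y; apply/funext => -[|l w] /=; rewrite !tE /= ?mulr0 ?addr0 //.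
by case: ifP => _; rewrite ?tE // mulr0 addr0.
Qed.
HB.instance Definition _ k :=
  GRing.isLinear.Build F X X *:%R (tens k) (tens_linear k).

Lemma fop_cons i x k w :
  fop i x (k :: w) = fop i (slice k x) w +
    (if k == snd_idx i then Kop i (slice (fst_idx i) x) w else 0).
Proof. by []. Qed.

Lemma eop_cons i x k w :
  eop i x (k :: w) = q ^ (- lwt i k) * eop i (slice k x) w +
    (if k == fst_idx i then x (snd_idx i :: w) else 0).
Proof. by []. Qed.

Lemma slice_fop i k x : slice k (fop i x) =
  fop i (slice k x) + (k == snd_idx i)%:R *: Kop i (slice (fst_idx i) x).
Proof.
apply/funext => w; rewrite !tE /slice fop_cons.
by case: (k == _); rewrite ?mul1r ?mul0r.
Qed.

Lemma slice_eop i k x : slice k (eop i x) =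
  q ^ (- lwt i k) *: eop i (slice k x) + (k == fst_idx i)%:R *: slice (snd_idx i) x.
Proof.
apply/funext => w; rewrite !tE /slice eop_cons.
by case: (k == _); rewrite ?mul1r ?mul0r.
Qed.

Lemma slice_Kop i k x : slice k (Kop i x) = q ^ lwt i k *: Kop i (slice k x).
Proof. by apply/funext => w; rewrite /Kop /slice tZ wwt_cons expfzDr // mulrA. Qed.

Lemma slice_tens k l x : slice k (tens l x) = (k == l)%:R *: x.
Proof.
by apply/funext => w; rewrite /slice tZ /=; case: (k == l); rewrite ?mul1r ?mul0r.
Qed.

Lemma eq_by_slice x y : x [::] = y [::] -> (forall k, slice k x = slice k y) -> x = y.
Proof. by move=> e0 ek; apply/funext => -[//|k w]; apply: (congr1 (@^~ w) (ek k)). Qed.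

Lemma fop_tens i x k : fop i (tens k x) =
  tens k (fop i x) + (k == fst_idx i)%:R *: tens (snd_idx i) (Kop i x).
Proof.
apply: eq_by_slice => [|l]; first by rewrite !tE /= mulr0 addr0.
rewrite linearD linearZ /= slice_fop !slice_tens !linearZ /=.
by rewrite !scalerA mulrC [fst_idx i == k]eq_sym.
Qed.

Lemma eop_tens i x k : eop i (tens k x) =
  q ^ (- lwt i k) *: tens k (eop i x) + (k == snd_idx i)%:R *: tens (fst_idx i) x.
Proof.
apply: eq_by_slice => [|l]; first by rewrite !tE /= !mulr0 addr0.
rewrite linearD !linearZ /= slice_eop !slice_tens !linearZ /=.
rewrite !scalerA; congr (_ + _); last by rewrite mulrC [snd_idx i == k]eq_sym.
by case: eqVneq => [->|_] /=; rewrite ?mul0r ?mulr0.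
Qed.

Lemma Kop_tens i x k : Kop i (tens k x) = q ^ lwt i k *: tens k (Kop i x).
Proof.
apply: eq_by_slice => [|l]; first by rewrite /Kop tZ /= !mulr0.
rewrite linearZ /= slice_Kop !slice_tens !linearZ /= !scalerA.
by case: eqVneq => [->|_] /=; rewrite ?mul0r ?mulr0.
Qed.

Lemma KopK i : cancel (Kop i) (Kiop i).
Proof.
move=> x; apply/funext => w; rewrite /Kop /Kiop mulrA.
by rewrite -expfzDr // addNr expr0z mul1r.
Qed.
Lemma KopC i j x : Kop i (Kop j x) = Kop j (Kop i x).
Proof. by apply/funext => w; rewrite /Kop mulrCA. Qed.

Lemma Kop_e i j x : Kop i (eop j x) = q ^ cartan i j *: eop j (Kop i x).
Proof.
apply/funext => w; rewrite tZ.
elim: w x => [|k w IH] x; first by rewrite /Kop /= !mulr0.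
change (slice k (Kop i (eop j x)) w = q ^ cartan i j * slice k (eop j (Kop i x)) w).
rewrite slice_Kop !slice_eop !slice_Kop !(linearD, linearZ) /= !tE IH.
rewrite !mulrDr; congr (_ + _); first by ring.
case: (eqVneq k (fst_idx j)) => [->|_]; last by rewrite !mul0r !mulr0.
by rewrite !mul1r [RHS]mulrA -expfzDr // -lwt_cartan subrK.
Qed.

Lemma Kop_f i j x : Kop i (fop j x) = q ^ (- cartan i j) *: fop j (Kop i x).
Proof.
apply/funext => w; rewrite tZ.
elim: w x => [|k w IH] x; first by rewrite /Kop /= !mulr0.
change (slice k (Kop i (fop j x)) w = q ^ (- cartan i j) * slice k (fop j (Kop i x)) w).
rewrite slice_Kop !slice_fop !slice_Kop !(linearD, linearZ) /= !tE IH (KopC j).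
rewrite !mulrDr; congr (_ + _); first by ring.
case: (eqVneq k (snd_idx j)) => [->|_]; last by rewrite !mul0r !mulr0.
by rewrite !mul1r [RHS]mulrA -expfzDr // -lwt_cartan opprB subrK.
Qed.

Lemma slice_Kiop i k x : slice k (Kiop i x) = q ^ (- lwt i k) *: Kiop i (slice k x).
Proof.
by apply/funext => w; rewrite /Kiop /slice tZ wwt_cons opprD expfzDr // mulrA.
Qed.

Hypothesis qq : q - q^-1 != 0.

Lemma eopfop i j x : eop i (fop j x) - fop j (eop i x) =
  (i == j)%:R *: ((q - q^-1)^-1 *: (Kop i x - Kiop i x)).
Proof.
apply/funext => w; elim: w x => [|k w IH] x.
  by rewrite !tE /Kop /Kiop /wwt big_nil oppr0 /= subrr !mulr0 addr0.
rewrite -[LHS]/(slice k (eop i (fop j x) - fop j (eop i x)) w).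
rewrite -[RHS]/(slice k _ w) !(linearB, linearZ) /=.
rewrite !slice_eop !slice_fop !slice_eop !slice_Kop !slice_Kiop !(linearD, linearZ) /= !tE.
have -> : eop i (fop j (slice k x)) w = fop j (eop i (slice k x)) w +
  (i == j)%:R * ((q - q^-1)^-1 * (Kop i (slice k x) w - Kiop i (slice k x) w)).
  by have := IH (slice k x); rewrite !tE => /eqP; rewrite subr_eq addrC => /eqP.
rewrite Kop_e tZ snd_idx_inj fst_idx_inj.
(* The mixed terms, with e on the tail and f on the head, cancel between the two products: the power
   of q picked up when [eop i] passes [Kop j] is the change of [lwt i] from [fst_idx j] to
   [snd_idx j]. *)
have -> : q ^ (- lwt i (fst_idx j)) * - (q ^ cartan j i * eop i (Kop j (slice (fst_idx j) x)) w)
  = - (q ^ (- lwt i (snd_idx j)) * eop i (Kop j (slice (fst_idx j) x)) w).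
  rewrite mulrN mulrA -expfzDr // -lwt_cartan -lwtC; congr (- (q ^ _ * _)).
  by rewrite addrA addNr sub0r.
have -> : (k == snd_idx j)%:R * (q ^ (- lwt i k) * eop i (Kop j (slice (fst_idx j) x)) w)
  = (k == snd_idx j)%:R * (q ^ (- lwt i (snd_idx j)) * eop i (Kop j (slice (fst_idx j) x)) w).
  by case: eqVneq => [->|_] //; rewrite !mul0r.
have [<-|ij] := eqVneq i j; last by rewrite /= !mul0r; ring.
have qq2 : q * q - 1 != 0.
  by move: qq; rewrite -(mulfV q0) -mulrBr mulf_neq0.
rewrite /lwt.
case: (eqVneq k (fst_idx i)) => [->|kf].
  by rewrite fst_neq_snd /= subr0 !(expr1z, exprN1); field; rewrite q0 qq2.
case: (eqVneq k (snd_idx i)) => [->|ks] /=.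
  by rewrite sub0r opprK !(expr1z, exprN1); field; rewrite q0 qq2.
by rewrite subrr oppr0 expr0z; ring.
Qed.

Lemma fopC (i j : idx) x : (i.+1 < j)%N -> fop i (fop j x) = fop j (fop i x).
Proof.
move=> ij; apply/funext => w; elim: w x => [//|k w IH] x.
rewrite -[LHS]/(slice k (fop i (fop j x)) w) -[RHS]/(slice k (fop j (fop i x)) w).
rewrite !slice_fop !(linearD, linearZ) /= !tE IH.
have -> : (fst_idx i == snd_idx j) = false by rewrite -val_eqE /=; lia.
have -> : (fst_idx j == snd_idx i) = false by rewrite -val_eqE /=; lia.
have c0 : cartan j i = 0 /\ cartan i j = 0.
  rewrite /cartan -!val_eqE /=.
  by do 6?[case: eqP => ? /=]; split=> //; lia.
rewrite !Kop_f !tE !c0.1 !c0.2 oppr0 expr0z.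
by rewrite /=; ring.
Qed.

End TensorPower.

(** * The crystal of words *)

Section WordCrystal.
Variable n : nat.
Local Notation word := (seq 'I_n).
Local Notation idx := 'I_n.-1.

(* Numbers of unmatched letters L and R of the signature of a word. *)
Fixpoint wphi (i : idx) (w : word) : nat :=
  if w is k :: z then
    if k == fst_idx i then (wphi i z).+1
    else if k == snd_idx i then (wphi i z).-1 else wphi i z
  else 0%N.

Fixpoint weps (i : idx) (w : word) : nat :=
  if w is k :: z then
    if (k == snd_idx i) && (wphi i z == 0%N) then (weps i z).+1 else weps i z
  else 0%N.

(** The signature rule read from the head, with [fst_idx i] as L and [snd_idx i] as R. The operator
    f acts on the unmatched L farthest from the head. An R at the head cancels the nearest unmatched
    L, so something remains only if the tail has at least two. *)
Fixpoint wf (i : idx) (w : word) : option word :=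
  if w is k :: z then
    if (k == fst_idx i) && (wphi i z == 0%N) then Some (snd_idx i :: z)
    else if (k == snd_idx i) && (wphi i z <= 1)%N then None
    else omap (cons k) (wf i z)
  else None.

Fixpoint we (i : idx) (w : word) : option word :=
  if w is k :: z then
    if (k == snd_idx i) && (wphi i z == 0%N) then Some (fst_idx i :: z)
    else omap (cons k) (we i z)
  else None.

Lemma wwt_phi_eps i w : wwt i w = (wphi i w)%:Z - (weps i w)%:Z.
Proof.
elim: w => [|k w IH]; first by rewrite /wwt big_nil.
rewrite wwt_cons IH /lwt /=.
case: (eqVneq k (fst_idx i)) => [->|_] /=; first by rewrite fst_neq_snd /=; lia.
by case: (eqVneq k (snd_idx i)) => [_|_] /=; [case: (wphi i w) => [|m] /=|]; lia.
Qed.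

Lemma wf_None i w : (wf i w == None) = (wphi i w == 0%N).
Proof.
elim: w => //= k w; case: (wf i w) => [u|] /= IH.
  case: (eqVneq k (fst_idx i)) => [->|_] /=; first by rewrite fst_neq_snd /=; case: ifP.
  by case: (k == snd_idx i) => //=; move: IH; case: (wphi i w) => [|[|m]].
have {IH} -> : wphi i w = 0%N by apply/eqP; rewrite -IH.
by case: (k == fst_idx i) => //=; case: (k == snd_idx i).
Qed.

Lemma we_None i w : (we i w == None) = (weps i w == 0%N).
Proof.
elim: w => //= k w; case: (we i w) => [u|] /= IH; case: (k == snd_idx i) => //=.
  by case: (wphi i w == 0%N).
by case: (wphi i w == 0%N).
Qed.

Lemma wf_Some i w w' : wf i w = Some w' ->
  [/\ we i w' = Some w, wphi i w = (wphi i w').+1, weps i w' = (weps i w).+1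
    & size w' = size w].
Proof.
elim: w w' => //= k w IH w'.
case: (eqVneq k (fst_idx i)) => [->|kf] /=.
  case: eqP => [p0 [<-]|p0] /=.
    by rewrite snd_neq_fst fst_neq_snd p0 !eqxx /=.
  rewrite fst_neq_snd /=; case e: (wf i w) => [u|] //= [<-] /=.
  have [h1 h2 h3 h4] := IH _ e.
  by rewrite eqxx fst_neq_snd /= h1 h2 h3 h4.
case: (eqVneq k (snd_idx i)) => [->|ks] /=.
  case: leqP => // p2; case e: (wf i w) => [u|] //= [<-] /=.
  have [h1 h2 h3 h4] := IH _ e.
  have pu : (wphi i u == 0%N) = false by lia.
  have pw : (wphi i w == 0%N) = false by lia.
  by rewrite snd_neq_fst eqxx pu pw h1 h3 h4 h2 /=; split=> //; lia.
case e: (wf i w) => [u|] //= [<-] /=.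
have [h1 h2 h3 h4] := IH _ e.
by rewrite (negPf kf) (negPf ks) /= h1 h2 h3 h4.
Qed.

Lemma we_Some i w w' : we i w = Some w' -> wf i w' = Some w.
Proof.
elim: w w' => //= k w IH w'.
case: (eqVneq k (snd_idx i)) => [->|ks] /=.
  case: eqP => [p0 [<-]|p0] /=; first by rewrite eqxx p0.
  case e: (we i w) => [u|] //= [<-] /=; have fu := IH _ e.
  have [_ h _ _] := wf_Some fu.
  by rewrite snd_neq_fst eqxx /= fu; case: leqP => //; lia.
case e: (we i w) => [u|] //= [<-] /=; have fu := IH _ e.
have [_ h _ _] := wf_Some fu.
by rewrite (negPf ks) /= fu /= (_ : (wphi i u == 0%N) = false) ?andbF //; lia.
Qed.

Lemma we_size i w w' : we i w = Some w' -> size w' = size w.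
Proof. by move/we_Some/wf_Some => [_ _ _ ->]. Qed.

End WordCrystal.

(** * Bases of the tensor powers adapted to the i-strings *)

Section AdaptedBasis.
Variables (F : fieldType) (q : F) (reg : F -> Prop) (n : nat).
Hypothesis vr : valuation_ring_at q reg.
Local Notation word := (seq 'I_n).
Local Notation idx := 'I_n.-1.
Local Notation X := (tensors F n).
Local Notation van := (vanishing q reg).
Local Notation fX := (fop q).
Local Notation eX := (eop q).
Local Notation KX := (Kop q).

Let q0 := q_neq0 vr.

(** Clebsch-Gordan coefficients for tensoring an i-string with the two-dimensional module spanned by
    [fst_idx i] and [snd_idx i]. With [fst_idx i] in front, or with [snd_idx i] and [wphi] zero, the
    vector lies in the string longer by one; with [snd_idx i] and [wphi] positive it lies in the
    string shorter by one. The normalisation makes the term of the word itself dominant modulo q.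
    The recursion is on [z] because the other word is replaced by [we i w'] or [wf i w'], which are
    not subterms. *)
Fixpoint adapted_at (i : idx) (z w : word) : F :=
  match z, w with
  | [::], [::] => 1
  | l :: z', k :: w' =>
      if k == fst_idx i then
        (if l == fst_idx i then adapted_at i z' w' else 0) +
        (if l == snd_idx i then
           q ^+ (wphi i w').+1 * oapp (adapted_at i z') 0 (we i w') else 0)
      else if (k == snd_idx i) && (0 < wphi i w')%N then
        (if l == snd_idx i then
           gq q (wphi i w') / gq q (weps i w' + wphi i w') * adapted_at i z' w'
         else 0) -
        (if l == fst_idx i then
           q ^+ wphi i w' * gq q (weps i w').+1 / gq q (weps i w' + wphi i w') *
             oapp (adapted_at i z') 0 (wf i w')
         else 0)
      else if l == k then adapted_at i z' w' else 0
  | _, _ => 0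
  end.

Definition adapted i w : X := fun z => adapted_at i z w.
Definition oadapted i (o : option word) : X := oapp (adapted i) 0 o.

Lemma adapted_fst i w : adapted i (fst_idx i :: w) =
  tens (fst_idx i) (adapted i w) +
  q ^+ (wphi i w).+1 *: tens (snd_idx i) (oadapted i (we i w)).
Proof.
apply/funext => -[|l z]; rewrite !tE /adapted /= ?mulr0 ?addr0 // eqxx.
congr (_ + _); case: ifP => _; last by rewrite mulr0.
by case: (we i w).
Qed.

Lemma adapted_snd0 i w : wphi i w = 0%N ->
  adapted i (snd_idx i :: w) = tens (snd_idx i) (adapted i w).
Proof.
by move=> p0; apply/funext => -[|l z] //=; rewrite /adapted /= snd_neq_fst p0 andbF.
Qed.

Lemma adapted_snd i w : (0 < wphi i w)%N -> adapted i (snd_idx i :: w) =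
  (gq q (wphi i w) / gq q (weps i w + wphi i w)) *: tens (snd_idx i) (adapted i w) -
  (q ^+ wphi i w * gq q (weps i w).+1 / gq q (weps i w + wphi i w)) *:
     tens (fst_idx i) (oadapted i (wf i w)).
Proof.
move=> p0; apply/funext => -[|l z]; rewrite !tE /adapted /= ?mulr0 ?subr0 //.
rewrite snd_neq_fst eqxx p0 /=.
congr (_ - _); case: ifP => _; rewrite ?mulr0 //.
by case: (wf i w).
Qed.

Lemma adapted_other i k w : k != fst_idx i -> k != snd_idx i ->
  adapted i (k :: w) = tens k (adapted i w).
Proof.
move=> kf ks; apply/funext => -[|l z] //=.
by rewrite /adapted /= (negPf kf) (negPf ks).
Qed.

Definition delta (w : word) : X := fun z => (z == w)%:R.

Lemma deltaE w z : delta w z = (z == w)%:R.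
Proof. by []. Qed.

Lemma tens_delta k w : tens k (delta w) = delta (k :: w).
Proof.
apply/funext => -[|l z] //=; rewrite /delta eqseq_cons.
by case: (l == k).
Qed.

Definition in_lattice (x : X) := forall w, reg (x w).
Definition in_qlattice (x : X) := forall w, van (x w).

(** Each correction term carries a positive power of q, and the leading coefficient is 1 or a ratio
    of values of [gq] at positive integers, congruent to 1. Here and below the induction is on the
    length, which [we] and [wf] preserve. *)
Lemma adapted_cong i w : in_qlattice (adapted i w - delta w).
Proof.
have vd u z : van (adapted i u z - delta u z) -> reg (adapted i u z).
  move=> /vanW h; rewrite -(subrK (delta u z) (adapted i u z)).
  apply: (regD vr); first exact: h.
  by rewrite /delta; case: eqP => _; [apply: (vr1 vr) | apply: (reg0 vr)].
have vt u k : (forall z, van (adapted i u z - delta u z)) ->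
    forall z, van (tens k (adapted i u) z - delta (k :: u) z).
  move=> hu z; rewrite -tens_delta; case: z => [|l z] /=.
    by rewrite subrr; apply: (van0 vr).
  by case: ifP => _; [apply: hu | rewrite subrr; apply: (van0 vr)].
have rt (x : X) k : in_lattice x -> in_lattice (tens k x).
  by move=> rx [|l z] /=; [|case: ifP => _]; rewrite ?rx //; apply: (reg0 vr).
suff H m : forall u, (size u <= m)%N -> in_qlattice (adapted i u - delta u).
  exact: (H (size w)).
elim: m => [|m IH] u.
  case: u => //= _ [|l z]; rewrite !tE /adapted /delta /= subrr; exact: (van0 vr).
case: u => [|k u su]; first by move=> _; apply: IH.
have hu := IH _ su.
have lat v : size v = size u -> in_lattice (adapted i v).
  by move=> sv z; apply: vd; apply: IH; rewrite sv.
move=> z; rewrite !tE.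
case: (eqVneq k (fst_idx i)) => [->|kf].
  rewrite adapted_fst !tE addrAC; apply: (vanD vr); first exact: vt.
  apply: (vanMr vr); first exact: (van_qX vr).
  apply: (rt); case e: (we i u) => [v|] //=; last by move=> ?; apply: (reg0 vr).
  by apply: lat; apply: we_size e.
case: (eqVneq k (snd_idx i)) => [->|ks]; last by rewrite adapted_other //; apply: vt.
case: (posnP (wphi i u)) => [p0|p0]; first by rewrite adapted_snd0 //; apply: vt.
rewrite adapted_snd // !tE.
have [p ep] : exists p, wphi i u = p.+1 by exists (wphi i u).-1; rewrite prednK.
rewrite ep addnS.
have gi a := reg_inv_cong1 vr (gq_cong1 vr a).
rewrite addrAC; apply: (vanB vr).
  set c := _ / _; have c1 : van (c - 1).
    by apply: (cong1M vr); [|apply: (cong1V vr)]; apply: (gq_cong1 vr).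
  rewrite (_ : _ - _ = c * (tens (snd_idx i) (adapted i u) z - delta (snd_idx i :: u) z)
      + (c - 1) * delta (snd_idx i :: u) z); last by ring.
  apply: (vanD vr).
    by apply: (vanMl vr); [apply: (reg_cong1 vr) | apply: vt].
  apply: (vanMr vr) => //.
  by rewrite /delta; case: eqP => _; [apply: (vr1 vr) | apply: (reg0 vr)].
rewrite -!mulrA; apply: (vanMr vr); first exact: (van_qX vr).
apply: (vrM vr); first exact: (reg_gq vr).
apply: (vrM vr); first exact: gi.
apply: rt; case e: (wf i u) => [v|] //=; last by move=> ?; apply: (reg0 vr).
by apply: lat; have [_ _ _ ->] := wf_Some e.
Qed.

Lemma br_rec (m : int) : br q (m + 1) = q * br q m + q ^ (- m).
Proof.
rewrite /br opprD !expfzDr // expr1z exprN1.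
have qq2 : q * q - 1 != 0 by have := q_exp_neq1 vr (isT : (0 < 2)%N); rewrite -subr_eq0 expr2.
have qm0 : q ^ m != 0 := q_expz_neq0 vr m.
rewrite -invr_expz; move: (q ^ m) qm0 => u u0.
by field; rewrite u0 qq2 q0.
Qed.

Lemma br_rec' (m : int) : br q (m + 1) = q^-1 * br q m + q ^ m.
Proof.
rewrite /br opprD !expfzDr // expr1z exprN1.
have qq2 : q * q - 1 != 0 by have := q_exp_neq1 vr (isT : (0 < 2)%N); rewrite -subr_eq0 expr2.
have qm0 : q ^ m != 0 := q_expz_neq0 vr m.
rewrite -invr_expz; move: (q ^ m) qm0 => u u0.
by field; rewrite u0 qq2 q0.
Qed.

Lemma Kop_adapted i w : KX i (adapted i w) = q ^ wwt i w *: adapted i w.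
Proof.
suff H m : forall u, (size u <= m)%N -> KX i (adapted i u) = q ^ wwt i u *: adapted i u.
  exact: (H (size w)).
elim: m => [|m IH] u.
  case: u => // _; apply/funext => -[|l z]; rewrite /Kop tZ //.
  by rewrite /adapted /= !mulr0.
case: u => [|k u su]; first by move=> _; apply: IH.
have hu := IH _ su.
rewrite wwt_cons expfzDr //.
case: (eqVneq k (fst_idx i)) => [->|kf].
  rewrite adapted_fst linearD linearZ /= !Kop_tens // hu !linearZ /= scalerDr.
  rewrite !scalerA; congr (_ + _); first by rewrite mulrC.
  rewrite /oadapted; case e: (we i u) => [v|] /=; last by rewrite !linear0 ?scaler0.
  have [_ p1 e1 sv] := wf_Some (we_Some e).
  rewrite IH -?sv // linearZ /= !scalerA; congr (_ *: _).
  rewrite lwt_fst lwt_snd !wwt_phi_eps p1 e1 exprnP -!expfzDr //.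
  by congr (_ ^ _); lia.
case: (eqVneq k (snd_idx i)) => [->|ks]; last first.
  by rewrite adapted_other // Kop_tens // hu linearZ scalerA.
case: (posnP (wphi i u)) => [p0|p0].
  by rewrite adapted_snd0 // Kop_tens // hu linearZ scalerA.
rewrite adapted_snd // linearB !linearZ /= !Kop_tens // hu !linearZ /= scalerDr.
rewrite !scalerA; congr (_ + _).
rewrite /oadapted; case e: (wf i u) => [v|] /=; last by rewrite !linear0 ?scaler0.
have [_ p1 e1 sv] := wf_Some e.
rewrite IH ?sv // !linearZ /= !scalerA; congr (_ *: _).
rewrite lwt_fst lwt_snd mulrA -!expfzDr //.
by congr (q ^ _ * _); rewrite !wwt_phi_eps p1 e1; lia.
Qed.

(** With [eop_adapted]: along a string the adapted vectors behave as the divided powers f^(k) u of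
    its top vector u, where k is [weps] and the length of the string is [weps] plus [wphi]. *)
Lemma fop_adapted i w :
  fX i (adapted i w) = br q (weps i w).+1%:Z *: oadapted i (wf i w).
Proof.
suff H m : forall u, (size u <= m)%N ->
    fX i (adapted i u) = br q (weps i u).+1%:Z *: oadapted i (wf i u).
  exact: (H (size w)).
elim: m => [|m IH] u.
  case: u => // _; rewrite /= scaler0; apply: eq_by_slice => [|k]; first exact: erefl.
  have c0 l : slice l (adapted i [::]) = 0 by [].
  by rewrite slice_fop !c0 !linear0 ?scaler0 ?addr0.
case: u => [|k u su]; first by move=> _; apply: IH.
have hu := IH _ su.
case: (eqVneq k (fst_idx i)) => [->|kf].
  rewrite adapted_fst linearD linearZ /= !fop_tens eqxx snd_neq_fst scale1r scale0r addr0.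
  rewrite hu Kop_adapted.
  have -> : fX i (oadapted i (we i u)) = br q (weps i u)%:Z *: adapted i u.
    rewrite /oadapted; case e: (we i u) => [v|] /=.
      have [_ p1 e1 sv] := wf_Some (we_Some e).
      by rewrite IH -?sv // (we_Some e) e1.
    by rewrite linear0 (eqP (etrans (esym (we_None i u)) _)) ?e // br0 scale0r.
  have ek : q ^ wwt i u + q ^+ (wphi i u).+1 * br q (weps i u)%:Z =
     q ^+ (wphi i u) * br q (weps i u).+1%:Z.
    have -> : ((weps i u).+1%:Z = (weps i u)%:Z + 1) by lia.
    by rewrite br_rec wwt_phi_eps expfzDr // exprS -exprnP; ring.
  rewrite !linearZ /= -addrA scalerA -scalerDl [br q _ * _]mulrC ek [q ^+ _ * br q _]mulrC -[(br q _ * _) *: _]scalerA -scalerDr.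
  rewrite fst_neq_snd /=; congr (_ *: _).
  have [p0|p0] := posnP (wphi i u).
    have -> : wf i u = None by apply/eqP; rewrite wf_None p0.
    by rewrite p0 expr0 scale1r linear0 add0r /= adapted_snd0.
  case e: (wf i u) => [v|]; last by move: p0; rewrite lt0n -(wf_None i u) e.
  have [e1 p1 e2 sv] := wf_Some e.
  by rewrite /= adapted_fst e1 p1.
case: (eqVneq k (snd_idx i)) => [->|ks]; last first.
  rewrite adapted_other // fop_tens (negPf kf) scale0r addr0 hu linearZ /=.
  rewrite (negPf kf) (negPf ks) /=; congr (_ *: _).
  by case: (wf i u) => [v|] /=; rewrite ?linear0 // adapted_other.
have [p0|p0] := posnP (wphi i u).
  have wN : wf i u = None by apply/eqP; rewrite wf_None p0.
  rewrite adapted_snd0 // fop_tens snd_neq_fst scale0r addr0 hu wN /=.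
  by rewrite snd_neq_fst eqxx p0 /= !linear0 ?scaler0.
case e: (wf i u) => [v|]; last by move: p0; rewrite lt0n -(wf_None i u) e.
have [e1 p1 e2 sv] := wf_Some e.
rewrite adapted_snd // linearB !linearZ /= !fop_tens eqxx snd_neq_fst scale0r addr0.
rewrite e /= hu e /= IH ?sv // Kop_adapted scale1r e2 !linearZ /=.
rewrite eqxx p1 /= addnS.
have D0 : gq q (weps i u + wphi i v).+1 != 0 := gq_neq0 vr _.
have [D eD] : exists D, D = gq q (weps i u + wphi i v).+1 by eexists.
rewrite -eD in D0 *.
have -> : oadapted i (if (wphi i v < 1)%N then None else Some (snd_idx i :: v)) =
    (gq q (wphi i v) / D) *: tens (snd_idx i) (adapted i v) -
    (q ^+ wphi i v * gq q (weps i u).+2 / D) *: tens (fst_idx i) (oadapted i (wf i v)).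
  have D_eq : gq q (weps i v + wphi i v) = gq q (weps i u + wphi i v).+1.
    by rewrite e2 addSn.
  have [v0|v0] := posnP (wphi i v).
    have -> : wf i v = None by apply/eqP; rewrite wf_None v0.
    by rewrite v0 gq0 mul0r scale0r sub0r /= !linear0 ?scaler0 ?oppr0.
  by rewrite ltnNge v0 /= adapted_snd // D_eq -eD e2.
have ge j : gq q j.+1 = q ^+ j * br q j.+1%:Z.
  by rewrite (gq_br vr) (_ : j.+1%:Z - 1 = j%:Z) ?exprnP //; lia.
(* This power of q is the increment from [gq q (wphi i v)] to [gq q (wphi i v).+1]. Subtracting it
   turns the numerator belonging to [u] into the one belonging to [v]. *)
have kap : q ^+ (wphi i v).+1 * q ^+ weps i u * q ^ wwt i v = q ^+ (2 * wphi i v).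
  by rewrite !exprnP -!expfzDr //; congr (q ^ _); rewrite wwt_phi_eps e2; lia.
apply/funext => z; rewrite !tE.
move: (tens _ _ z) (tens _ _ z) => S T.
have -> : q ^+ (wphi i v).+1 * gq q (weps i u).+1 / D *
    - (br q (weps i u).+2 * S + q ^ wwt i v * T) =
  - (q ^+ (wphi i v).+1 * gq q (weps i u).+1 / D * br q (weps i u).+2 * S)
  - (q ^+ (wphi i v).+1 * q ^+ weps i u * q ^ wwt i v) * br q (weps i u).+1%:Z / D * T.
  by rewrite ge; ring.
rewrite kap gqSr !ge !exprS.
by field.
Qed.

Lemma eop_adapted i w :
  eX i (adapted i w) = br q (wphi i w).+1%:Z *: oadapted i (we i w).
Proof.
suff H m : forall u, (size u <= m)%N ->
    eX i (adapted i u) = br q (wphi i u).+1%:Z *: oadapted i (we i u).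
  exact: (H (size w)).
elim: m => [|m IH] u.
  case: u => // _; rewrite /= scaler0; apply: eq_by_slice => [|k]; first exact: erefl.
  have c0 l : slice l (adapted i [::]) = 0 by [].
  by rewrite slice_eop !c0 !linear0 ?scaler0 ?addr0.
case: u => [|k u su]; first by move=> _; apply: IH.
have hu := IH _ su.
case: (eqVneq k (fst_idx i)) => [->|kf].
  rewrite adapted_fst linearD linearZ /= !eop_tens eqxx fst_neq_snd scale1r scale0r addr0.
  rewrite hu lwt_fst lwt_snd ?fst_neq_snd ?eqxx /= ?fst_neq_snd /= opprK expr1z exprN1.
  case e: (we i u) => [v|] /=; last by rewrite !(linear0, addr0, scaler0).
  have [_ p1 e1 sv] := wf_Some (we_Some e).
  rewrite IH -?sv // adapted_fst p1 !linearZ /=.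
  have e3 : q^-1 * br q (wphi i u).+1 + q ^+ (wphi i u).+1 = br q (wphi i u).+2.
    have -> : ((wphi i u).+2%:Z = (wphi i u).+1%:Z + 1) by lia.
    by rewrite br_rec' exprnP.
  apply/funext => z; rewrite !tE.
  move: (tens _ _ z) (tens _ _ z) => S T.
  rewrite mulrDr -e3 [q ^+ (wphi i u).+2]exprS.
  by ring.
case: (eqVneq k (snd_idx i)) => [->|ks]; last first.
  rewrite adapted_other // eop_tens (negPf ks) scale0r addr0 hu linearZ /=.
  rewrite /lwt (negPf kf) (negPf ks) /= subrr oppr0 expr0z scale1r; congr (_ *: _).
  by case: (we i u) => [v|] /=; rewrite ?linear0 // adapted_other.
have [p0|p0] := posnP (wphi i u).
  rewrite adapted_snd0 // eop_tens eqxx scale1r hu p0 (br1 vr) scale1r lwt_snd opprK expr1z.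
  by rewrite /= snd_neq_fst eqxx p0 /= (br1 vr) // scale1r adapted_fst p0 addrC expr1.
case e: (wf i u) => [v|]; last by move: p0; rewrite lt0n -(wf_None i u) e.
have [e1 p1 e2 sv] := wf_Some e.
rewrite adapted_snd // linearB !linearZ /= !eop_tens eqxx fst_neq_snd scale0r addr0.
rewrite e /= hu IH ?sv // scale1r e1 /= -p1 lwt_fst lwt_snd opprK expr1z exprN1.
rewrite snd_neq_fst ?eqxx /=.
rewrite p1 /=.
have D0 : gq q (weps i u + (wphi i v).+1) != 0 by rewrite addnS; apply: gq_neq0 vr _.
have ge j : gq q j.+1 = q ^+ j * br q j.+1%:Z.
  by rewrite (gq_br vr) (_ : j.+1%:Z - 1 = j%:Z) ?exprnP //; lia.
case e' : (we i u) => [x|] /=.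
  have [_ p2 e3 sx] := wf_Some (we_Some e').
  rewrite adapted_snd ?p2 // (we_Some e') -e3 p1.
  have -> : (weps i x + (wphi i v).+2 = weps i u + (wphi i v).+1)%N by rewrite e3 addnS addSn.
  rewrite /=; move: (gq q (weps i u + _)) D0 => D D0.
  rewrite !linearZ /=; apply/funext => z; rewrite !tE.
  move: (tens _ _ z) (tens _ _ z) => T S.
  rewrite (gqS _ (weps i u)) !ge !exprS.
  by field; rewrite q0 D0.
have e0 : weps i u = 0%N by apply/eqP; rewrite -we_None e'.
move: (gq q (weps i u + _)) D0 => D D0.
rewrite e0 !(linear0, scaler0) add0r (gqS _ 0) gq0 mulr0 addr0 mulr1 ge.
rewrite !linearZ /=; apply/funext => z; rewrite !tE exprS.
move: (tens _ _ z) => T.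
by field; rewrite q0 D0.
Qed.

End AdaptedBasis.

(** * Shift operators on the tensor powers and their action modulo q *)

Section KashiwaraOnTensors.
Variables (F : fieldType) (q : F) (reg : F -> Prop) (n : nat).
Hypothesis vr : valuation_ring_at q reg.
Local Notation word := (seq 'I_n).
Local Notation idx := 'I_n.-1.
Local Notation X := (tensors F n).
Local Notation van := (vanishing q reg).
Local Notation fX := (fop q).
Local Notation eX := (eop q).
Local Notation KX := (Kop q).
Local Notation yX := (@adapted F q n).
Local Notation oyX := (@oadapted F q n).
Local Notation delta := (@delta F n).
Local Notation in_lattice := (@in_lattice F reg n).
Local Notation in_qlattice := (@in_qlattice F q reg n).

Lemma adapted_size i w z : size z != size w -> yX i w z = 0.
Proof.
rewrite /adapted; elim: z w => [|l z IH] [|k w] //= sz.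
have h : adapted_at q i z w = 0 by exact: IH.
have hw : oapp (adapted_at q i z) 0 (we i w) = 0.
  by case e: (we i w) => [v|] //=; apply: IH; rewrite (we_size e).
have hf : oapp (adapted_at q i z) 0 (wf i w) = 0.
  by case e: (wf i w) => [v|] //=; apply: IH; have [_ _ _ ->] := wf_Some e.
by rewrite h hw hf !mulr0 !if_same addr0 subr0 !if_same.
Qed.

(** A function on words has components of all lengths at once. Locality allows an identity to be
    checked on one length at a time, where the adapted vectors form a finite basis. *)
Definition size_local (T : X -> X) := forall x y N,
  (forall z, size z = N -> x z = y z) -> forall z, size z = N -> T x z = T y z.

Lemma local_comp T U : size_local T -> size_local U -> size_local (T \o U).
Proof. by move=> lT lU x y N e z sz /=; apply: (lT _ _ N) => // u; apply: lU. Qed.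

Lemma local_fop i : size_local (fX i).
Proof.
move=> x y N e z; elim: z N x y e => [|k z IH] N x y e sz //.
rewrite /= in sz; rewrite !fop_cons; congr (_ + _).
  by apply: (IH (size z)) => // u su; apply: e; rewrite /= su.
by case: ifP => // _; rewrite /Kop /slice (e (_ :: z)).
Qed.

Lemma local_eop i : size_local (eX i).
Proof.
move=> x y N e z; elim: z N x y e => [|k z IH] N x y e sz //.
rewrite /= in sz; rewrite !eop_cons; congr (_ * _ + _).
  by apply: (IH (size z)) => // u su; apply: e; rewrite /= su.
by case: ifP => // _; rewrite (e (_ :: z)).
Qed.

Lemma local_Kop i : size_local (KX i).
Proof. by move=> x y N e z sz; rewrite /Kop e. Qed.

Lemma local_scale c T : size_local T -> size_local (fun x => c *: T x).
Proof. by move=> lT x y N e z sz; rewrite !tE (lT x y N). Qed.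

Lemma local_iter k T : size_local T -> size_local (iter k T).
Proof.
move=> lT; elim: k => [|k IH]; first by move=> x y N e z; apply: e.
exact: (local_comp lT IH).
Qed.

Lemma adapted_inverse_exists (i : idx) N : exists C : N.-tuple 'I_n -> N.-tuple 'I_n -> F,
    [/\ forall a b, van (C a b - (a == b)%:R),
        forall a b : N.-tuple 'I_n,
          \sum_(c : N.-tuple 'I_n) yX i a c * C c b = (a == b)%:R
      & forall a b : N.-tuple 'I_n,
          \sum_(c : N.-tuple 'I_n) C a c * yX i c b = (a == b)%:R].
Proof.
apply: (inverse_kernel_cong1 vr (A := fun a b : N.-tuple 'I_n => yX i a b)) => a b.
by rewrite eq_sym; apply: (adapted_cong vr).
Qed.

Definition adapted_inverse i N := sval (cid (adapted_inverse_exists i N)).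

(** The coordinate on [adapted i w] of the component of [x] of length N. *)
Definition ycoord i N (x : X) (w : N.-tuple 'I_n) : F :=
  \sum_(z : N.-tuple 'I_n) x z * adapted_inverse i z w.

Lemma ycoord_linear i N c (x y : X) (w : N.-tuple 'I_n) :
  ycoord i (c *: x + y) w = c * ycoord i x w + ycoord i y w.
Proof.
rewrite /ycoord mulr_sumr -big_split; apply: eq_bigr => z _.
by rewrite !tE mulrDl mulrA.
Qed.

Lemma ycoordZ i N c (x : X) (w : N.-tuple 'I_n) : ycoord i (c *: x) w = c * ycoord i x w.
Proof.
by rewrite /ycoord mulr_sumr; apply: eq_bigr => z _; rewrite !tE mulrA.
Qed.

Lemma ycoord0 i N (w : N.-tuple 'I_n) : ycoord i 0 w = 0.
Proof. by rewrite /ycoord big1 // => z _; rewrite mul0r. Qed.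

Lemma ycoord_sum i N I (r : seq I) (P : pred I) (E : I -> X) (w : N.-tuple 'I_n) :
  ycoord i (\sum_(j <- r | P j) E j) w = \sum_(j <- r | P j) ycoord i (E j) w.
Proof.
elim/big_rec2: _ => [|j u v _ <-]; first by rewrite ycoord0.
by rewrite -(scale1r (E j)) ycoord_linear ycoordZ !mul1r.
Qed.

Lemma ycoord_eq i N (x y : X) (w : N.-tuple 'I_n) :
  (forall z, size z = N -> x z = y z) -> ycoord i x w = ycoord i y w.
Proof. by move=> e; apply: eq_bigr => z _; rewrite e // size_tuple. Qed.

Lemma adapted_inverseV i N (a b : N.-tuple 'I_n) :
  \sum_(c : N.-tuple 'I_n) adapted_inverse i a c * yX i c b = (a == b)%:R.
Proof. by rewrite /adapted_inverse; case: cid => C []. Qed.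

Lemma reg_adapted_inverse i N (a b : N.-tuple 'I_n) : reg (adapted_inverse i a b).
Proof.
rewrite /adapted_inverse; case: cid => C [/= vC _ _].
rewrite -(subrK (a == b)%:R (C a b)); apply: (regD vr); first exact: (vanW vr).
by case: (_ == _); [apply: (vr1 vr) | apply: (reg0 vr)].
Qed.

Lemma ycoord_adapted i N (v w : N.-tuple 'I_n) : ycoord i (yX i v) w = (v == w)%:R.
Proof. by rewrite /ycoord /adapted_inverse; case: cid => C [? e ?] /=. Qed.

Lemma ycoord_adapted' i N (v : word) (w : N.-tuple 'I_n) :
  ycoord i (yX i v) w = (v == w)%:R.
Proof.
case: (eqVneq (size v) N) => [sv|sv].
  have -> : v = Tuple (introT eqP sv) by [].
  exact: ycoord_adapted.
rewrite /ycoord big1 => [|z _].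
  by case: eqP => // e; move: sv; rewrite e size_tuple eqxx.
by rewrite adapted_size ?mul0r // size_tuple eq_sym.
Qed.

Definition restr N (x : X) : X := fun z => if size z == N then x z else 0.

Lemma restrE i N x : restr N x = \sum_(w : N.-tuple 'I_n) ycoord i x w *: yX i w.
Proof.
apply/funext => z; rewrite tsum /restr; case: eqP => [sz|/eqP sz]; last first.
  by rewrite big1 // => w _; rewrite tE adapted_size ?mulr0 // size_tuple.
pose t : N.-tuple 'I_n := Tuple (introT eqP sz).
have -> : z = t by [].
under eq_bigr => w _ do rewrite tE /ycoord mulr_suml.
have h (u : N.-tuple 'I_n) : \sum_(w : N.-tuple 'I_n) x u * adapted_inverse i u w * yX i w t =
    x u * (u == t)%:R :> F.
  rewrite -(adapted_inverseV i) mulr_sumr.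
  by apply: eq_bigr => w _; rewrite mulrA.
rewrite exchange_big /= (eq_bigr _ (fun u _ => h u)) (bigD1 t) //= big1 => [|u ut].
  by rewrite addr0 eqxx mulr1.
by rewrite (negPf ut) mulr0.
Qed.

Lemma reg_coord i N x (w : N.-tuple 'I_n) : in_lattice x -> reg (ycoord i x w).
Proof.
by move=> rx; apply: (reg_sum vr) => z _; apply: (vrM vr) => //; apply: reg_adapted_inverse.
Qed.

Lemma van_coord i N x (w : N.-tuple 'I_n) : in_qlattice x -> van (ycoord i x w).
Proof.
move=> rx; apply: (van_sum vr) => z _; apply: (vanMr vr) => //.
exact: reg_adapted_inverse.
Qed.

Lemma restr_id N x z : size z = N -> restr N x z = x z.
Proof. by rewrite /restr => ->; rewrite eqxx. Qed.

Lemma linear_comb (T : X -> X) : linear T -> forall I (r : seq I) (c : I -> F) (E : I -> X),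
  T (\sum_(j <- r) c j *: E j) = \sum_(j <- r) c j *: T (E j).
Proof.
move=> lT I r c E; have T0 : T 0 = 0.
  by have := lT (-1) 0 0; rewrite scaler0 addr0 scaleN1r addNr.
by elim/big_rec2: _ => // j u v _ <-; rewrite lT.
Qed.

Definition spanned i (P : word -> Prop) (x : X) :=
  forall N (w : N.-tuple 'I_n), ycoord i x w != 0 -> P w.

(** The method by which operator identities are proved below: bound the [weps] and fix the weight of
    the adapted vectors occurring in [x], and compare the operators on those vectors only. *)
Lemma spanned_eq i P (T U : X -> X) x :
  linear T -> linear U -> size_local T -> size_local U ->
  (forall w, P w -> T (yX i w) = U (yX i w)) -> spanned i P x -> T x = U x.
Proof.
move=> lT lU sT sU TU Px; apply/funext => z.
rewrite (sT x (restr (size z) x) (size z)) // => [|u su]; last by rewrite restr_id.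
rewrite (sU x (restr (size z) x) (size z)) // => [|u su]; last by rewrite restr_id.
rewrite (restrE i) !linear_comb // !tsum; apply: eq_bigr => w _; rewrite !tE.
case: (eqVneq (ycoord i x w) 0) => [->|/Px Pw]; first by rewrite !mul0r.
by rewrite TU.
Qed.

Lemma spanned_and i P Q x :
  spanned i P x -> spanned i Q x -> spanned i (fun w => P w /\ Q w) x.
Proof. by move=> hP hQ N w w0; split; [apply: hP | apply: hQ]. Qed.

Lemma ycoord_restr_op i N (T : X -> X) x (v : N.-tuple 'I_n) : linear T -> size_local T ->
  ycoord i (T x) v = \sum_(w : N.-tuple 'I_n) ycoord i x w * ycoord i (T (yX i w)) v.
Proof.
move=> lT sT; rewrite (@ycoord_eq i N _ (T (restr N x))); last first.
  by apply: sT => z sz; rewrite restr_id.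
by rewrite (restrE i) linear_comb // ycoord_sum; apply: eq_bigr => w _; rewrite ycoordZ.
Qed.

(** No cancellation is possible: [we i] is injective where it is defined, so the coordinate of
    [eX i x] on [v] is that of [x] on [w] times a nonzero quantum integer. *)
Lemma spanned_eop i Q x : spanned i Q (eX i x) ->
  spanned i (fun w => forall v, we i w = Some v -> Q v) x.
Proof.
move=> hQ N w cw v e; have sv : size v == N by rewrite (we_size e) size_tuple.
have -> : v = Tuple sv by [].
apply: hQ; rewrite ycoord_restr_op; [|exact: eop_linear|exact: local_eop].
rewrite (bigD1 w) //= big1 => [|u uw].
  rewrite addr0 mulf_neq0 // (eop_adapted vr) ycoordZ e mulf_neq0 //.
    by apply: (br_neq0 vr).
  by rewrite ycoord_adapted' eqxx oner_eq0.
rewrite (eop_adapted vr) ycoordZ.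
case e' : (we i u) => [v'|] /=; last by rewrite ycoord0 !mulr0.
rewrite ycoord_adapted'; case: eqP => [vv|_]; last by rewrite !mulr0.
move: uw; rewrite -val_eqE /= => /eqP []; move: (we_Some e); move: (we_Some e').
by rewrite vv => -> [].
Qed.

Lemma spanned_iter_eop i k x : iter k (eX i) x = 0 -> spanned i (fun w => (weps i w < k)%N) x.
Proof.
elim: k x => [|k IH] x.
  by move=> /= -> N w; rewrite ycoord0 eqxx.
rewrite iterSr => /IH /spanned_eop h N w /h hw.
case e : (we i w) => [v|]; first by have [_ _ -> _] := wf_Some (we_Some e); apply: hw.
by move/eqP: e; rewrite we_None => /eqP ->.
Qed.

Lemma spanned_Kop i m x : KX i x = q ^ m *: x -> spanned i (fun w => wwt i w = m) x.
Proof.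
move=> e N w cw; have := congr1 (fun y => ycoord i y w) e.
rewrite /= ycoordZ ycoord_restr_op; [|exact: Kop_linear|exact: local_Kop].
rewrite (bigD1 w) //= big1 => [|u uw].
  rewrite addr0 (Kop_adapted vr) ycoordZ ycoord_adapted eqxx mulr1 mulrC.
  by move/(mulIf cw)/(q_expzI vr).
by rewrite (Kop_adapted vr) ycoordZ ycoord_adapted (negPf uw) !mulr0.
Qed.

(** The linear operator with values [g w] on the adapted vectors, for [g] preserving the length. *)
Definition sop i (g : word -> X) : X -> X :=
  fun x z => \sum_(w : (size z).-tuple 'I_n) ycoord i x w * g w z.

Lemma sop_linear i g : linear (sop i g).
Proof.
move=> c x y; apply/funext => z; rewrite !tE /sop mulr_sumr -big_split.
by apply: eq_bigr => w _; rewrite ycoord_linear mulrDl mulrA.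
Qed.

Lemma sop_local i g : size_local (sop i g).
Proof. by move=> x y N e z sz; apply: eq_bigr => w _; rewrite (@ycoord_eq i _ x y) // sz. Qed.

Lemma sop_adapted i g w :
  (forall u z, size z != size u -> g u z = 0) -> sop i g (yX i w) = g w.
Proof.
move=> sg; apply/funext => z; rewrite /sop; case: (eqVneq (size w) (size z)) => [e|ne].
  pose t : (size z).-tuple 'I_n := Tuple (introT eqP e).
  rewrite (bigD1 t) //= big1 => [|u ut]; rewrite ycoord_adapted'.
    by rewrite eqxx mul1r addr0.
  by rewrite eq_sym -val_eqE /= in ut; rewrite (negPf ut) mul0r.
rewrite big1 ?sg // 1?eq_sym // => u _; rewrite ycoord_adapted'.
by case: eqP => [e|_]; [move: ne; rewrite e size_tuple eqxx | rewrite mul0r].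
Qed.

Lemma sop_qlattice i g x : (forall w, in_lattice (g w)) -> in_qlattice x -> in_qlattice (sop i g x).
Proof.
move=> rg rx z; apply: (van_sum vr) => w _; apply: (vanMr vr); last exact: rg.
exact: van_coord.
Qed.

(** [Ft] and [Et] shift the adapted basis along its strings; [Ft_dvf], [Et_kernel] and [Et_dvf] will
    show that they act on string decompositions as the Kashiwara operators do. *)
Definition Ft i := sop i (fun w => oyX i (wf i w)).
Definition Et i := sop i (fun w => oyX i (we i w)).

HB.instance Definition _ i := GRing.isLinear.Build F X X *:%R (Ft i) (sop_linear i _).
HB.instance Definition _ i := GRing.isLinear.Build F X X *:%R (Et i) (sop_linear i _).

Lemma Ft_adapted i w : Ft i (yX i w) = oyX i (wf i w).
Proof.
apply: sop_adapted => u z; case e: (wf i u) => [v|] //= sz.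
by rewrite adapted_size //; have [_ _ _ ->] := wf_Some e.
Qed.

Lemma Et_adapted i w : Et i (yX i w) = oyX i (we i w).
Proof.
apply: sop_adapted => u z; case e: (we i u) => [v|] //= sz.
by rewrite adapted_size // (we_size e).
Qed.

Lemma delta_lattice w : in_lattice (delta w).
Proof. by move=> z; rewrite deltaE; case: (_ == _); [apply: (vr1 vr) | apply: (reg0 vr)]. Qed.

Lemma qlatticeD x y : in_qlattice x -> in_qlattice y -> in_qlattice (x + y).
Proof. by move=> hx hy z; apply: (vanD vr). Qed.
Lemma qlatticeB x y : in_qlattice x -> in_qlattice y -> in_qlattice (x - y).
Proof. by move=> hx hy z; apply: (vanB vr). Qed.
Lemma latticeD x y : in_lattice x -> in_lattice y -> in_lattice (x + y).
Proof. by move=> hx hy z; apply: (regD vr). Qed.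
Lemma qlatticeW x : in_qlattice x -> in_lattice x.
Proof. by move=> hx z; apply: (vanW vr). Qed.
Lemma qlattice0 : in_qlattice 0. Proof. by move=> z; apply: (van0 vr). Qed.

Lemma adapted_lattice i w : in_lattice (yX i w).
Proof.
rewrite -(subrK (delta w) (yX i w)); apply: latticeD; last exact: delta_lattice.
by apply: qlatticeW; apply: (adapted_cong vr).
Qed.

Lemma oadapted_lattice i o : in_lattice (oyX i o).
Proof. by case: o => [w|]; [apply: adapted_lattice | apply/qlatticeW/qlattice0]. Qed.

Definition odelta (o : option word) : X := oapp delta 0 o.

Lemma oadapted_cong i o : in_qlattice (oyX i o - odelta o).
Proof.
case: o => [w|] /=; first exact: (adapted_cong vr).
by rewrite subrr; apply: qlattice0.
Qed.

Lemma Ft_qlattice i x : in_qlattice x -> in_qlattice (Ft i x).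
Proof. by apply: sop_qlattice => w; apply: oadapted_lattice. Qed.
Lemma Et_qlattice i x : in_qlattice x -> in_qlattice (Et i x).
Proof. by apply: sop_qlattice => w; apply: oadapted_lattice. Qed.

(** Replace [delta w] by the adapted vector congruent to it: on that vector [Ft] is known exactly,
    and the difference stays in the q-lattice because adapted coordinates of vanishing vectors
    vanish. *)
Lemma Ft_delta i x w : in_qlattice (x - delta w) -> in_qlattice (Ft i x - odelta (wf i w)).
Proof.
move=> hx; have -> : Ft i x - odelta (wf i w) =
  Ft i (x - delta w) - Ft i (yX i w - delta w) + (oyX i (wf i w) - odelta (wf i w)).
  by rewrite !linearB /= Ft_adapted; apply/funext => z; rewrite !tE; ring.
apply: qlatticeD; last exact: oadapted_cong.
by apply: qlatticeB; apply: Ft_qlattice => //; apply: (adapted_cong vr).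
Qed.

Lemma Et_delta i x w : in_qlattice (x - delta w) -> in_qlattice (Et i x - odelta (we i w)).
Proof.
move=> hx; have -> : Et i x - odelta (we i w) =
  Et i (x - delta w) - Et i (yX i w - delta w) + (oyX i (we i w) - odelta (we i w)).
  by rewrite !linearB /= Et_adapted; apply/funext => z; rewrite !tE; ring.
apply: qlatticeD; last exact: oadapted_cong.
by apply: qlatticeB; apply: Et_qlattice => //; apply: (adapted_cong vr).
Qed.

End KashiwaraOnTensors.

(** * Highest weight vectors and strings *)

Section HighestWeightVectors.
Variables (F : fieldType) (q : F) (reg : F -> Prop) (n : nat).
Hypothesis vr : valuation_ring_at q reg.
Local Notation idx := 'I_n.-1.

Let q0 := q_neq0 vr.

(** A common interface for the abstract module and the tensor power. The commutator of e and f is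
    required only on eigenvectors of [K i], where it is multiplication by a quantum integer. *)
Record highest_weight_data (A : lmodType F) (e f K : idx -> A -> A)
    (m : idx -> int) (t : A) : Prop := {
  hd_e_lin : forall i, linear (e i);
  hd_f_lin : forall i, linear (f i);
  hd_K_lin : forall i, linear (K i);
  hd_Kf : forall i j x, K i (f j x) = q ^ (- cartan i j) *: f j (K i x);
  hd_ef : forall i j (a : int) x, K i x = q ^ a *: x ->
    e i (f j x) = f j (e i x) + (i == j)%:R *: (br q a *: x);
  hd_Kt : forall i, K i t = q ^ m i *: t;
  hd_et : forall i, e i t = 0 }.

Definition fseq (A : Type) (f : idx -> A -> A) (I : seq idx) (t : A) : A :=
  foldr f t I.

Definition fcomb (A : lmodType F) (f : idx -> A -> A) (t : A)
    (s : seq (F * seq idx)) : A :=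
  \sum_(p <- s) p.1 *: fseq f p.2 t.

Definition seq_wt (m : idx -> int) (I : seq idx) (i : idx) : int :=
  m i - \sum_(j <- I) cartan i j.

(** The formal result of moving e_i to the right through a product of f's. The coefficients depend
    only on the highest weight [m], hence agree in any two modules with the same [m]; this is what
    makes [hw_graph] stable under e. *)
Fixpoint e_fseq (m : idx -> int) (i : idx) (I : seq idx) : seq (F * seq idx) :=
  if I is j :: I' then
    [seq (p.1, j :: p.2) | p <- e_fseq m i I'] ++
    [:: ((i == j)%:R * br q (seq_wt m I' i), I')]
  else [::].

Definition e_fcomb m i (s : seq (F * seq idx)) :=
  flatten [seq [seq (p.1 * r.1, r.2) | r <- e_fseq m i p.2] | p <- s].
Definition f_fcomb (i : idx) (s : seq (F * seq idx)) := [seq (p.1, i :: p.2) | p <- s].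
Definition K_fcomb m i (s : seq (F * seq idx)) :=
  [seq (p.1 * q ^ seq_wt m p.2 i, p.2) | p <- s].
Definition scale_fcomb (c : F) (s : seq (F * seq idx)) := [seq (c * p.1, p.2) | p <- s].

Section Data.
Variables (A : lmodType F) (e f K : idx -> A -> A) (m : idx -> int) (t : A).
Hypothesis hd : highest_weight_data e f K m t.

Lemma linop0 (B C : lmodType F) (T : B -> C) : linear T -> T 0 = 0.
Proof. by move=> lT; have := lT (-1) 0 0; rewrite scaler0 addr0 scaleN1r addNr. Qed.

Lemma linopD (B C : lmodType F) (T : B -> C) : linear T -> forall x y, T (x + y) = T x + T y.
Proof. by move=> lT x y; have := lT 1 x y; rewrite !scale1r. Qed.

Lemma linopZ (B C : lmodType F) (T : B -> C) : linear T -> forall c x, T (c *: x) = c *: T x.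
Proof. by move=> lT c x; have := lT c x 0; rewrite !addr0 (linop0 lT) addr0. Qed.

Lemma linop_sum (B C : lmodType F) (T : B -> C) : linear T ->
  forall I (r : seq I) (c : I -> F) (E : I -> B),
  T (\sum_(j <- r) c j *: E j) = \sum_(j <- r) c j *: T (E j).
Proof.
move=> lT I r c E; elim/big_rec2: _ => [|j u v _ <-]; first exact: linop0.
by rewrite lT.
Qed.

Lemma K_fseq I i : K i (fseq f I t) = q ^ seq_wt m I i *: fseq f I t.
Proof.
elim: I => [|j I IH] /=; first by rewrite /seq_wt big_nil subr0; apply: hd_Kt hd i.
rewrite (hd_Kf hd) IH (linopZ (hd_f_lin hd j)) scalerA -expfzDr //; congr (q ^ _ *: _).
by rewrite /seq_wt big_cons opprD addrCA.
Qed.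

Lemma fcomb_cat s1 s2 : fcomb f t (s1 ++ s2) = fcomb f t s1 + fcomb f t s2.
Proof. exact: big_cat. Qed.

Lemma fcomb_scale c s : fcomb f t (scale_fcomb c s) = c *: fcomb f t s.
Proof.
rewrite /fcomb big_map scaler_sumr; apply: eq_bigr => p _ /=.
by rewrite scalerA.
Qed.

Lemma fcomb_f i s : fcomb f t (f_fcomb i s) = f i (fcomb f t s).
Proof. by rewrite /fcomb (linop_sum (hd_f_lin hd i)) big_map. Qed.

Lemma fcomb_K i s : fcomb f t (K_fcomb m i s) = K i (fcomb f t s).
Proof.
rewrite /fcomb (linop_sum (hd_K_lin hd i)) big_map; apply: eq_bigr => p _ /=.
by rewrite K_fseq scalerA.
Qed.

Lemma fcomb_e_fseq i I : fcomb f t (e_fseq m i I) = e i (fseq f I t).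
Proof.
elim: I => [|j I IH] /=; first by rewrite /fcomb big_nil (hd_et hd).
rewrite fcomb_cat (fcomb_f j) IH (hd_ef hd _ (K_fseq I i)).
by rewrite /fcomb big_seq1 /= scalerA.
Qed.

Lemma fcomb_e i s : fcomb f t (e_fcomb m i s) = e i (fcomb f t s).
Proof.
rewrite /fcomb (linop_sum (hd_e_lin hd i)) /e_fcomb big_flatten big_map.
apply: eq_bigr => p _; rewrite big_map -fcomb_e_fseq /fcomb scaler_sumr.
by apply: eq_bigr => r _ /=; rewrite scalerA.
Qed.

Definition f_span (x : A) : Prop := exists s, x = fcomb f t s.

End Data.

(* Comparison of two modules f_span by highest weight vectors of the same
   weight: the graph of the correspondence [f_I t |-> f_I t']. *)
Definition hw_graph (A B : lmodType F) (f : idx -> A -> A) (t : A)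
    (f' : idx -> B -> B) (t' : B) (x : A) (y : B) : Prop :=
  exists s, x = fcomb f t s /\ y = fcomb f' t' s.

(** A nonempty sum of simple roots is a nonzero weight. If all coroots killed it, its coordinates
    [g] would be constant; their total is 0, so they would all be 0. But pairing [g] with the
    function sending k to -k counts the roots in the sum. *)
Lemma cartan_seq_nonzero (I : seq idx) : I != [::] -> exists i, \sum_(j <- I) cartan i j != 0.
Proof.
case: I => [//|j0 I0] _; set I := j0 :: I0; apply: contrapT => hN.
have h i : \sum_(j <- I) cartan i j = 0.
  by apply/eqP; apply: contrapT => /negP ?; apply: hN; exists i.
pose g (k : 'I_n) : int := \sum_(j <- I) ((k == fst_idx j)%:Z - (k == snd_idx j)%:Z).
have gE i : g (fst_idx i) - g (snd_idx i) = 0.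
  rewrite -(h i) /g -sumrB; apply: eq_bigr => j _.
  by rewrite -lwt_cartan lwtC /lwt; lia.
have n0 : (0 < n)%N by case: (n) (fst_idx j0) => [[]|].
pose k0 : 'I_n := Ordinal n0.
have gc (k : 'I_n) : g k = g k0.
  case: k => k; elim: k => [|k IH] hk; first by congr (g _); apply: val_inj.
  have kn : (k < n.-1)%N by rewrite -ltnS prednK.
  rewrite -(IH (ltnW hk)); have /eqP := gE (Ordinal kn); rewrite subr_eq0 => /eqP e.
  by rewrite (_ : Ordinal hk = snd_idx (Ordinal kn)) -?e; [congr (g _)|]; apply: val_inj.
have sum_delta (w : 'I_n -> int) (a : 'I_n) : \sum_k (k == a)%:Z * w k = w a.
  rewrite (bigD1 a) //= eqxx mul1r big1 ?addr0 // => k /negPf ->.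
  by rewrite mul0r.
have sum_g (w : 'I_n -> int) :
    \sum_k g k * w k = \sum_(j <- I) (w (fst_idx j) - w (snd_idx j)).
  under eq_bigr => k _ do rewrite /g mulr_suml.
  rewrite exchange_big /=; apply: eq_bigr => j _.
  under eq_bigr => k _ do rewrite mulrBl.
  by rewrite sumrB !sum_delta.
have g0 : g k0 = 0.
  have := sum_g (fun=> 1); under eq_bigr => k _ do rewrite mulr1 gc.
  rewrite sumr_const card_ord big1 => [/eqP|j _]; last by rewrite subrr.
  by rewrite mulrn_eq0 => /orP[|/eqP //]; rewrite -leqn0 leqNgt n0.
have := sum_g (fun k => - (k : nat)%:Z).
rewrite big1 => [|k _]; last by rewrite gc g0 mul0r.
rewrite (eq_bigr (fun=> 1)) => [|j _]; last by rewrite /=; lia.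
have : 0 <= \sum_(j <- I0) (1 : int) by apply: sumr_ge0.
rewrite /I big_cons => h0 e; have : (0 : int) < 0 by rewrite [X in _ < X]e ltr_pwDl.
by rewrite ltxx.
Qed.

(** Applying [K i - c j i], where [c j i] differs from [d i], removes the term j from the sum,
    rescales the others, and multiplies [u] by a nonzero scalar. *)
Lemma weight_vectors_independent (A : lmodType F) (K : idx -> A -> A) (d : idx -> F)
    (J : Type) (r : seq J) (P : pred J) (x : J -> A) (c : J -> idx -> F) (u : A) :
  (forall i, linear (K i)) ->
  (forall i, K i u = d i *: u) ->
  (forall j, P j -> (forall i, K i (x j) = c j i *: x j) /\ exists i, c j i != d i) ->
  u = \sum_(j <- r | P j) x j -> u = 0.
Proof.
move=> lK; elim: r u x => [|j r IH] u x Ku Kx; first by rewrite big_nil.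
rewrite big_cons; case: ifP => [Pj|_] eu; last exact: IH eu.
have [Kxj [i ci]] := Kx j Pj.
have : (d i - c j i) *: u = 0.
  apply: (IH _ (fun k => (c k i - c j i) *: x k)).
  - by move=> k; rewrite (linopZ (lK k)) Ku !scalerA mulrC.
  - move=> k Pk; have [Kxk ex] := Kx k Pk; split=> // l.
    by rewrite (linopZ (lK l)) Kxk !scalerA mulrC.
  rewrite scalerBl -Ku {1}eu (linopD (lK i)) Kxj eu scalerDr opprD addrACA subrr add0r.
  rewrite scaler_sumr -sumrN -[X in X + _]/(K i _).
  have -> : K i (\sum_(k <- r | P k) x k) = \sum_(k <- r | P k) c k i *: x k.
    elim/big_rec2: _ => [|k a b Pk eb]; first exact: linop0.
    by rewrite (linopD (lK i)) (Kx k Pk).1 eb.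
  by rewrite -big_split; apply: eq_bigr => k _; rewrite scalerBl.
move/eqP; rewrite scaler_eq0 subr_eq0 => /orP[/eqP e|/eqP //].
by rewrite e eqxx in ci.
Qed.

Section Comparison.
Variables (A B : lmodType F) (e f K : idx -> A -> A) (e' f' K' : idx -> B -> B).
Variables (m : idx -> int) (t : A) (t' : B).
Hypothesis hd : highest_weight_data e f K m t.
Hypothesis hd' : highest_weight_data e' f' K' m t'.
Local Notation G := (hw_graph f t f' t').

Lemma hw_graph_top : G t t'.
Proof. by exists [:: (1, [::])]; rewrite /fcomb !big_seq1 /= !scale1r. Qed.

Lemma hw_graph_lin c x y x' y' : G x y -> G x' y' -> G (c *: x + x') (c *: y + y').
Proof.
move=> [s [-> ->]] [r [-> ->]]; exists (scale_fcomb c s ++ r).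
by rewrite !fcomb_cat !fcomb_scale.
Qed.

Lemma hw_graph0 : G 0 0.
Proof. by exists [::]; rewrite /fcomb !big_nil. Qed.

Lemma hw_graph_f i x y : G x y -> G (f i x) (f' i y).
Proof.
by move=> [s [-> ->]]; exists (f_fcomb i s); rewrite (fcomb_f hd) (fcomb_f hd').
Qed.

Lemma hw_graph_e i x y : G x y -> G (e i x) (e' i y).
Proof.
by move=> [s [-> ->]]; exists (e_fcomb m i s); rewrite (fcomb_e hd) (fcomb_e hd').
Qed.

Lemma hw_graph_K i x y : G x y -> G (K i x) (K' i y).
Proof.
by move=> [s [-> ->]]; exists (K_fcomb m i s); rewrite (fcomb_K hd) (fcomb_K hd').
Qed.

Lemma hw_graph_Kinv i x y : G x y -> exists x' y', [/\ G x' y', K i x' = x & K' i y' = y].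
Proof.
move=> [s [-> ->]]; pose r := [seq (p.1 * q ^ (- seq_wt m p.2 i), p.2) | p <- s].
have e_r : K_fcomb m i r = s.
  rewrite /K_fcomb /r -map_comp -[RHS]map_id; apply: eq_map => -[c I] /=.
  by rewrite -mulrA -expfzDr // addNr expr0z mulr1.
exists (fcomb f t r), (fcomb f' t' r); split; first by exists r.
  by rewrite -(fcomb_K hd) e_r.
by rewrite -(fcomb_K hd') e_r.
Qed.

(* Everything below the top weight is spanned by vectors of other weights. *)
Lemma fcomb_top (s : seq (F * seq idx)) (u : A) :
  u = fcomb f t s -> (forall i, K i u = q ^ m i *: u) ->
  u = (\sum_(p <- s | p.2 == [::]) p.1) *: t.
Proof.
move=> eu Ku; apply/eqP; rewrite -subr_eq0; apply/eqP.
apply: (weight_vectors_independent (K := K) (d := fun i => q ^ m i)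
   (P := fun p : F * seq idx => p.2 != [::])
   (x := fun p => p.1 *: fseq f p.2 t) (c := fun p i => q ^ seq_wt m p.2 i) (r := s)).
- exact: hd_K_lin hd.
- move=> i; rewrite addrC -scaleNr (hd_K_lin hd) Ku (hd_Kt hd) scalerDr !scalerA.
  by rewrite mulrC.
- move=> [c I] /= I0; split.
    by move=> i; rewrite (linopZ (hd_K_lin hd i)) (K_fseq hd) !scalerA mulrC.
  have [i hi] := cartan_seq_nonzero I0; exists i.
  apply: contraNneq hi => /(q_expzI vr); rewrite /seq_wt => /eqP.
  by rewrite -subr_eq0 addrAC subrr add0r oppr_eq0.
rewrite eu /fcomb (bigID (fun p : F * seq idx => p.2 == [::])) /= scaler_suml.
rewrite addrAC [X in X - _](eq_bigr (fun p => p.1 *: t)) ?subrr ?add0r //.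
by move=> [c I] /= /eqP ->.
Qed.

End Comparison.

End HighestWeightVectors.

(** * String decompositions inside submodules of the tensor powers *)

Section Strings.
Variables (F : fieldType) (q : F) (reg : F -> Prop) (n : nat).
Hypothesis vr : valuation_ring_at q reg.
Local Notation word := (seq 'I_n).
Local Notation idx := 'I_n.-1.
Local Notation X := (tensors F n).
Local Notation fX := (@fop F q n).
Local Notation eX := (@eop F q n).
Local Notation KX := (@Kop F q n).
Local Notation yX := (@adapted F q n).
Local Notation oyX := (@oadapted F q n).
Local Notation Ft := (Ft vr).
Local Notation Et := (Et vr).

Let q0 := q_neq0 vr.
Let qq := q_qV_neq0 vr.

Let eX_lin (i : idx) : linear (eX i). Proof. exact: eop_linear. Qed.
Let fX_lin (i : idx) : linear (fX i). Proof. exact: fop_linear. Qed.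

Lemma tensors_hd (m : idx -> int) (t : X) :
  (forall i, KX i t = q ^ m i *: t) -> (forall i, eX i t = 0) ->
  highest_weight_data q eX fX KX m t.
Proof.
move=> Kt et; split=> //.
- by move=> i; apply: Kop_linear.
- by move=> i j x; rewrite Kop_f.
move=> i j a x Kx; apply/eqP; rewrite addrC -subr_eq; apply/eqP.
rewrite eopfop // Kx; have -> : Kiop q i x = q ^ (- a) *: x.
  rewrite -{2}(KopK q0 i x) Kx linearZ /= scalerA -expfzDr //.
  by rewrite addNr expr0z scale1r.
by congr (_ *: _); rewrite -scalerBl scalerA /br mulrC.
Qed.

Lemma linear_iter k (T : X -> X) : linear T -> linear (iter k T).
Proof. by move=> lT; elim: k => [|k IH] c x y //=; rewrite IH lT. Qed.

Definition qf (k : nat) : F := qfact q k.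
Lemma qf0 : qf 0 = 1. Proof. exact: big_ord0. Qed.
Lemma qfS k : qf k.+1 = qf k * br q k.+1%:Z.
Proof. by rewrite /qf /qfact big_ord_recr /= br_qint. Qed.
Lemma qf_neq0 k : qf k != 0.
Proof. by elim: k => [|k IH]; rewrite ?qf0 ?oner_eq0 // qfS mulf_neq0 // (br_neq0 vr). Qed.

(** The product of the quantum integers from p+1 to p+k: the factor by which k steps of e act on an
    adapted vector with [wphi] equal to p. *)
Fixpoint ecoef (k p : nat) : F := if k is k'.+1 then br q p.+1%:Z * ecoef k' p.+1 else 1.
Lemma ecoef_neq0 k p : ecoef k p != 0.
Proof. by elim: k p => [|k IH] p /=; rewrite ?oner_eq0 // mulf_neq0 // (br_neq0 vr). Qed.

Definition dvf i k (x : X) : X := (qf k)^-1 *: iter k (fX i) x.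

Lemma dvf_linear i k : linear (dvf i k).
Proof.
move=> c x y; rewrite /dvf (linear_iter _ (fX_lin i)) // scalerDr !scalerA.
by rewrite mulrC.
Qed.

Lemma dvf_local i k : size_local (dvf i k).
Proof. by apply: local_scale; apply: local_iter; apply: local_fop. Qed.

Lemma Kop_dvf l i k x (m : int) : KX l x = q ^ m *: x ->
  KX l (dvf i k x) = q ^ (m - cartan l i *+ k) *: dvf i k x.
Proof.
move=> Kx; rewrite /dvf linearZ /= scalerA mulrC -scalerA; congr (_ *: _).
elim: k => [|k IH] /=; first by rewrite mulr0n subr0.
rewrite Kop_f // IH linearZ /= scalerA -expfzDr //; congr (q ^ _ *: _).
by rewrite mulrS opprD addrCA.
Qed.

Lemma iter_eop_adapted0 i k v : (weps i v < k)%N -> iter k (eX i) (yX i v) = 0.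
Proof.
elim: k v => [//|k IH] v hk; rewrite iterSr (eop_adapted vr).
rewrite (linopZ (linear_iter k (eX_lin i))).
case e: (we i v) => [u|] /=; last first.
  by rewrite (linop0 (linear_iter k (eX_lin i))) scaler0.
have [_ _ e1 _] := wf_Some (we_Some e).
by rewrite IH ?scaler0 // -ltnS -e1.
Qed.

Lemma adapted_string i k v : weps i v = k -> exists u,
  [/\ iter k (eX i) (yX i v) = ecoef k (wphi i v) *: yX i u,
      iter k (fX i) (yX i u) = qf k *: yX i v,
      weps i u = 0%N & wphi i u = (wphi i v + k)%N].
Proof.
elim: k v => [|k IH] v ek.
  by exists v; rewrite /= qf0 !scale1r addn0.
case e: (we i v) => [v1|]; last by move/eqP: e; rewrite we_None ek.
have [f1 p1 e1 _] := wf_Some (we_Some e).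
have [u [h1 h2 h3 h4]] := IH v1 (congr1 predn (etrans (esym e1) ek)).
exists u; split=> //; last by rewrite h4 p1 addnS addSn.
  rewrite iterSr (eop_adapted vr) e /= (linopZ (linear_iter k (eX_lin i))) h1.
  by rewrite scalerA p1.
have ek1 : weps i v1 = k by move: e1; rewrite ek => -[].
by rewrite iterS h2 linearZ /= (fop_adapted vr) (we_Some e) /= scalerA qfS ek1.
Qed.

Section Closed.
Variables (i : idx) (M : X -> Prop).
Hypothesis M_lin : forall c x y, M x -> M y -> M (c *: x + y).
Hypothesis M_e : forall x, M x -> M (eX i x).
Hypothesis M_f : forall x, M x -> M (fX i x).

Lemma M_zero x : M x -> M 0.
Proof. by move=> Mx; have := M_lin (-1) Mx Mx; rewrite scaleN1r addNr. Qed.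

Lemma M_scale c x : M x -> M (c *: x).
Proof. by move=> Mx; have := M_lin c Mx (M_zero Mx); rewrite addr0. Qed.

Lemma M_iter (T : X -> X) k x : (forall x, M x -> M (T x)) -> M x -> M (iter k T x).
Proof. by move=> hT Mx; elim: k => //= k; apply: hT. Qed.

Lemma M_dvf k x : M x -> M (dvf i k x).
Proof. by move=> Mx; apply: M_scale; apply: M_iter. Qed.

Lemma K_iter_e l k x (m : int) : KX l x = q ^ m *: x ->
  KX l (iter k (eX i) x) = q ^ (m + cartan l i *+ k) *: iter k (eX i) x.
Proof.
move=> Kx; elim: k => [|k IH] /=; first by rewrite mulr0n addr0.
by rewrite Kop_e // IH linearZ /= scalerA -expfzDr // mulrS addrCA.
Qed.

(** The component of largest index is a multiple of e^k x, hence lies in [M]; subtracting its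
    divided power leaves a vector killed by one power of e less. Only adapted vectors with [weps]
    equal to k survive e^k, and the weight then fixes their [wphi], so a single scalar works for all
    of them. *)
Lemma string_exists (m : idx -> int) k x :
  M x -> (forall l, KX l x = q ^ m l *: x) -> iter k (eX i) x = 0 ->
  exists us : seq X, [/\ size us = k,
    x = \sum_(0 <= j < k) dvf i j us`_j
  & forall j, (j < k)%N ->
    [/\ M us`_j, forall l, KX l us`_j = q ^ (m l + cartan l i *+ j) *: us`_j,
        eX i us`_j = 0 & dvf i j us`_j = 0 -> us`_j = 0]].
Proof.
elim: k x => [|k IH] x Mx Kx ex.
  by exists [::]; split=> //; rewrite big_geq.
pose P v := ((weps i v < k.+1)%N /\ wwt i v = m i).
have Px : spanned vr i P x.
  by apply: spanned_and; [apply: spanned_iter_eop | apply: spanned_Kop].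
have le := linear_iter k (eX_lin i).
have lf := linear_iter k (fX_lin i).
have loce := local_iter k (@local_eop F q n i).
have locf := local_iter k (@local_fop F q n i).
suff [w [Mw Kw [ew dw] ekw]] : exists w, [/\ M w,
    forall l, KX l w = q ^ (m l + cartan l i *+ k) *: w,
    eX i w = 0 /\ (dvf i k w = 0 -> w = 0)
  & iter k (eX i) (x - dvf i k w) = 0].
  have [||us [sus xus hus]] := IH (x - dvf i k w) _ _ ekw.
  - by rewrite addrC -scaleN1r; apply: M_lin => //; apply: M_dvf.
  - move=> l; rewrite linearB /= Kx scalerBr; congr (_ - _).
    by rewrite (Kop_dvf i k (Kw l)) addrK.
  exists (rcons us w); split=> [||j jk].
  - by rewrite size_rcons sus.
  - rewrite big_nat_recr //= nth_rcons sus ltnn eqxx.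
    rewrite -[LHS](subrK (dvf i k w)) {1}xus; congr (_ + _).
    by rewrite !big_nat; apply: eq_bigr => j /andP[_ jk]; rewrite nth_rcons sus jk.
  rewrite nth_rcons sus; case: ltngtP => [jk'|jk'|->]; first exact: hus.
    by move: jk; rewrite ltnS leqNgt jk'.
  by split.
have Kek l := K_iter_e k (Kx l).
(* An adapted vector with [weps] equal to k would have [wphi] equal to m i + k. If this is negative
   there is none, e^k x is already 0, and the component is 0. *)
case: (lerP 0 (m i + k%:Z)) => [mk|mk]; last first.
  have ek0 : iter k (eX i) x = 0.
    apply: (@spanned_eq _ _ _ _ vr i P _ (fun=> 0)) => //.
    - by move=> c y z; rewrite scaler0 addr0.
    move=> v [ev wv]; apply: iter_eop_adapted0; move: wv; rewrite wwt_phi_eps; lia.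
  exists 0; rewrite /dvf (linop0 lf) scaler0 subr0 linear0; split=> //.
    exact: M_zero Mx.
  by move=> l; rewrite linear0 scaler0.
have [p ep] : exists p : nat, m i + k%:Z = p%:Z by exists (absz (m i + k%:Z)); lia.
have c0 := ecoef_neq0 k p.
have EFE : iter k (eX i) (dvf i k (iter k (eX i) x)) = ecoef k p *: iter k (eX i) x.
  apply: (@spanned_eq _ _ _ _ vr i P (fun y => iter k (eX i) (dvf i k (iter k (eX i) y)))
    (fun y => ecoef k p *: iter k (eX i) y)) => //.
  - by move=> c y z; rewrite le dvf_linear le.
  - by move=> c y z; rewrite le scalerDr !scalerA mulrC.
  - by apply: (local_comp loce (local_comp (@dvf_local i k) loce)).
  - exact: local_scale.
  move=> v [ev wv]; case: (ltngtP (weps i v) k) => [lt|lt|ek].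
  - by rewrite iter_eop_adapted0 // (linop0 (dvf_linear i k)) (linop0 le) scaler0.
  - by move: ev; rewrite ltnS leqNgt lt.
  have [u [h1 h2 h3 h4]] := adapted_string ek.
  rewrite h1 (linopZ (dvf_linear i k)) (linopZ le) /dvf h2 (scalerA (qf k)^-1) mulVf ?qf_neq0 // scale1r.
  by rewrite h1; congr (ecoef _ _ *: _); move: wv; rewrite wwt_phi_eps; lia.
exists ((ecoef k p)^-1 *: iter k (eX i) x); split.
- by apply: M_scale; apply: M_iter.
- by move=> l; rewrite linearZ /= Kek !scalerA mulrC.
- split; first by rewrite linearZ /= -iterS ex scaler0.
  rewrite (linopZ (dvf_linear i k)) => /eqP; rewrite scaler_eq0 invr_eq0 (negPf c0) /= => /eqP h.
  move: EFE; rewrite h (linop0 le) => /esym/eqP.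
  by rewrite scaler_eq0 (negPf c0) => /eqP ->; rewrite scaler0.
rewrite -scaleN1r addrC le (linopZ (dvf_linear i k)) (linopZ le) EFE (scalerA (ecoef k p)^-1).
by rewrite mulVf // scale1r scaleN1r addNr.
Qed.

End Closed.

Definition owf i k (v : word) : option word := iter k (obind (wf i)) (Some v).

Lemma dvf_adapted i k v : weps i v = 0%N -> dvf i k (yX i v) = oyX i (owf i k v).
Proof.
move=> e0; suff [h _] : iter k (fX i) (yX i v) = qf k *: oyX i (owf i k v) /\
   (forall u, owf i k v = Some u -> weps i u = k).
  by rewrite /dvf h scalerA mulVf ?qf_neq0 // scale1r.
elim: k => [|k [IH1 IH2]]; first by rewrite qf0 scale1r; split=> // u [<-].
rewrite iterS IH1 linearZ /= -/(owf i k v).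
case e: (owf i k v) => [u|] /=; last by rewrite linear0 !scaler0.
rewrite (fop_adapted vr) scalerA (IH2 _ e) qfS; split=> // u' /wf_Some [_ _ -> _].
by rewrite (IH2 _ e).
Qed.

Lemma owf_phi i k v : (owf i k v == None) = (wphi i v < k)%N.
Proof.
suff: (owf i k v == None) = (wphi i v < k)%N /\
   (forall u, owf i k v = Some u -> (wphi i u + k)%N = wphi i v) by case.
elim: k => [|k [IH1 IH2]]; first by split=> // u [<-]; rewrite addn0.
rewrite /owf iterS -/(owf i k v); case e: (owf i k v) IH1 IH2 => [u|] /= IH1 IH2.
  have hu := IH2 _ erefl; split; last first.
    by move=> u' /wf_Some [_ h _ _]; rewrite -hu h addnS addSn.
  by rewrite wf_None -hu; lia.
by split=> //; move: IH1; rewrite eqxx => /esym h; rewrite ltnS (ltnW h).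
Qed.

(** A vector killed by e involves only adapted vectors with [weps] zero, and on these the divided
    powers of f are again adapted vectors or 0. *)
Lemma Ft_dvf i k x : eX i x = 0 -> Ft i (dvf i k x) = dvf i k.+1 x.
Proof.
move=> ex; apply: (@spanned_eq _ _ _ _ vr i (fun v => (weps i v < 1)%N)
   (fun y => Ft i (dvf i k y)) (dvf i k.+1)).
- by move=> c y z; rewrite dvf_linear linearP.
- exact: dvf_linear.
- by apply: (local_comp (@sop_local _ _ _ _ vr i _) (@dvf_local i k)).
- exact: dvf_local.
- move=> v; rewrite ltnS leqn0 => /eqP e0; rewrite !dvf_adapted // /owf iterS -/(owf i k v).
  by case: (owf i k v) => [u|] /=; rewrite ?Ft_adapted ?linear0.
exact: (spanned_iter_eop (k := 1)).
Qed.

Lemma Et_kernel i x : eX i x = 0 -> Et i x = 0.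
Proof.
move=> ex; apply: (@spanned_eq _ _ _ _ vr i (fun v => (weps i v < 1)%N) (Et i) (fun=> 0)).
- exact: linearP.
- by move=> c y z; rewrite scaler0 addr0.
- exact: sop_local.
- by [].
- by move=> v; rewrite ltnS leqn0 -we_None Et_adapted => /eqP ->.
exact: (spanned_iter_eop (k := 1)).
Qed.

(** If [m] is at least k+1, all strings involved are long enough for k+1 steps, and [Et] undoes the
    last one. Otherwise the divided power is 0, and the last hypothesis, the normalisation in string
    decompositions, forces [x] to be 0. *)
Lemma Et_dvf i k m x : eX i x = 0 -> KX i x = q ^ m *: x ->
  (dvf i k.+1 x = 0 -> x = 0) -> Et i (dvf i k.+1 x) = dvf i k x.
Proof.
move=> ex Kx hx; pose P v := ((weps i v < 1)%N /\ wwt i v = m).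
have Px : spanned vr i P x.
  by apply: spanned_and; [apply: (spanned_iter_eop (k := 1)) | apply: spanned_Kop].
case: (lerP k.+1%:Z m) => km.
  apply: (@spanned_eq _ _ _ _ vr i P (fun y => Et i (dvf i k.+1 y)) (dvf i k)) => //.
  - by move=> c y z; rewrite dvf_linear linearP.
  - exact: dvf_linear.
  - by apply: (local_comp (@sop_local _ _ _ _ vr i _) (@dvf_local i k.+1)).
  - exact: dvf_local.
  move=> v [e0 wv]; have {}e0 : weps i v = 0%N by lia.
  rewrite !dvf_adapted // /owf iterS -/(owf i k v).
  case e: (owf i k v) => [u|] /=; last by rewrite linear0.
  case e': (wf i u) => [u'|] /=; last first.
    have /eqP : owf i k.+1 v = None by rewrite /owf iterS -/(owf i k v) e.
    by rewrite owf_phi; move: wv; rewrite wwt_phi_eps; lia.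
  by have [h _ _ _] := wf_Some e'; rewrite Et_adapted h.
suff -> : x = 0.
  by rewrite !(linop0 (dvf_linear _ _)) linear0.
apply: hx; apply: (@spanned_eq _ _ _ _ vr i P (dvf i k.+1) (fun=> 0)) => //.
- exact: dvf_linear.
- by move=> c y z; rewrite scaler0 addr0.
- exact: dvf_local.
move=> v [e0 wv]; rewrite dvf_adapted; last by lia.
suff -> : owf i k.+1 v = None by [].
by apply/eqP; rewrite owf_phi; move: wv; rewrite wwt_phi_eps; lia.
Qed.

Definition supp N (x : X) := forall z, size z != N -> x z = 0.

Lemma supp_local N (T : X -> X) x : size_local T -> T 0 = 0 -> supp N x -> supp N (T x).
Proof.
move=> lT T0 sx z sz; rewrite (lT x 0 (size z)) ?T0 // => u su.
by rewrite sx // su.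
Qed.

Lemma weps_size i (v : word) : (weps i v <= size v)%N.
Proof. by elim: v => //= k v IH; case: ifP => _ //; apply: leqW. Qed.

Lemma eop_nilpotent i N x : supp N x -> iter N.+1 (eX i) x = 0.
Proof.
move=> sx; apply: (@spanned_eq _ _ _ _ vr i (fun v => (weps i v <= N)%N) _ (fun=> 0)).
- by apply: linear_iter; apply: eop_linear.
- by move=> c y z; rewrite scaler0 addr0.
- by apply: local_iter; apply: local_eop.
- by [].
- by move=> v hv; apply: iter_eop_adapted0.
move=> N' w; case: (eqVneq N' N) => [eN _|nN].
  by apply: leq_trans (weps_size _ _) _; rewrite size_tuple eN.
suff -> : ycoord vr i x w = 0 by rewrite eqxx.
by rewrite (ycoord_eq vr i (y := 0)) ?ycoord0 // => z sz; rewrite sx // sz.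
Qed.

Section ClosedUnderKashiwara.
Variables (N : nat) (M : X -> Prop).
Hypothesis M_lin : forall c x y, M x -> M y -> M (c *: x + y).
Hypothesis M_e : forall i x, M x -> M (eX i x).
Hypothesis M_f : forall i x, M x -> M (fX i x).
Hypothesis M_supp : forall x, M x -> supp N x.

Lemma M_sum x0 : M x0 -> forall a b (E : nat -> X),
  (forall j, (a <= j < b)%N -> M (E j)) -> M (\sum_(a <= j < b) E j).
Proof.
move=> M0 a b E hE; rewrite big_nat; elim/big_rec: _ => [|j x /hE Mj Mx].
  by have := M_lin (-1) M0 M0; rewrite scaleN1r addNr.
by rewrite -[E j]scale1r; apply: M_lin.
Qed.

Lemma M_strings i m x : M x -> (forall l, KX l x = q ^ m l *: x) ->
  exists us : seq X, [/\ x = \sum_(0 <= j < size us) dvf i j us`_j,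
    Ft i x = \sum_(0 <= j < size us) dvf i j.+1 us`_j,
    Et i x = \sum_(1 <= j < size us) dvf i j.-1 us`_j
  & forall j, (j < size us)%N ->
    [/\ M us`_j, forall l, KX l us`_j = q ^ (m l + cartan l i *+ j) *: us`_j,
        eX i us`_j = 0 & dvf i j us`_j = 0 -> us`_j = 0]].
Proof.
move=> Mx Kx.
have [us [sus xus hus]] := string_exists M_lin (@M_e i) (@M_f i) Mx Kx (eop_nilpotent i (M_supp Mx)).
exists us; rewrite sus; split=> //.
- rewrite {1}xus linear_sum !big_nat; apply: eq_bigr => j /andP[_ /hus [_ _ ej _]].
  by rewrite /= Ft_dvf.
- rewrite {1}xus linear_sum big_ltn //.
  have [_ _ e0 _] := hus 0%N isT.
  rewrite {1}/dvf /= linearZ /= Et_kernel // scaler0 add0r.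
  rewrite !big_nat; apply: eq_bigr => -[//|j] /hus [_ Kj ej nj] /=.
  by rewrite (Et_dvf ej (Kj i)).
Qed.

(** [Ft] is defined by the adapted basis, whose vectors need not lie in [M]; it preserves weight
    vectors of [M] because their string components lie in [M]. *)
Lemma M_Ft i m x : M x -> (forall l, KX l x = q ^ m l *: x) ->
  M (Ft i x) /\ forall l, KX l (Ft i x) = q ^ (m l - cartan l i) *: Ft i x.
Proof.
move=> Mx Kx; have [us [_ -> _ hus]] := M_strings i Mx Kx; split.
  by apply: (M_sum Mx) => j /andP[_ /hus [Mj _ _ _]]; apply: (M_dvf M_lin (@M_f i)).
move=> l; rewrite linear_sum scaler_sumr !big_nat; apply: eq_bigr => j /andP[_ /hus [_ Kj _ _]].
by rewrite /= (Kop_dvf _ _ (Kj l)); congr (q ^ _ *: _); rewrite mulrS; lia.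
Qed.

End ClosedUnderKashiwara.

End Strings.

(** * Invariant form and lowering operators *)

Section Polarization.
Variables (F : fieldType) (q : F) (n : nat).
Hypothesis q0 : q != 0.
Local Notation X := (tensors F n).
Local Notation fX := (@fop F q n).
Local Notation eX := (@eop F q n).
Local Notation KX := (@Kop F q n).

Definition wform N (x y : X) : F := \sum_(w : N.-tuple 'I_n) x w * y w.

Lemma wformC N x y : wform N x y = wform N y x.
Proof. by apply: eq_bigr => w _; rewrite mulrC. Qed.

Lemma wform_lin N c x y z : wform N (c *: x + y) z = c * wform N x z + wform N y z.
Proof.
rewrite /wform mulr_sumr -big_split; apply: eq_bigr => w _ /=.
by rewrite !tE mulrDl mulrA.
Qed.

Lemma wform0 N z : wform N 0 z = 0.
Proof. by apply: big1 => w _; rewrite mul0r. Qed.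

Lemma wformD N x y z : wform N (x + y) z = wform N x z + wform N y z.
Proof. by rewrite -[x]scale1r wform_lin mul1r scale1r. Qed.

Lemma wformZ N c x z : wform N (c *: x) z = c * wform N x z.
Proof. by rewrite -[c *: x]addr0 wform_lin wform0 addr0. Qed.

Lemma wform_sum N I (r : seq I) (P : pred I) (E : I -> X) z :
  wform N (\sum_(j <- r | P j) E j) z = \sum_(j <- r | P j) wform N (E j) z.
Proof. by elim/big_rec2: _ => [|j a b _ <-]; rewrite ?wform0 ?wformD. Qed.

Lemma sum_tuple_cons (R : zmodType) N (G : seq 'I_n -> R) :
  \sum_(w : N.+1.-tuple 'I_n) G w = \sum_k \sum_(w : N.-tuple 'I_n) G (k :: w).
Proof.
rewrite pair_big (reindex (fun p : 'I_n * N.-tuple 'I_n => cons_tuple p.1 p.2)) //=.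
exists (fun w : N.+1.-tuple 'I_n => (thead w, [tuple of behead w])) => [[k w]|w] _.
  by congr pair; apply: val_inj.
by rewrite [RHS]tuple_eta; apply: val_inj.
Qed.

Lemma wform_cons N x y : wform N.+1 x y = \sum_k wform N (slice k x) (slice k y).
Proof. by rewrite /wform (sum_tuple_cons N (fun w => x w * y w)). Qed.

Lemma wform_K i N x y : wform N (KX i x) y = wform N x (KX i y).
Proof. by apply: eq_bigr => w _; rewrite /Kop mulrCA mulrA. Qed.

(** The adjoint of f_i is K_i e_i up to a scalar. The orthogonal of a submodule is thus stable, and
    f's in one argument can be traded for e's in the other. *)
Lemma wform_f i N x y : wform N (fX i x) y = q^-1 * wform N x (KX i (eX i y)).
Proof.
elim: N x y => [|N IH] x y.
  rewrite /wform mulr_sumr; apply: eq_bigr => w _; rewrite (tuple0 w) /Kop /=.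
  by rewrite mul0r !mulr0.
rewrite !wform_cons mulr_sumr.
under eq_bigr => k _ do rewrite slice_fop wformD wformZ IH wform_K.
under [in RHS]eq_bigr => k _.
  rewrite slice_Kop // slice_eop linearD !linearZ /= scalerDr !scalerA.
  rewrite -expfzDr // addrN expr0z scale1r wformC wformD wformZ mulrDr.
  rewrite ![wform _ _ (slice k x)]wformC.
  over.
rewrite !big_split /=; congr (_ + _).
rewrite (bigD1 (snd_idx i)) //= eqxx mul1r big1 ?addr0 => [|k /negPf ->]; last by rewrite mul0r.
rewrite (bigD1 (fst_idx i)) //= eqxx mulr1 big1 ?addr0 => [|k /negPf ->]; last first.
  by rewrite mulr0 mul0r mulr0.
by rewrite lwt_fst expr1z mulKf.
Qed.

End Polarization.

(** * Lowering operators for the positive roots ending at j *)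

Section LoweringOperators.
Variables (F : fieldType) (q : F) (reg : F -> Prop) (n : nat).
Hypothesis vr : valuation_ring_at q reg.
Local Notation idx := 'I_n.-1.
Local Notation X := (tensors F n).
Local Notation fX := (@fop F q n).
Local Notation eX := (@eop F q n).
Local Notation KX := (@Kop F q n).

Let q0 := q_neq0 vr.
Let qq := q_qV_neq0 vr.

(* The operators, indexed by all natural numbers and zero out of range. *)
Definition fN (k : nat) (x : X) : X := if insub k is Some i then fX i x else 0.
Definition eN (k : nat) (x : X) : X := if insub k is Some i then eX i x else 0.

Definition cartN (i k : nat) : int :=
  if i == k then 2 else if (i.+1 == k) || (k.+1 == i) then -1 else 0.

Definition weightN (w : nat -> int) (x : X) := forall i : idx, KX i x = q ^ w i *: x.

Lemma fN_linear k : linear (fN k).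
Proof.
rewrite /fN => c x y; case: insub => [i|]; first exact: linearP.
by rewrite scaler0 addr0.
Qed.
Lemma eN_linear k : linear (eN k).
Proof.
rewrite /eN => c x y; case: insub => [i|]; first exact: linearP.
by rewrite scaler0 addr0.
Qed.

Lemma eN_fN_neq i k x : i != k -> eN i (fN k x) = fN k (eN i x).
Proof.
rewrite /eN /fN; case: insubP => [a _ ea|_]; case: insubP => [b _ eb|_] ik; rewrite ?linear0 //.
apply/eqP; rewrite -subr_eq0 eopfop // (_ : (a == b) = false) ?scale0r //.
by rewrite -val_eqE /= ea eb (negPf ik).
Qed.

Lemma eN_fN k w x : (k < n.-1)%N -> weightN w x ->
  eN k (fN k x) = fN k (eN k x) + br q (w k) *: x.
Proof.
move=> kn wx; pose i : idx := Ordinal kn.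
rewrite /eN /fN (insubT (fun k => k < n.-1)%N kn) -[Sub _ _]/i.
apply/eqP; rewrite addrC -subr_eq; apply/eqP.
rewrite eopfop // eqxx scale1r (wx i) -[w i]/(w k); have -> : Kiop q i x = q ^ (- w k) *: x.
  rewrite -{2}(KopK q0 i x) (wx i) linearZ /= scalerA -expfzDr //.
  by rewrite addNr expr0z scale1r.
by rewrite -scalerBl scalerA /br mulrC.
Qed.

Lemma weightN_f k w x : weightN w x -> weightN (fun i => w i - cartN i k) (fN k x).
Proof.
rewrite /fN => wx i; case: insubP => [a _ ea|_]; last by rewrite linear0 scaler0.
by rewrite Kop_f // wx linearZ /= scalerA -expfzDr // addrC /cartan -ea.
Qed.

Lemma weightN_lin w c x y : weightN w x -> weightN w y -> weightN w (c *: x + y).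
Proof. by move=> wx wy i; rewrite linearP /= wx wy scalerDr !scalerA mulrC. Qed.

Lemma fN_comm k l x : (k.+1 < l)%N -> fN k (fN l x) = fN l (fN k x).
Proof.
rewrite /fN => kl; case: insubP => [a _ ea|_]; case: insubP => [b _ eb|_]; rewrite ?linear0 //.
by rewrite fopC // ea eb.
Qed.

Section Lowering.
Variables (m : nat -> int) (j : nat).
Hypothesis jn : (j <= n.-1)%N.

(** The pairing of [m] plus the half-sum of the positive roots with the coroot of alpha_(j-d) + .. +
    alpha_(j-1), minus 1. The quantum integers at this number and its successor are the coefficients
    for which the inner e's kill the lowered vector. *)
Fixpoint low_shift (d : nat) : int :=
  if d is d'.+1 then low_shift d' + m (j - d) + 1 else -1.

(* [lowering d u] has the weight of [u] lowered by the positive root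
   [alpha_(j-d) + .. + alpha_(j-1)]. *)
Fixpoint lowering (d : nat) (u : X) : X :=
  if d is d'.+1 then
    br q (low_shift d' + 1) *: fN (j - d) (lowering d' u)
    - br q (low_shift d') *: lowering d' (fN (j - d) u)
  else u.

Lemma lowering_linear d : linear (lowering d).
Proof.
elim: d => [|d IH] //= c x y.
rewrite IH !(fN_linear _) IH; apply/funext => z; rewrite !tE; ring.
Qed.

Lemma lowering_closed (M : X -> Prop) :
  (forall c x y, M x -> M y -> M (c *: x + y)) -> (forall k x, M x -> M (fN k x)) ->
  forall d x, M x -> M (lowering d x).
Proof.
move=> Ml Mf; have M0 x : M x -> M 0.
  by move=> Mx; have := Ml (-1) x x Mx Mx; rewrite scaleN1r addNr.
have Mz c x : M x -> M (c *: x) by move=> Mx; rewrite -[c *: x]addr0; apply: Ml; last exact: M0 Mx.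
elim=> [|d IH] x Mx //=; rewrite -scaleNr; apply: Ml; first exact/Mf/IH.
by apply/Mz/IH/Mf.
Qed.

Lemma eN_lowering i d u : (d <= j)%N -> (i < j - d)%N || (j <= i)%N ->
  eN i (lowering d u) = lowering d (eN i u).
Proof.
elim: d u => [//|d IH] u dj hi /=.
have ik : i != (j - d.+1)%N by lia.
have hi' : (i < j - d)%N || (j <= i)%N by lia.
rewrite -scaleNr (eN_linear i) (linopZ (eN_linear i)) eN_fN_neq // !IH ?(ltnW dj) //.
by rewrite eN_fN_neq // scaleNr.
Qed.

Lemma fN_lowering l d u : (d <= j)%N -> (l.+1 < j - d)%N ->
  fN l (lowering d u) = lowering d (fN l u).
Proof.
elim: d u => [//|d IH] u dj hl /=.
rewrite -scaleNr (fN_linear l) (linopZ (fN_linear l)) fN_comm ?IH ?(ltnW dj) //; try lia.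
by rewrite fN_comm; [rewrite scaleNr | lia].
Qed.

Lemma br_lower (a b : int) : br q (a + 1) * br q (b + 1) - br q a * br q b = br q (a + b + 1).
Proof.
rewrite /br !opprD !expfzDr // expr1z exprN1 -!invr_expz.
have qa := q_expz_neq0 vr a; have qb := q_expz_neq0 vr b.
have qq2 : q * q - 1 != 0 by have := q_exp_neq1 vr (isT : (0 < 2)%N); rewrite -subr_eq0 expr2.
move: (q ^ a) (q ^ b) qa qb => x y x0 y0; field.
by rewrite x0 y0 q0 qq2.
Qed.

(** By induction on d, applied to both [u] and [fN k u]. The weight [w] must agree with [m] only
    strictly to the right of j - d, since that of [fN k u] differs from it by one at the left end of
    the smaller range. *)
Lemma lowering_spec d u w : (d <= j)%N -> weightN w u ->
  (forall i, (j - d <= i < j)%N -> eN i u = 0) ->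
  (forall i, (j - d < i < j)%N -> w i = m i) ->
  [/\ weightN (fun i => w i - \sum_(j - d <= k < j) cartN i k) (lowering d u),
      forall i, (j - d < i < j)%N -> eN i (lowering d u) = 0
    & forall d', d = d'.+1 ->
        eN (j - d) (lowering d u) = br q (low_shift d' + w (j - d)%N + 1) *: lowering d' u].
Proof.
elim: d u w => [|d IH] u w dj wu eu wm.
  split=> // [i|i]; last by lia.
  by rewrite subn0 big_geq // subr0; apply: wu.
set k := (j - d.+1)%N.
have kE : (j - d = k.+1)%N by rewrite /k; lia.
have kn : (k < n.-1)%N by rewrite /k; lia.
have [||W1 E1 C1] := IH u w (ltnW dj) wu.
- by move=> i hi; apply: eu; lia.
- by move=> i hi; apply: wm; lia.
have wf := weightN_f k wu.
have ef i : (k < i < j)%N -> eN i (fN k u) = 0.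
  move=> hi; rewrite eN_fN_neq ?eu ?(linop0 (fN_linear k)) //; lia.
have [||W2 E2 C2] := IH (fN k u) _ (ltnW dj) wf.
- by move=> i hi; apply: ef; lia.
- by move=> i hi; rewrite wm ?/cartN; [case: eqP => ?; [lia|case: eqP => ? /=; [lia|case: eqP => ? /=; lia]] | lia].
have sumS i : \sum_(k <= l < j) cartN i l = cartN i k + \sum_(k.+1 <= l < j) cartN i l.
  by rewrite big_ltn //; lia.
split=> [|i hi|d' [<-]] /=; rewrite -/k.
- rewrite -scaleNr; apply: weightN_lin.
    move=> i; rewrite (weightN_f k W1); congr (q ^ _ *: _).
    by rewrite sumS kE opprD addrA addrAC.
  move=> i; rewrite linearZ /= W2 !scalerA mulrC; congr (q ^ _ * _ *: _).
  by rewrite sumS kE opprD addrA.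
- rewrite -scaleNr (eN_linear i) (linopZ (eN_linear i)) eN_fN_neq; last by lia.
  case: (ltngtP i k.+1) => hk; first by lia.
    rewrite E1 ?E2 ?(linop0 (fN_linear k)) ?scaler0 ?addr0 //; lia.
  (* Case i = j - d. Both terms become multiples of [lowering d' (fN k u)]; the extra unit in the
     weight of [fN k u] makes the two coefficients the same product of quantum integers, with
     opposite signs. *)
  have [d' ed] : exists d', d = d'.+1 by exists d.-1; lia.
  have sE : low_shift d = low_shift d' + m (j - d)%N + 1 by rewrite ed.
  have c1 : cartN (j - d) k = -1.
    by rewrite kE /cartN; case: eqP => [|_]; [lia | rewrite eqxx orbT].
  rewrite hk -kE (C1 _ ed) (C2 _ ed) (linopZ (fN_linear k)) fN_lowering; [|lia|lia].
  rewrite c1 !scalerA -scalerDl wm; last by lia.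
  rewrite (_ : low_shift d' + (m (j - d)%N - -1) + 1 = low_shift d + 1); last by rewrite sE; lia.
  by rewrite -sE mulNr mulrC subrr scale0r.
rewrite -scaleNr (eN_linear k) (linopZ (eN_linear k)) (eN_fN kn W1).
rewrite !eN_lowering; try (by lia).
rewrite (eN_fN kn wu) eu; last by lia.
rewrite (linop0 (fN_linear k)) add0r (linop0 (lowering_linear d)) (linop0 (fN_linear k)) add0r.
rewrite (linopZ (lowering_linear d)) !scalerA -scalerDl; congr (_ *: _).
rewrite mulNr.
(* For d = 0 the initial value -1 of [low_shift] gives the coefficients [0] = 0 and -[-1] = 1, so
   [lowering 1] is just f. Otherwise [lowering d] raises the weight at k by one, and the identity is
   [a+1][b+1] - [a][b] = [a+b+1]. *)
case: (posnP d) => d0.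
  by rewrite d0 /= subn0 big_geq // subr0 addNr (br0 q) mul0r sub0r brN (br1 vr) mulN1r opprK addrAC addNr add0r.
rewrite -(br_lower (low_shift d) (w k)); congr (_ * br q _ - _).
rewrite big_ltn; last by lia.
have -> : cartN k (j - d) = -1 by rewrite kE /cartN eqn_leq ltnn andbF eqxx.
rewrite big_nat big1 ?addr0 ?opprK // => l hl.
by rewrite /cartN; case: eqP => ?; [lia|case: eqP => ? /=; [lia|case: eqP => ? //=; lia]].
Qed.

End Lowering.

End LoweringOperators.

(** * Highest weight vectors of the tensor powers *)

Section Components.
Variable n : nat.
Local Notation word := (seq 'I_n).
Local Notation idx := 'I_n.-1.

Definition is_hw (w : word) : Prop := forall i, we i w = None.

Definition wfs (I : seq idx) (w : word) : option word :=
  foldr (fun i => obind (wf i)) (Some w) I.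

(** The sum of the letters is the height that makes every ascent by the [we] terminate. *)
Lemma wf_sum (i : idx) (w w' : word) : wf i w = Some w' ->
  (\sum_(k <- w') (k : nat) = (\sum_(k <- w) (k : nat)).+1)%N.
Proof.
elim: w w' => //= k w IH w'.
case: (eqVneq k (fst_idx i)) => [->|_] /=.
  case: eqP => [p0 [<-]|p0]; first by rewrite !big_cons.
  rewrite fst_neq_snd /=; case e: (wf i w) => [u|] //= [<-].
  by rewrite !big_cons (IH _ e) addnS.
case: ifP => // _; case e: (wf i w) => [u|] //= [<-].
by rewrite !big_cons (IH _ e) addnS.
Qed.

Lemma wf_wwt (i l : idx) (w w' : word) : wf i w = Some w' -> wwt l w' = wwt l w - cartan l i.
Proof.
elim: w w' => //= k w IH w'.
case: (eqVneq k (fst_idx i)) => [->|_] /=.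
  case: eqP => [p0 [<-]|p0]; first by rewrite !wwt_cons -lwt_cartan; ring.
  rewrite fst_neq_snd /=; case e: (wf i w) => [u|] //= [<-].
  by rewrite !wwt_cons (IH _ e) addrA.
case: ifP => // _; case e: (wf i w) => [u|] //= [<-].
by rewrite !wwt_cons (IH _ e) addrA.
Qed.

Lemma wfs_wwt I w b l : wfs I w = Some b -> wwt l b = seq_wt (fun i => wwt i w) I l.
Proof.
elim: I b => [|i I IH] b /=; first by move=> [<-]; rewrite /seq_wt big_nil subr0.
case e: (wfs I w) => [u|] //= /(wf_wwt l) ->.
by rewrite (IH _ e) /seq_wt big_cons opprD addrA addrAC.
Qed.

Lemma wfs_size I w b : wfs I w = Some b -> size b = size w.
Proof.
elim: I b => [|i I IH] b /=; first by move=> [<-].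
by case e: (wfs I w) => [u|] //= /wf_Some [_ _ _ ->]; apply: IH.
Qed.

Lemma hw_path_exists (b : word) : exists p : word * seq idx,
  is_hw p.1 /\ wfs p.2 p.1 = Some b.
Proof.
have [s] := ubnP (\sum_(k <- b) (k : nat)); elim: s b => // s IH b hb.
case: (pselect (is_hw b)) => [hw|nhw]; first by exists (b, [::]).
have [i [b' eb]] : exists i b', we i b = Some b'.
  apply: contrapT => h; apply: nhw => i; case e: (we i b) => [b'|] //.
  by case: h; exists i, b'.
have fb := we_Some eb; have [|[w I] /= [hw ew]] := IH b'.
  by rewrite -ltnS -(wf_sum fb).
by exists (w, i :: I); rewrite /= ew.
Qed.

(** A fixed choice, since a word can be reached along several paths; it indexes the basis [ub]. *)
Definition hw_path (b : word) := sval (cid (hw_path_exists b)).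
Definition top (b : word) := (hw_path b).1.
Definition top_path (b : word) := (hw_path b).2.

Lemma top_hw b : is_hw (top b).
Proof. by rewrite /top /hw_path; case: cid => p []. Qed.

Lemma wfs_top b : wfs (top_path b) (top b) = Some b.
Proof. by rewrite /top /top_path /hw_path; case: cid => p []. Qed.

Lemma top_size b : size (top b) = size b.
Proof. by rewrite (wfs_size (wfs_top b)). Qed.

Lemma top_of_hw w : is_hw w -> top w = w.
Proof.
move=> hw; have := wfs_top w; case: (top_path w) => [|i I] /=; first by case.
by case: (wfs I (top w)) => [u|] //= /wf_Some [h _ _ _]; rewrite hw in h.
Qed.

End Components.

(** * Decomposition of a tensor power by a system of highest weight vectors *)

Section HighestWeightSystem.
Variables (F : fieldType) (q : F) (reg : F -> Prop) (n : nat).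
Hypothesis vr : valuation_ring_at q reg.
Local Notation word := (seq 'I_n).
Local Notation idx := 'I_n.-1.
Local Notation X := (tensors F n).
Local Notation van := (vanishing q reg).
Local Notation fX := (@fop F q n).
Local Notation eX := (@eop F q n).
Local Notation KX := (@Kop F q n).
Local Notation Ft := (@Ft F q reg n vr).
Local Notation Et := (@Et F q reg n vr).
Local Notation delta := (@delta F n).
Local Notation in_lattice := (@in_lattice F reg n).
Local Notation in_qlattice := (@in_qlattice F q reg n).

Let q0 := q_neq0 vr.
Let qq := q_qV_neq0 vr.

Definition hw_vector N (w : word) (t : X) :=
  [/\ supp N t, forall i, eX i t = 0, forall i, KX i t = q ^ wwt i w *: t
    & in_qlattice (t - delta w)].

(** Several highest weight words may have the same weight, so orthogonality does not follow from
    weights alone and is carried along in the induction on N. *)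
Definition hw_system N (t : word -> X) :=
  (forall w, size w = N -> is_hw w -> hw_vector N w (t w)) /\
  (forall w w', size w = N -> is_hw w -> size w' = N -> is_hw w' -> w <> w' ->
     wform N (t w) (t w') = 0).

Section System.
Variables (N : nat) (t : word -> X).
Hypothesis ht : hw_system N t.

Definition Mod (w : word) : X -> Prop := f_span fX (t w).

Section Mod.
Variable w : word.
Hypotheses (sw : size w = N) (hw : is_hw w).

Lemma t_hd : highest_weight_data q eX fX KX (fun i => wwt i w) (t w).
Proof. by have [_ et Kt _] := ht.1 _ sw hw; apply: (tensors_hd vr). Qed.

Lemma Mod_graph x : Mod w x <-> hw_graph fX (t w) fX (t w) x x.
Proof. by split=> [[s ->]|[s [-> _]]]; exists s. Qed.

Lemma Mod_top : Mod w (t w).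
Proof. exact/Mod_graph/hw_graph_top. Qed.

Lemma Mod_lin c x y : Mod w x -> Mod w y -> Mod w (c *: x + y).
Proof. by rewrite !Mod_graph; apply: hw_graph_lin. Qed.

Lemma Mod0 : Mod w 0.
Proof. by exists [::]; rewrite /fcomb big_nil. Qed.

Lemma ModZ c x : Mod w x -> Mod w (c *: x).
Proof. by move=> Mx; rewrite -[_ *: _]addr0; apply: Mod_lin => //; apply: Mod0. Qed.

Lemma ModB x y : Mod w x -> Mod w y -> Mod w (x - y).
Proof. by move=> Mx My; rewrite addrC -scaleN1r; apply: Mod_lin. Qed.

Lemma Mod_sum I (r : seq I) (P : pred I) (c : I -> F) (E : I -> X) :
  (forall j, P j -> Mod w (E j)) -> Mod w (\sum_(j <- r | P j) c j *: E j).
Proof.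
move=> ME; elim/big_rec: _ => [|j x /ME Mj Mx]; first exact: Mod0.
exact: Mod_lin.
Qed.

Lemma Mod_f i x : Mod w x -> Mod w (fX i x).
Proof. by rewrite !Mod_graph; apply: (hw_graph_f t_hd t_hd). Qed.
Lemma Mod_e i x : Mod w x -> Mod w (eX i x).
Proof. by rewrite !Mod_graph; apply: (hw_graph_e vr t_hd t_hd). Qed.
Lemma Mod_K i x : Mod w x -> Mod w (KX i x).
Proof. by rewrite !Mod_graph; apply: (hw_graph_K vr t_hd t_hd). Qed.

Lemma Mod_supp x : Mod w x -> supp N x.
Proof.
move=> [s ->] z sz; rewrite /fcomb tsum big1 // => p _; rewrite tE.
suff -> : fseq fX p.2 (t w) z = 0 by rewrite mulr0.
elim: p.2 z sz => [|i I IH] /=; first by have [? _ _ _] := ht.1 _ sw hw.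
by move=> z sz; apply: (@supp_local F n N) => //; [exact: local_fop | rewrite linear0].
Qed.

Definition Fts (I : seq idx) (x : X) : X := foldr Ft x I.

Lemma Fts_spec I :
  [/\ Mod w (Fts I (t w)),
      forall l, KX l (Fts I (t w)) = q ^ seq_wt (fun i => wwt i w) I l *: Fts I (t w)
    & in_qlattice (Fts I (t w) - odelta F (wfs I w))].
Proof.
elim: I => [|i I [IH1 IH2 IH3]] /=.
  have [_ _ Kt ct] := ht.1 _ sw hw; split=> //; first exact: Mod_top.
  by move=> l; rewrite Kt /seq_wt big_nil subr0.
have [M1 K1] := M_Ft vr Mod_lin Mod_e Mod_f Mod_supp i IH1 IH2; split=> //.
  by move=> l; rewrite K1 /seq_wt big_cons opprD addrA addrAC.
move: IH3; case: (wfs I w) => [u|] /= IH3; first exact: Ft_delta.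
by rewrite !subr0 in IH3 *; apply: Ft_qlattice.
Qed.

End Mod.

(** By adjunction the f's in front of [t w] become operators on [y], which stays in [Mod w']. The
    f's of [y] then become e's on [t w] and kill it, leaving only the form of [t w] with [t w']. *)
Lemma Mod_orth w w' : size w = N -> is_hw w -> size w' = N -> is_hw w' -> w <> w' ->
  forall x y, Mod w x -> Mod w' y -> wform N x y = 0.
Proof.
move=> sw hw sw' hw' ww x y [s ->] My; rewrite wform_sum big1 // => -[c I] _.
rewrite wformZ /=; suff -> : wform N (fseq fX I (t w)) y = 0 by rewrite mulr0.
elim: I y My => [|i I IH] y My /=; last first.
  rewrite wform_f // IH ?mulr0 //.
  by apply: (Mod_K sw' hw'); apply: (Mod_e sw' hw').
case: My => s' ->; rewrite wformC wform_sum big1 // => -[c' [|j J]] _ /=.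
  by rewrite wformZ wformC ht.2 // mulr0.
have [_ et _ _] := ht.1 _ sw hw.
by rewrite wformZ wform_f // et linear0 wformC wform0 !mulr0.
Qed.

(* A basis adapted to the decomposition of the tensor power into the [Mod w]. *)
Definition ub (b : word) : X := Fts (top_path b) (t (top b)).

Lemma ub_spec b : size b = N ->
  [/\ Mod (top b) (ub b), forall l, KX l (ub b) = q ^ wwt l b *: ub b
    & in_qlattice (ub b - delta b)].
Proof.
move=> sb; have st : size (top b) = N by rewrite top_size.
have [h1 h2 h3] := Fts_spec st (@top_hw _ b) (top_path b).
split=> // [l|]; last by move: h3; rewrite wfs_top.
by rewrite h2 (wfs_wwt l (wfs_top b)).
Qed.

Lemma ub_inverse_exists : exists C : N.-tuple 'I_n -> N.-tuple 'I_n -> F,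
  (forall a b, reg (C a b)) /\
  (forall a b : N.-tuple 'I_n, \sum_(c : N.-tuple 'I_n) C a c * ub c b = (a == b)%:R).
Proof.
have [|C [h1 _ h2]] := inverse_kernel_cong1 vr (A := fun a b : N.-tuple 'I_n => ub a b).
  move=> a b; have [|_ _ h] := ub_spec (b := a); first exact: size_tuple.
  by rewrite eq_sym; apply: h.
exists C; split=> // a b; rewrite -(subrK (a == b)%:R (C a b)).
apply: (regD vr); first exact: (vanW vr).
by case: (_ == _); [apply: (vr1 vr) | apply: (reg0 vr)].
Qed.

Lemma ub_expand x : supp N x -> exists c : N.-tuple 'I_n -> F,
  [/\ x = \sum_b c b *: ub b, in_lattice x -> forall b, reg (c b)
    & in_qlattice x -> forall b, van (c b)].
Proof.
move=> sx; have [C [rC eC]] := ub_inverse_exists.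
exists (fun b => \sum_(z : N.-tuple 'I_n) x z * C z b); split; last 2 first.
- by move=> rx b; apply: (reg_sum vr) => z _; apply: (vrM vr).
- by move=> rx b; apply: (van_sum vr) => z _; apply: (vanMr vr).
apply/funext => z; rewrite tsum; case: (eqVneq (size z) N) => [sz|sz]; last first.
  rewrite sx // big1 // => b _; rewrite tE.
  have [|h _ _] := ub_spec (b := b); first exact: size_tuple.
  rewrite (Mod_supp _ (@top_hw _ _) h) ?mulr0 //.
  by rewrite top_size size_tuple.
pose a : N.-tuple 'I_n := Tuple (introT eqP sz).
have -> : z = a by [].
under eq_bigr => b _ do rewrite tE mulr_suml.
have h (u : N.-tuple 'I_n) : \sum_(b : N.-tuple 'I_n) x u * C u b * ub b a =
    x u * (u == a)%:R :> F.
  by rewrite -eC mulr_sumr; apply: eq_bigr => b _; rewrite mulrA.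
rewrite exchange_big /= (eq_bigr _ (fun u _ => h u)) (bigD1 a) //= big1 => [|u ua].
  by rewrite addr0 eqxx mulr1.
by rewrite (negPf ua) mulr0.
Qed.

Lemma wform_nondegenerate x : supp N x ->
  (forall b : N.-tuple 'I_n, wform N x (ub b) = 0) -> x = 0.
Proof.
move=> sx ox; apply/funext => z; case: (eqVneq (size z) N) => [sz|]; last exact: sx.
pose a : N.-tuple 'I_n := Tuple (introT eqP sz).
have sd : supp N (delta a).
  move=> u su; rewrite deltaE; case: eqP => // e.
  by move: su; rewrite e size_tuple eqxx.
have xa : wform N x (delta a) = x z.
  rewrite /wform (bigD1 a) //= deltaE eqxx mulr1 big1 ?addr0 // => u ua.
  by rewrite -val_eqE in ua; rewrite deltaE (negPf ua) mulr0.
have [c [ec _ _]] := ub_expand sd.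
rewrite -xa ec wformC wform_sum big1 // => b _.
by rewrite wformZ wformC ox mulr0.
Qed.

(** Expand [x] in all the [ub b], with regular coefficients when [x] is in the lattice. The part
    with other tops lies in [Mod w] and is orthogonal to every [ub b], so it is 0; the remaining
    coefficients are unchanged. *)
Lemma Mod_expand w x : size w = N -> is_hw w -> Mod w x ->
  exists c : N.-tuple 'I_n -> F, [/\ x = \sum_(b : N.-tuple 'I_n | top b == w) c b *: ub b,
    in_lattice x -> forall b, reg (c b) & in_qlattice x -> forall b, van (c b)].
Proof.
move=> sw hw Mx; have [c [ec rc vc]] := ub_expand (Mod_supp sw hw Mx).
exists c; split=> //; set x1 := \sum_(b : N.-tuple 'I_n | _) _.
have ubM (b : N.-tuple 'I_n) : Mod (top b) (ub b).
  by have [|h _ _] := ub_spec (b := b); first exact: size_tuple.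
have Mx1 : Mod w x1 by apply: Mod_sum => b /eqP <-.
have ex : x - x1 = \sum_(b : N.-tuple 'I_n | top b != w) c b *: ub b.
  rewrite {1}ec (bigID (fun b : N.-tuple 'I_n => top b == w)) /=.
  by rewrite -/x1 addrAC subrr add0r.
have Mx2 : Mod w (x - x1) by apply: ModB.
apply/eqP; rewrite -subr_eq0; apply/eqP/wform_nondegenerate.
  exact: Mod_supp Mx2.
move=> b; have stb : size (top b) = N by rewrite top_size size_tuple.
case: (eqVneq (top b) w) => [bw|bw]; last first.
  apply: (Mod_orth sw hw stb (@top_hw _ _) _ Mx2 (ubM b)).
  by move=> e; rewrite e eqxx in bw.
rewrite ex wform_sum big1 // => b' bw'; rewrite wformZ.
rewrite (Mod_orth _ (@top_hw _ b') stb (@top_hw _ b) _ (ubM b') (ubM b)) ?mulr0 //.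
  by rewrite top_size size_tuple.
by rewrite bw => e; rewrite e eqxx in bw'.
Qed.

Lemma Mod_nondegenerate w x : size w = N -> is_hw w -> Mod w x ->
  (forall y, Mod w y -> wform N y x = 0) -> x = 0.
Proof.
move=> sw hw Mx ox; apply: wform_nondegenerate; first exact: Mod_supp Mx.
move=> b; have [|h _ _] := ub_spec (b := b); first exact: size_tuple.
case: (pselect (w = top b)) => [e|ne]; first by rewrite wformC ox // e.
apply: (Mod_orth sw hw _ (@top_hw _ b) ne Mx h).
by rewrite top_size size_tuple.
Qed.

End System.

End HighestWeightSystem.

(** * Construction of the highest weight vectors by adding one tensor factor *)

Section Construction.
Variables (F : fieldType) (q : F) (reg : F -> Prop) (n : nat).
Hypothesis vr : valuation_ring_at q reg.
Local Notation word := (seq 'I_n).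
Local Notation idx := 'I_n.-1.
Local Notation X := (tensors F n).
Local Notation van := (vanishing q reg).
Local Notation eX := (@eop F q n).
Local Notation KX := (@Kop F q n).
Local Notation Ft := (@Ft F q reg n vr).
Local Notation Et := (@Et F q reg n vr).
Local Notation delta := (@delta F n).
Local Notation in_lattice := (@in_lattice F reg n).
Local Notation in_qlattice := (@in_qlattice F q reg n).

Let q0 := q_neq0 vr.
Let qq := q_qV_neq0 vr.

Lemma lwt_separates (j k : 'I_n) : (forall i, lwt i j = lwt i k) -> j = k.
Proof.
suff H (a b : 'I_n) : (a < b)%N -> exists i, lwt i a != lwt i b.
  move=> e; apply/val_inj; case: (ltngtP j k) => // h; by case: (H _ _ h) => i; rewrite e eqxx.
move=> ab; have an : (a < n.-1)%N.
  by case: (n) a b ab => [[]|m] //= a b ab; apply: leq_trans ab _; rewrite -ltnS.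
exists (Ordinal an); rewrite /lwt -!val_eqE /=; lia.
Qed.

Lemma lwt_telescope (i : idx) (k j : 'I_n) : (k <= j)%N ->
  \sum_(k <= l < j) cartN i l = lwt i k - lwt i j.
Proof.
case: j => j hj /=; elim: j hj => [|j IH] hj kj.
  have -> : k = Ordinal hj by apply: val_inj; move: kj => /=; lia.
  by rewrite big_geq // subrr.
case: (ltngtP k j.+1) kj => // [kj _|kj _]; last first.
  have -> : k = Ordinal hj by apply: val_inj.
  by rewrite /= big_geq // subrr.
have hj' := ltnW hj.
rewrite big_nat_recr //= (IH hj') //.
have jn : (j < n.-1)%N by move: hj; case: (n) => [|m].
have -> : cartN i j = cartan i (Ordinal jn) by [].
rewrite -lwt_cartan (_ : fst_idx _ = Ordinal hj'); last by apply: val_inj.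
by rewrite (_ : snd_idx _ = Ordinal hj); [ring | apply: val_inj].
Qed.

(** Consequently a lattice vector killed by all e's vanishes modulo q at every word that is not of
    highest weight. *)
Lemma Et_pointwise i x w w' : in_lattice x -> we i w = Some w' -> van (Et i x w' - x w).
Proof.
move=> rx ew; have sw : size w == size w' by rewrite (we_size ew).
pose a : (size w').-tuple 'I_n := Tuple sw.
have -> : x w = x a by [].
rewrite /Et /sop.
have vc (b : (size w').-tuple 'I_n) : van (ycoord vr i x b - x b).
  have vC (c : (size w').-tuple 'I_n) : van (adapted_inverse vr i c b - (c == b)%:R).
    by rewrite /adapted_inverse; case: cid => C [].
  rewrite /ycoord (bigD1 b) //= addrAC -{2}[x b]mulr1 -mulrBr.
  apply: (vanD vr); first by apply: (vanMl vr) => //; have := vC b; rewrite eqxx.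
  apply: (van_sum vr) => c cb; apply: (vanMl vr) => //.
  by have := vC c; rewrite (negPf cb) subr0.
have vy (b : (size w').-tuple 'I_n) : van (oadapted q i (we i b) w' - (b == a)%:R).
  have := @oadapted_cong F q reg n vr i (we i b) w'; rewrite tB.
  suff -> : odelta F (we i b) w' = (b == a)%:R by [].
  rewrite -val_eqE /=; case e: (we i b) => [u|] /=; last first.
    by case: eqP => // eb; move: e; rewrite eb ew.
  rewrite deltaE; congr (_%:R); congr nat_of_bool; apply/eqP/eqP => [eu|eb].
    by move: (we_Some e) (we_Some ew); rewrite -eu => -> [].
  by move: e; rewrite eb ew => -[].
rewrite (bigD1 a) //= addrAC; apply: (vanD vr).
  rewrite (_ : _ - _ = ycoord vr i x a * (oadapted q i (we i a) w' - 1) + (ycoord vr i x a - x a)).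
    apply: (vanD vr); last exact: vc.
    by apply: (vanMl vr); [apply: reg_coord | have := vy a; rewrite eqxx].
  by rewrite mulrBr mulr1 addrA subrK.
apply: (van_sum vr) => b ba; apply: (vanMl vr); first exact: reg_coord.
by have := vy b; rewrite (negPf ba) subr0.
Qed.

Section Step.
Variables (N : nat) (t : word -> X).
Hypothesis ht : hw_system q reg N t.
Variables (j : 'I_n) (w1 : word).
Hypotheses (sw1 : size w1 = N) (hjw : is_hw (j :: w1)).

Let hw1 : is_hw w1.
Proof.
move=> i; have := hjw i; rewrite /=; case: ifP => // _.
by case: (we i w1).
Qed.

Let eps0 i : weps i w1 = 0%N.
Proof. by apply/eqP; rewrite -we_None hw1. Qed.

Let phi_gt0 i : j = snd_idx i -> (0 < wphi i w1)%N.
Proof. by move=> ej; have := hjw i; rewrite /= ej eqxx; case: posnP. Qed.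

Let m (l : nat) : int := if insub l is Some i then (wphi (i : idx) w1)%:Z else 0.
Let jn : (j <= n.-1)%N. Proof. by rewrite -ltnS prednK // (leq_ltn_trans _ (ltn_ord j)). Qed.

Let mE (i : idx) : m i = wwt i w1.
Proof. by rewrite /m valK wwt_phi_eps eps0 subr0. Qed.

(** Lowered by the root eps_k - eps_j, so that tensoring with the letter k always gives the weight
    of [j :: w1]. *)
Let zv (k : nat) : X := lowering q m j (j - k) (t w1).

(** In e_i applied to [hw_lift], only [zv i.+1] tensored with the letter [fst_idx i] remains: once
    from e acting on [zv i], with factor q^-1 times a quantum integer, and once from e turning the
    letter [snd_idx i] into [fst_idx i]. The recursion makes the two cancel. *)
Fixpoint lift_coef (k : nat) : F :=
  if k is k'.+1 then - q^-1 * br q (low_shift m j (j - k')) * lift_coef k' else 1.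

(* The highest weight vector of weight [wt (j :: w1)] in [Mod w1 (x) W]. *)
Definition hw_lift : X :=
  \sum_(k : 'I_n | (k <= j)%N) lift_coef k *: tens k (zv k).

Let t1 := ht.1 _ sw1 hw1.

Let wt1 : weightN q m (t w1).
Proof. by have [_ _ Kt _] := t1; move=> i; rewrite Kt mE. Qed.

Let eN_t i : eN q i (t w1) = 0.
Proof. by have [_ et _ _] := t1; rewrite /eN; case: insub. Qed.

Let spec d : (d <= j)%N -> _ :=
  fun dj => lowering_spec vr jn dj wt1 (fun i _ => eN_t i) (fun i _ => erefl).

Let e_zv (i : idx) (k : 'I_n) : (k <= j)%N -> k != fst_idx i -> eX i (zv k) = 0.
Proof.
move=> kj ki; have ik : (i : nat) != k by apply: contraNneq ki => e; apply/eqP/val_inj.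
have -> : eX i (zv k) = eN q i (zv k) by rewrite /eN valK.
case: (boolP ((k < i) && (i < j)))%N => hi.
  by have [_ h _] := spec (leq_subr k j); apply: h; lia.
rewrite /zv (eN_lowering vr _ jn) ?leq_subr //; last by lia.
by rewrite eN_t (linop0 (lowering_linear _ _ _ _)).
Qed.

Let e_zv_fst (i : idx) : (i < j)%N ->
  eX i (zv i) = br q (low_shift m j (j - i)) *: zv i.+1.
Proof.
move=> ij; have -> : eX i (zv i) = eN q i (zv i) by rewrite /eN valK.
have [_ _ h] := spec (leq_subr i j).
have := h (j - i.+1)%N; rewrite (_ : j - (j - i) = i)%N; last by lia.
rewrite -/(zv i) -/(zv i.+1) => ->; last by lia.
have -> : (j - i = (j - i.+1).+1)%N by lia.
by rewrite /= (_ : j - (j - i.+1).+1 = i)%N //; lia.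
Qed.

Lemma eX_hw_lift i : eX i hw_lift = 0.
Proof.
have n0 : (0 < n)%N by case: (n) j => [[]|].
rewrite /hw_lift linear_sum.
have E (k : 'I_n) : (k <= j)%N -> eX i (lift_coef k *: tens k (zv k)) =
   lift_coef k *: (q ^ (- lwt i k) *: tens k (eX i (zv k))) +
   (lift_coef k * (k == snd_idx i)%:R) *: tens (fst_idx i) (zv k).
  by move=> kj; rewrite linearZ /= eop_tens scalerDr [X in _ + X]scalerA.
rewrite (eq_bigr _ (fun k hk => E k hk)) big_split /=.
have -> : \sum_(k : 'I_n | (k <= j)%N) lift_coef k *: (q ^ (- lwt i k) *: tens k (eX i (zv k))) =
   if (i < j)%N then lift_coef i *: (q^-1 *: tens (fst_idx i) (eX i (zv i))) else 0.
  case: ifP => ij.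
    rewrite (bigD1 (fst_idx i)) /=; last exact: ltnW.
    rewrite lwt_fst exprN1 big1 ?addr0 // => k /andP[kj ki].
    by rewrite e_zv // linear0 !scaler0.
  rewrite big1 // => k kj; case: (eqVneq k (fst_idx i)) => [ek|ki]; last first.
    by rewrite e_zv // linear0 !scaler0.
  have {}ek : (k : nat) = i by rewrite ek.
  have -> : zv k = t w1 by rewrite /zv (_ : j - k = 0)%N //; lia.
  by have [_ et _ _] := t1; rewrite et linear0 !scaler0.
have -> : \sum_(k : 'I_n | (k <= j)%N) (lift_coef k * (k == snd_idx i)%:R) *: tens (fst_idx i) (zv k)
   = if (i < j)%N then lift_coef i.+1 *: tens (fst_idx i) (zv i.+1) else 0.
  case: ifP => ij.
    rewrite (bigD1 (snd_idx i)) //= eqxx mulr1 big1 ?addr0 // => k /andP[_ /negPf ->].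
    by rewrite mulr0 scale0r.
  rewrite big1 // => k kj; case: eqP => [ek|_]; last by rewrite mulr0 scale0r.
  by have : (k : nat) = i.+1 by [rewrite ek]; lia.
case: ifP => ij; last by rewrite addr0.
rewrite e_zv_fst // !linearZ /= !scalerA -scalerDl.
rewrite (_ : _ + _ = 0) ?scale0r //.
by rewrite mulNr; ring.
Qed.

Lemma KX_hw_lift i : KX i hw_lift = q ^ wwt i (j :: w1) *: hw_lift.
Proof.
rewrite /hw_lift linear_sum scaler_sumr; apply: eq_bigr => k kj.
have [W _ _] := spec (leq_subr k j).
rewrite linearZ /= Kop_tens // W !linearZ /= !scalerA -/(zv k); congr (_ *: _).
rewrite -expfzDr // mulrC; congr (_ * q ^ _).
by rewrite mE wwt_cons subKn // (lwt_telescope i kj); ring.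
Qed.

Lemma slice_hw_lift k : slice k hw_lift = ((k <= j)%N%:R * lift_coef k) *: zv k.
Proof.
rewrite /hw_lift linear_sum /=.
under eq_bigr => l _ do rewrite linearZ /= slice_tens scalerA.
case: (boolP (k <= j)%N) => kj.
  rewrite (bigD1 k) //= eqxx mulr1 mul1r big1 ?addr0 // => l /andP[_ lk].
  by rewrite eq_sym (negPf lk) mulr0 scale0r.
rewrite mul0r scale0r big1 // => l lj; case: eqP => [e|_]; last by rewrite mulr0 scale0r.
by rewrite e lj in kj.
Qed.

Lemma Mod_zv k : Mod q t w1 (zv k).
Proof.
apply: lowering_closed; last exact: Mod_top.
  by move=> c x y; apply: (Mod_lin (t := t)).
move=> l x Mx; rewrite /fN; case: insub => [i|]; last exact: Mod0.
exact: (Mod_f vr ht sw1 hw1).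
Qed.

Lemma supp_hw_lift : supp N.+1 hw_lift.
Proof.
move=> [|k z] sz; first by rewrite /hw_lift tsum big1 // => k _; rewrite tE mulr0.
rewrite -[LHS]/(slice k hw_lift z) slice_hw_lift tE.
by rewrite (Mod_supp ht sw1 hw1 (Mod_zv k)) ?mulr0 // -eqSS.
Qed.

(** All [m l] are nonnegative, and the one at j - 1 is positive since in the highest weight word
    [j :: w1] the head j is matched in the tail. Hence no [lift_coef] up to j vanishes. *)
Lemma low_shift_gt0 d : (0 < d <= j)%N -> 0 < low_shift m j d.
Proof.
case: d => // d /= dj; have m_ge0 l : 0 <= m l by rewrite /m; case: insub.
have m1 : 0 < m j.-1.
  have hj : (j.-1 < n.-1)%N by lia.
  rewrite /m (insubT (fun l => l < n.-1)%N hj); apply: (phi_gt0 (i := Ordinal hj)).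
  by apply: val_inj => /=; lia.
elim: d dj => [|d IH] dj /=; first by rewrite subn1; lia.
have := IH (ltnW dj); have := m_ge0 (j - d.+2)%N; rewrite /=; lia.
Qed.

Lemma lift_coef_neq0 k : (k <= j)%N -> lift_coef k != 0.
Proof.
elim: k => [|k IH] kj /=; first exact: oner_neq0.
apply: mulf_neq0; last exact: IH (ltnW kj).
apply: mulf_neq0; first by rewrite oppr_eq0 invr_eq0.
apply: (br_neq0 vr); rewrite gt_eqF // low_shift_gt0 //; lia.
Qed.

Lemma hw_lift_top : hw_lift (j :: w1) != 0.
Proof.
rewrite -[_ (j :: w1)]/(slice j hw_lift w1) slice_hw_lift leqnn mul1r tE.
rewrite mulf_neq0 ?lift_coef_neq0 // /zv subnn /=.
have [_ _ _ c] := t1; apply: (cong1_neq0 vr).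
by have := c w1; rewrite tB deltaE eqxx.
Qed.

(* Scaled to be primitive in the lattice, [hw_lift] can only reduce modulo q to
   a multiple of a highest weight word of [w1]'s component times a letter. *)
Lemma hw_vector_exists : exists u : X,
  hw_vector q reg N.+1 (j :: w1) u /\ forall k, Mod q t w1 (slice k u).
Proof.
pose s := [seq hw_lift (w : N.+1.-tuple 'I_n) | w : N.+1.-tuple 'I_n].
have sj : size (j :: w1) == N.+1 by rewrite /= sw1.
have hs : has (fun x => x != 0) s.
  apply/hasP; exists (hw_lift (j :: w1)); last exact: hw_lift_top.
  by apply/mapP; exists (Tuple sj); rewrite ?mem_enum.
have [c [c0 rc [y /mapP[a _ ->] nva]]] := exists_primitive_scaling vr hs.
pose u := c *: hw_lift.
have ru : in_lattice u.
  move=> w; case: (eqVneq (size w) N.+1) => [sw|sw].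
    apply: rc; apply/mapP; exists (Tuple (introT eqP sw)); rewrite ?mem_enum //.
  by rewrite /u tE supp_hw_lift ?mulr0 //; apply: (reg0 vr).
have Ku i : KX i u = q ^ wwt i (j :: w1) *: u.
  by rewrite linearZ /= KX_hw_lift !scalerA mulrC.
have eu i : eX i u = 0 by rewrite linearZ /= eX_hw_lift scaler0.
have su : supp N.+1 u by move=> z sz; rewrite /u tE supp_hw_lift ?mulr0.
have Mu k : Mod q t w1 (slice k u).
  by rewrite linearZ /= slice_hw_lift; apply: ModZ; apply: ModZ; apply: Mod_zv.
(* Three kinds of words. If some [we i] moves [w], then e_i u = 0 gives the claim by [Et_pointwise].
   If the tail is [w1], the weight forces the head to be j. If the tail is another highest weight
   word, the slice of [u] is a regular combination of vectors [ub b'] with top [w1], each congruent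
   to a word that differs from this tail, which is its own top. *)
have vu w : w <> j :: w1 -> van (u w).
  move=> wj; case: (eqVneq (size w) N.+1) => [sw|sw]; last by rewrite su //; apply: (van0 vr).
  case: (pselect (is_hw w)) => [hw|]; last first.
    move=> nhw; have [i [w' ew]] : exists i w', we i w = Some w'.
      apply: contrapT => h; apply: nhw => i; case e: (we i w) => [w'|] //.
      by case: h; exists i, w'.
    have := Et_pointwise ru ew; rewrite (Et_kernel vr (eu i)) sub0r => /(vanN vr).
    by rewrite opprK.
  case: w sw hw wj => [//|k b] [sb] hw wj.
  have hb : is_hw b.
    move=> i; have := hw i; rewrite /=; case: ifP => // _.
    by case: (we i b).
  case: (eqVneq b w1) => [eb|bw].
    suff -> : u (k :: b) = 0 by apply: (van0 vr).
    apply/eqP; apply: contrapT => /negP uk; apply: wj; rewrite eb; congr (_ :: _).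
    apply: lwt_separates => i.
    have := congr1 (fun x : X => x (k :: b)) (Ku i); rewrite tE /Kop => /(mulIf uk).
    by move/(q_expzI vr); rewrite !wwt_cons eb => /addIr.
  have [d [ed rd _]] := Mod_expand vr ht sw1 hw1 (Mu k).
  rewrite -[u _]/(slice k u b) ed tsum; apply: (van_sum vr) => b' /eqP tb'; rewrite tE.
  apply: (vanMl vr); first by apply: rd => z; apply: ru.
  have [|_ _ h] := ub_spec vr ht (b := b'); first exact: size_tuple.
  have := h b; rewrite tB deltaE; case: eqP => [e|_]; last by rewrite subr0.
  by move: bw; rewrite -tb' -e top_of_hw // eqxx.
(* By primitivity some coefficient of [u] is a unit, and the only candidate left is the one at
   [j :: w1]. *)
have aj : tval a = j :: w1.
  by apply: contrapT => /vu; rewrite /u tE.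
have nvj : ~ van (u (j :: w1)) by rewrite -aj /u tE.
have uj0 : u (j :: w1) != 0.
  by apply/eqP => e; apply: nvj; rewrite e; apply: (van0 vr).
have rj := reg_inv vr (ru _) nvj.
clearbody u.
exists ((u (j :: w1))^-1 *: u); split; last first.
  by move=> k; rewrite linearZ /=; apply: ModZ.
split.
- by move=> z sz; rewrite tE (su z) ?mulr0.
- by move=> i; rewrite linearZ /= eu scaler0.
- by move=> i; rewrite linearZ /= Ku !scalerA mulrC.
move=> z; rewrite tB tE deltaE; case: eqP => [->|zj].
  by rewrite mulVf // subrr; apply: (van0 vr).
by rewrite subr0; apply: (vanMl vr) => //; apply: vu.
Qed.

End Step.

(** Orthogonality of the new vectors: with different tails their slices lie in orthogonal
    submodules; with equal tails the heads differ, hence so do the weights, and the supports are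
    disjoint. *)
Lemma hw_system_step N (t : word -> X) :
  hw_system q reg N t -> exists t' : word -> X, hw_system q reg N.+1 t'.
Proof.
move=> ht; pose P w u := hw_vector q reg N.+1 w u /\
  forall k, Mod q t (behead w) (slice k u).
have ex (w : word) : exists u, size w = N.+1 -> is_hw w -> P w u.
  case: (pselect (size w = N.+1 /\ is_hw w)) => [[sw hw]|h]; last first.
    by exists 0 => sw hw; case: h.
  case: w sw hw => [//|j w1] [sw1] hw.
  by have [u hu] := hw_vector_exists ht sw1 hw; exists u.
have [t' ht'] := choice ex; exists t'; split=> [w sw hw|]; first by case: (ht' w sw hw).
move=> w w' sw hw sw' hw' ww'.
have [[_ _ Kw _] Mw] := ht' w sw hw; have [[_ _ Kw' _] Mw'] := ht' w' sw' hw'.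
have tl (v : word) : size v = N.+1 -> is_hw v -> size (behead v) = N /\ is_hw (behead v).
  case: v => [//|k v] [sv] hv; split=> // i; have := hv i; rewrite /=; case: ifP => // _.
  by case: (we i v).
have [sb hb] := tl _ sw hw; have [sb' hb'] := tl _ sw' hw'.
rewrite wform_cons big1 // => k _.
case: (eqVneq (behead w) (behead w')) => [eb|nb]; last first.
  by apply: (Mod_orth vr ht sb hb sb' hb') => //; apply/eqP.
apply: big1 => z _; rewrite /slice.
case: (eqVneq (t' w (k :: z)) 0) => [->|nz]; first by rewrite mul0r.
case: (eqVneq (t' w' (k :: z)) 0) => [->|nz']; first by rewrite mulr0.
case: ww'; case: w w' sw sw' eb {Mw Mw' hw hw' sb sb' hb hb'} Kw Kw' nz nz'
  => [|j w] [|j' w'] // _ _ /= -> Kw Kw' nz nz'.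
congr (_ :: _); apply: lwt_separates => i.
have := congr1 (fun x : X => x (k :: z)) (Kw i); rewrite tE /Kop => /(mulIf nz)/(q_expzI vr).
have := congr1 (fun x : X => x (k :: z)) (Kw' i); rewrite tE /Kop => /(mulIf nz')/(q_expzI vr).
by move=> ->; rewrite !wwt_cons => /addIr.
Qed.

Lemma hw_system_exists N : exists t : word -> X, hw_system q reg N t.
Proof.
elim: N => [|N [t ht]]; last exact: hw_system_step ht.
exists delta; split=> [w /size0nil -> _|w w' /size0nil -> _ /size0nil ->] //.
split.
- by move=> [|k z].
- move=> i; apply: eq_by_slice => [|k]; first exact: erefl.
  have s0 l : slice l (delta [::]) = 0 by [].
  by rewrite slice_eop !s0 !(linear0, scaler0, addr0).
- move=> i; apply/funext => -[|k z]; rewrite /Kop tE ?/wwt ?big_nil //.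
  by rewrite !mulr0.
- by move=> z; rewrite subrr; apply: (van0 vr).
Qed.

End Construction.

(** * The crystal of an irreducible module *)

Section WeightLattice.
Variable n : nat.
Local Notation idx := 'I_n.-1.
Local Open Scope quotient_scope.

Lemma corootD i (a b : weight_lattice n) : coroot i (a + b) = coroot i a + coroot i b.
Proof.
elim/quotW: a => x; elim/quotW: b => y.
have -> : \pi_(weight_lattice n) x + \pi_(weight_lattice n) y = \pi_(weight_lattice n) (x + y).
  by rewrite raddfD.
by rewrite !coroot_pi !mxE; ring.
Qed.

Lemma coroot0 i : coroot i (0 : weight_lattice n) = 0.
Proof. by apply: (addIr (coroot i (0 : weight_lattice n))); rewrite -corootD !add0r. Qed.

Lemma corootN i (a : weight_lattice n) : coroot i (- a) = - coroot i a.
Proof. by apply: (addIr (coroot i a)); rewrite -corootD !addNr coroot0. Qed.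

Lemma corootMn i (a : weight_lattice n) k : coroot i (a *+ k) = coroot i a *+ k.
Proof. by elim: k => [|k IH]; rewrite ?mulr0n ?coroot0 // !mulrS corootD IH. Qed.

Lemma coroot_sum i I (r : seq I) (P : pred I) (E : I -> weight_lattice n) :
  coroot i (\sum_(j <- r | P j) E j) = \sum_(j <- r | P j) coroot i (E j).
Proof. by elim/big_rec2: _ => [|j a b _ <-]; rewrite ?coroot0 ?corootD. Qed.

Lemma coroot_eps (i : idx) (k : 'I_n) : coroot i (eps k) = lwt i k.
Proof. by rewrite coroot_pi !mxE eqxx /lwt /= [fst_idx i == k]eq_sym [snd_idx i == k]eq_sym; case: eqP; case: eqP. Qed.

Lemma coroot_alpha (i j : idx) : coroot i (alpha j) = cartan i j.
Proof. by rewrite corootD corootN !coroot_eps lwt_cartan. Qed.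

Lemma coroot_separates (a b : weight_lattice n) : (forall i, coroot i a = coroot i b) -> a = b.
Proof.
elim/quotW: a => x; elim/quotW: b => y h.
apply/eqP; rewrite -Quotient.idealrBE; apply/forallP => k; apply/forallP => l.
have n0 : (0 < n)%N by case: (n) k => [[]|].
suff H (k' : 'I_n) : (x - y) 0 k' = (x - y) 0 (Ordinal n0) by rewrite !H.
case: k' => k'; elim: k' => [|k' IH] hk; first by congr (_ _ _); apply: val_inj.
rewrite -(IH (ltnW hk)).
have kn : (k' < n.-1)%N by rewrite -ltnS prednK.
have := h (Ordinal kn); rewrite !coroot_pi !mxE.
have -> : fst_idx (Ordinal kn) = Ordinal (ltnW hk) by apply: val_inj.
have -> : snd_idx (Ordinal kn) = Ordinal hk by apply: val_inj.
by move/(canRL (subrK _)) => ->; ring.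
Qed.

End WeightLattice.

(* The analogue of [kashiwara_crystal] where an arbitrary field with a valuation
   ring [reg] of uniformizer q replaces the rational functions regular at 0. *)
Section CrystalAt.
Variables (F : fieldType) (q : F) (reg : F -> Prop) (n : nat) (V : uq_module q n) (v : V).
Local Open Scope classical_set_scope.

Definition f_monomials_at : set V :=
  [set u | exists s : seq 'I_n.-1, u = foldr (fun i x => kashiwara_f i x) v s].

Definition lattice_at : set V :=
  [set u | exists s : seq (F * V),
     (forall x, x \in s -> reg x.1 /\ f_monomials_at x.2) /\
     u = \sum_(x <- s) x.1 *: x.2].

Definition q_lattice_at : set V := [set q *: u | u in lattice_at].

Definition coset_at (u : V) : set V := [set w | q_lattice_at (w - u)].

Definition induced_at (T : V -> V) (C : set V) : set V :=
  [set w | exists2 u, C u & q_lattice_at (w - T u)].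

Definition coset_wt_at (C : set V) : weight_lattice n :=
  xget 0 [set mu | exists2 u, C u & weight_vector mu u].

Definition crystal_at : crystal n :=
  {| cr_type := set V;
     cr_zero := coset_at 0;
     cr_elts := [set C | exists u,
       [/\ f_monomials_at u, C = coset_at u & C <> coset_at 0]];
     cr_wt := coset_wt_at;
     cr_e := fun i => induced_at (kashiwara_e i);
     cr_f := fun i => induced_at (kashiwara_f i) |}.

End CrystalAt.

Lemma kashiwara_crystal_at (K : fieldType) n (V : uq_module (qvar K) n) (v : V) :
  kashiwara_crystal v = crystal_at (@regular0 K) v.
Proof. by []. Qed.

(** * Identification of the irreducible module with the submodule of the tensor power *)

Section Comparison.
Variables (F : fieldType) (q : F) (reg : F -> Prop) (n : nat).
Hypothesis vr : valuation_ring_at q reg.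
Variables (V : uq_module q n) (v : V) (mu : weight_lattice n).
Hypotheses (irrV : uq_irreducible V) (hwV : highest_weight_vector mu v).
Local Notation word := (seq 'I_n).
Local Notation idx := 'I_n.-1.
Local Notation X := (tensors F n).
Local Notation fX := (@fop F q n).
Local Notation eX := (@eop F q n).
Local Notation KX := (@Kop F q n).
Local Notation Ft := (@Ft F q reg n vr).
Local Notation Et := (@Et F q reg n vr).
Local Notation delta := (@delta F n).
Local Notation in_lattice := (@in_lattice F reg n).
Local Notation in_qlattice := (@in_qlattice F q reg n).

Local Notation eV := (fun i => uq_e i : V -> V).
Local Notation fV := (fun i => uq_f i : V -> V).
Local Notation KV := (fun i => uq_K i : V -> V).

Let q0 := q_neq0 vr.

Variables (w : word) (t : word -> X).
Hypotheses (hw : is_hw w) (ht : hw_system q reg (size w) t)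
  (wmu : forall i, wwt i w = coroot i mu).

Lemma module_hd :
  highest_weight_data q eV fV KV (fun i => wwt i w) v.
Proof.
have [v0 Kv ev] := hwV; split=> //.
- by move=> i; apply: linearP.
- by move=> i; apply: linearP.
- by move=> i; apply: linearP.
- by move=> i j x; rewrite -{1}(uq_KinvK i x) uq_Kf.
- move=> i j a x Kx; apply/eqP; rewrite addrC -subr_eq uq_ef; apply/eqP.
  have -> : uq_Kinv i x = q ^ (- a) *: x.
    rewrite -{2}(uq_KinvK i x) Kx linearZ /= scalerA -expfzDr //.
    by rewrite addNr expr0z scale1r.
  rewrite Kx -scalerBl; case: eqP => _; rewrite ?scale0r // scale1r scalerA.
  by rewrite /br mulrC.
- by move=> i; rewrite wmu; apply: Kv.
Qed.

Let tX := t w.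
Let tX_spec := ht.1 _ erefl hw.
Let hdX : highest_weight_data q eX fX KX (fun i => wwt i w) tX := t_hd vr ht erefl hw.
Local Notation G := (hw_graph fX tX fV v).

Let tXw : tX w != 0.
Proof.
have [_ _ _ c] := tX_spec; apply: (cong1_neq0 vr).
by have := c w; rewrite tB deltaE eqxx.
Qed.

(** The vectors related to 0 form a submodule of [V], which is 0 or everything. It does not contain
    [v]: the top coefficient of a combination representing 0 in the tensor power is 0, whereas for
    [v] it cannot be. *)
Lemma graph0_tensor y : G 0 y -> y = 0.
Proof.
move=> Gy; have [v0 _ _] := hwV; pose N0 : set V := [set y | G 0 y]%classic.
have sN : uq_submodule N0.
  split; first exact: hw_graph0.
  - move=> a u u' Gu Gu'; rewrite /N0 /=.
    have -> : 0 = a *: 0 + 0 :> X by rewrite scaler0 addr0.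
    exact: hw_graph_lin.
  - move=> i u Gu; rewrite /N0 /=; split.
      by have := hw_graph_e vr hdX module_hd i Gu; rewrite linear0.
    by have := hw_graph_f hdX module_hd i Gu; rewrite linear0.
  move=> i u Gu; rewrite /N0 /=; split.
    by have := hw_graph_K vr hdX module_hd i Gu; rewrite linear0.
  have [x' [y' [Gx' Kx' <-]]] := hw_graph_Kinv vr hdX module_hd i Gu.
  by rewrite /= uq_KinvK (_ : 0 = x') // -(KopK q0 i x') Kx' linear0.
case: (irrV.2 _ sN) => e; first by have : N0 y := Gy; rewrite e.
have [s [e0 ev]] : N0 v by rewrite e.
have Kv i : uq_K i v = q ^ wwt i w *: v by rewrite (hd_Kt module_hd).
have h1 := fcomb_top vr hdX e0.
have h2 := fcomb_top vr module_hd ev Kv.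
have S0 : \sum_(p <- s | p.2 == [::]) p.1 = 0.
  have /(congr1 (fun x : X => x w)) : 0 = (\sum_(p <- s | p.2 == [::]) p.1) *: tX.
    by apply: h1 => i; rewrite linear0 scaler0.
  by rewrite tE => /esym/eqP; rewrite mulf_eq0 (negPf tXw) orbF => /eqP.
by move: v0; rewrite h2 S0 scale0r eqxx.
Qed.

(** Irreducibility is known for [V] only, so the form is used here. By adjunction, the form of [x]
    with the module reduces to the form of [tX] with vectors still related to 0, whose top
    coefficient is 0; nondegeneracy on [Mod] concludes. *)
Lemma graph_tensor0 x : G x 0 -> x = 0.
Proof.
have [v0 Kv ev] := hwV; have [_ et _ _] := tX_spec.
move=> Gx; have Mx : Mod q t w x by have [s [-> _]] := Gx; exists s.
apply: (Mod_nondegenerate vr ht erefl hw Mx) => y [s ->].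
rewrite wform_sum big1 // => -[c I] _; rewrite wformZ /=.
suff -> : wform (size w) (fseq fX I tX) x = 0 by rewrite mulr0.
elim: I x Gx {Mx} => [|i I IH] x Gx /=; last first.
  rewrite wform_f // IH ?mulr0 //.
  have := hw_graph_K vr hdX module_hd i (hw_graph_e vr hdX module_hd i Gx).
  by rewrite !linear0.
have [s' [-> e0]] := Gx.
have S0 : \sum_(p <- s' | p.2 == [::]) p.1 = 0.
  have : 0 = (\sum_(p <- s' | p.2 == [::]) p.1) *: v.
    by apply: (fcomb_top vr module_hd e0) => i; rewrite linear0 scaler0.
  by move/esym/eqP; rewrite scaler_eq0 (negPf v0) orbF => /eqP.
rewrite wformC wform_sum (bigID (fun p : F * seq idx => p.2 == [::])) /=.
rewrite [X in _ + X]big1 => [|[c' [//|i J]] _]; last first.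
  by rewrite wformZ wform_f //= et linear0 wformC wform0 !mulr0.
rewrite addr0 (eq_bigr (fun p => p.1 * wform (size w) tX tX)).
  by rewrite -mulr_suml S0 mul0r.
by move=> [c' J] /= /eqP ->; rewrite wformZ.
Qed.

Lemma graph_surjective y : exists x, G x y.
Proof.
have [v0 _ _] := hwV; pose N0 : set V := [set y | exists x, G x y]%classic.
have sN : uq_submodule N0.
  split; first by exists 0; exact: hw_graph0.
  - by move=> a u u' [x Gx] [x' Gx']; exists (a *: x + x'); apply: hw_graph_lin.
  - move=> i u [x Gx]; split.
      by exists (eX i x); apply: (hw_graph_e vr hdX module_hd).
    by exists (fX i x); apply: (hw_graph_f hdX module_hd).
  move=> i u [x Gx]; split.
    by exists (KX i x); apply: (hw_graph_K vr hdX module_hd).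
  have [x' [y' [Gx' _ <-]]] := hw_graph_Kinv vr hdX module_hd i Gx.
  by exists x'; rewrite /= uq_KinvK.
have N0v : N0 v by exists tX; apply: hw_graph_top.
case: (irrV.2 _ sN) => e; last by have : N0 y by rewrite e.
by move: N0v v0; rewrite e => ->; rewrite eqxx.
Qed.

Definition kap (y : V) : X := sval (cid (graph_surjective y)).

Lemma kapP y : G (kap y) y.
Proof. by rewrite /kap; case: cid. Qed.

Lemma graph_sub x y x' y' : G x y -> G x' y' -> G (x - x') (y - y').
Proof.
by move=> g g'; rewrite addrC [y - y']addrC -!scaleN1r; apply: hw_graph_lin.
Qed.

Lemma kapE x y : G x y -> kap y = x.
Proof.
move=> g; apply/eqP; rewrite -subr_eq0; apply/eqP/graph_tensor0.
by rewrite -(subrr y); apply: graph_sub => //; apply: kapP.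
Qed.

Lemma kap_inj : injective kap.
Proof.
move=> y y' e; apply/eqP; rewrite -subr_eq0; apply/eqP/graph0_tensor.
by rewrite -(subrr (kap y)) {2}e; apply: graph_sub; apply: kapP.
Qed.

Lemma kap_linear : linear kap.
Proof. by move=> c x y; apply: kapE; apply: hw_graph_lin; apply: kapP. Qed.
HB.instance Definition _ := GRing.isLinear.Build F V X *:%R kap kap_linear.

Lemma kap_f i y : kap (uq_f i y) = fX i (kap y).
Proof. by apply: kapE; apply: (hw_graph_f hdX module_hd); apply: kapP. Qed.
Lemma kap_e i y : kap (uq_e i y) = eX i (kap y).
Proof. by apply: kapE; apply: (hw_graph_e vr hdX module_hd); apply: kapP. Qed.
Lemma kap_K i y : kap (uq_K i y) = KX i (kap y).
Proof. by apply: kapE; apply: (hw_graph_K vr hdX module_hd); apply: kapP. Qed.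
Lemma kap_v : kap v = tX.
Proof. by apply: kapE; apply: hw_graph_top. Qed.
Lemma kap_Mod y : Mod q t w (kap y).
Proof. by have [s [e _]] := kapP y; exists s. Qed.
Lemma Mod_kap x : Mod q t w x -> exists y, kap y = x.
Proof.
by move=> [s ->]; exists (fcomb fV v s); apply: kapE; exists s.
Qed.

Lemma kap_divided_f i k y : kap (divided_f i k y) = dvf q i k (kap y).
Proof.
rewrite /divided_f linearZ; congr (_ *: _).
by elim: k => [|k IH] //=; rewrite kap_f IH.
Qed.

Lemma kap_weight (m : idx -> int) y :
  (forall i, uq_K i y = q ^ m i *: y) <-> (forall i, KX i (kap y) = q ^ m i *: kap y).
Proof.
split=> h i; first by rewrite -kap_K h linearZ.
by apply: kap_inj; rewrite kap_K h linearZ.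
Qed.

(** Valid for every string decomposition of [u], so the value does not depend on the
    decomposition. *)
Lemma kashiwara_f_wt_kap i u y : kashiwara_f_wt i u y -> kap y = Ft i (kap u).
Proof.
move=> [mu' [us [[_ eu hus] ->]]]; rewrite eu !linear_sum /=.
rewrite !big_nat; apply: eq_bigr => k /andP[_ hk].
have [_ ek _] := hus k hk.
by rewrite !kap_divided_f (Ft_dvf vr) // -kap_e ek linear0.
Qed.

Lemma kashiwara_e_wt_kap i u y : kashiwara_e_wt i u y -> kap y = Et i (kap u).
Proof.
move=> [mu' [us [[_ eu hus] ->]]]; rewrite eu !linear_sum /=.
case: us {eu} hus => [|u0 us] hus; first by rewrite !big_geq.
rewrite [RHS]big_ltn //.
have [_ e0 _] := hus 0%N isT.
rewrite kap_divided_f /dvf qf0 invr1 scale1r /= (Et_kernel vr) ?add0r; last first.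
  by rewrite -kap_e e0 linear0.
rewrite !big_nat; apply: eq_bigr => -[//|k] /hus [Kk ek nk].
rewrite !kap_divided_f /=.
apply/esym/(Et_dvf vr (m := coroot i (mu' + alpha i *+ k.+1))).
- by rewrite -kap_e ek linear0.
- by rewrite -kap_K Kk linearZ.
rewrite -kap_divided_f => h; have -> : us`_k = 0; last by rewrite linear0.
by apply: nk; apply: kap_inj; rewrite h linear0.
Qed.

Lemma string_decomposition_exists i (mu' : weight_lattice n) (u : V) : weight_vector mu' u ->
  exists us : seq V, string_decomposition i mu' u us.
Proof.
move=> wu; have Ku : forall l, KX l (kap u) = q ^ coroot l mu' *: kap u.
  exact/kap_weight.
have [us [eu _ _ hus]] := M_strings vr (Mod_lin (t := t) (w := w)) (Mod_e vr ht erefl hw)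
  (Mod_f vr ht erefl hw) (Mod_supp ht erefl hw) i (kap_Mod u) Ku.
have [g hg] : exists g : X -> V, forall x, Mod q t w x -> kap (g x) = x.
  have ex x : exists y, Mod q t w x -> kap y = x.
    case: (pselect (Mod q t w x)) => [/Mod_kap [y e]|h]; first by exists y.
    by exists 0.
  by have [g hg] := choice ex; exists g.
have gk k : (k < size us)%N -> kap (map g us)`_k = us`_k.
  by move=> hk; rewrite (nth_map 0) // hg //; have [] := hus k hk.
exists (map g us); split=> //.
  apply: kap_inj; rewrite eu linear_sum size_map !big_nat.
  by apply: eq_bigr => k /andP[_ hk] /=; rewrite kap_divided_f gk.
move=> k; rewrite size_map => hk; have [Mk Kk ek nk] := hus k hk; split.
- rewrite /weight_vector; apply/(kap_weight (fun l => coroot l (mu' + alpha i *+ k))) => l.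
  by rewrite gk // Kk corootD corootMn coroot_alpha.
- by apply: kap_inj; rewrite kap_e gk // ek linear0.
move=> h; apply: kap_inj; rewrite gk // linear0; apply: nk.
by rewrite -(gk k) // -kap_divided_f h linear0.
Qed.

Lemma weight_vectors_span (u : V) : exists s : seq V,
  (forall x, x \in s -> exists mu', weight_vector mu' x) /\ u = \sum_(x <- s) x.
Proof.
have [s [_ ->]] := kapP u.
exists [seq p.1 *: fseq fV p.2 v | p <- s]; split; last by rewrite big_map.
move=> x /mapP [[c I] _ ->] /=.
exists (mu - \sum_(j <- I) alpha j) => i.
rewrite linearZ /= (K_fseq vr module_hd) scalerA mulrC -scalerA; congr (q ^ _ *: _).
rewrite corootD corootN coroot_sum /seq_wt wmu; congr (_ - _).
by apply: eq_bigr => j _; rewrite coroot_alpha.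
Qed.

(** [additive_extension] picks one admissible value, or 0 if there is none. Every admissible value
    has image [T (kap u)], and one exists because weight vectors span [V]. *)
Lemma kap_additive_extension (R : V -> V -> Prop) (T : X -> X) :
  linear T -> (forall u y, R u y -> kap y = T (kap u)) ->
  (forall mu' (u : V), weight_vector mu' u -> exists y, R u y) ->
  forall u, kap (additive_extension R u) = T (kap u).
Proof.
move=> lT RT Rex u; rewrite /additive_extension.
have TD : forall x y, T (x + y) = T x + T y by apply: linopD.
have T0 : T 0 = 0 by apply: linop0.
have key (s : seq (V * V)) : (forall x, x \in s -> R x.1 x.2) ->
    kap (\sum_(x <- s) x.2) = T (kap (\sum_(x <- s) x.1)).
  elim: s => [|x s IH] hs; first by rewrite !big_nil linear0 T0.
  rewrite !big_cons !linearD /= TD IH; first by rewrite (RT _ _ (hs x _)) ?mem_head.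
  by move=> y ys; apply: hs; rewrite inE ys orbT.
case: xgetP => [y -> [s [hs -> ->]]|nex]; first exact: key.
have [s [hs eu]] := weight_vectors_span u; exfalso.
have [s' [hs' eu']] : exists s' : seq (V * V),
    (forall x, x \in s' -> R x.1 x.2) /\ \sum_(x <- s) x = \sum_(x <- s') x.1.
  elim: s hs {eu} => [|x s IH] hs; first by exists [::]; rewrite !big_nil.
  have [|s' [h1 h2]] := IH; first by move=> y ys; apply: hs; rewrite inE ys orbT.
  have [mu' wx] := hs x (mem_head _ _); have [y Ry] := Rex _ _ wx.
  exists ((x, y) :: s'); rewrite !big_cons h2; split=> // z.
  by rewrite inE => /orP[/eqP ->|/h1].
by apply: (nex (\sum_(x <- s') x.2)); exists s'; split=> //; rewrite eu.
Qed.

Lemma kap_kashiwara_f i u : kap (kashiwara_f i u) = Ft i (kap u).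
Proof.
apply: kap_additive_extension => [|x y|mu' x wx]; first exact: linearP.
  exact: kashiwara_f_wt_kap.
have [us hus] := string_decomposition_exists i wx.
by eexists; exists mu', us; split; first exact: hus.
Qed.

Lemma kap_kashiwara_e i u : kap (kashiwara_e i u) = Et i (kap u).
Proof.
apply: kap_additive_extension => [|x y|mu' x wx]; first exact: linearP.
  exact: kashiwara_e_wt_kap.
have [us hus] := string_decomposition_exists i wx.
by eexists; exists mu', us; split; first exact: hus.
Qed.

Definition fmon (I : seq idx) : V := foldr (fun i x => kashiwara_f i x) v I.

Lemma kap_fmon I : kap (fmon I) = Fts vr I tX.
Proof. by elim: I => [|i I IH] /=; rewrite ?kap_v // kap_kashiwara_f IH. Qed.

Lemma fmon_cong I : in_qlattice (kap (fmon I) - odelta F (wfs I w)).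
Proof. by rewrite kap_fmon; have [_ _ h] := Fts_spec vr ht erefl hw I. Qed.

(** Monomials have regular coordinates, being congruent to a word or to 0. Conversely [Mod_expand]
    writes a lattice vector with regular coefficients on the [ub b] of top [w], which are images of
    monomials. *)
Lemma lattice_kap y : lattice_at reg v y <-> in_lattice (kap y).
Proof.
split=> [[s [hs ->]]|ry].
  rewrite linear_sum => z; rewrite tsum big_seq; apply: (reg_sum vr) => x xs.
  have [rx [I eI]] := hs x xs.
  rewrite linearZ /= tE; apply: (vrM vr) => //.
  rewrite eI -/(fmon I) -(subrK (odelta F (wfs I w)) (kap (fmon I))) tE.
  apply: (regD vr); first by apply: (vanW vr); apply: fmon_cong.
  case: (wfs I w) => [b|] /=; last exact: (reg0 vr).
  exact: (delta_lattice vr).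
have [c [ec rc _]] := Mod_expand vr ht erefl hw (kap_Mod y).
exists [seq (c b, fmon (top_path b)) |
  b <- [seq b <- enum {: (size w).-tuple 'I_n} | top (tval b) == w]].
split.
  by move=> x /mapP [b _ ->] /=; split; [apply: rc | exists (top_path b)].
apply: kap_inj; rewrite ec linear_sum big_map big_filter big_enum_cond /=.
apply: eq_big => [b|b /eqP tb]; first by [].
by rewrite linearZ /= kap_fmon /ub tb.
Qed.

Lemma qlattice_scale (x : X) : in_qlattice x -> exists2 x', in_lattice x' & x = q *: x'.
Proof.
move=> hx; exists (q^-1 *: x).
  by move=> z; rewrite tE; have [y ry ->] := hx z; rewrite mulKf.
by rewrite scalerA mulfV // scale1r.
Qed.

Lemma q_lattice_kap y : q_lattice_at reg v y <-> in_qlattice (kap y).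
Proof.
split=> [[u /lattice_kap Lu <-]|].
  by move=> z; rewrite linearZ /= tE; exists (kap u z).
move/qlattice_scale => [x' rx' ex']; exists (q^-1 *: y).
  by apply/lattice_kap; rewrite linearZ /= ex' scalerA mulVf // scale1r.
by rewrite scalerA mulfV // scale1r.
Qed.

Definition word_class (b : word) : set V :=
  [set y | in_qlattice (kap y - delta b)]%classic.

Definition word_class_opt (o : option word) : set V :=
  if o is Some b then word_class b else coset_at reg v 0.

Lemma coset_modP u (o : option word) : in_qlattice (kap u - odelta F o) ->
  coset_at reg v u = word_class_opt o.
Proof.
move=> hu; have qD := @qlatticeD F q reg n vr; have qB := @qlatticeB F q reg n vr.
apply/seteqP; split=> y.
  move=> /q_lattice_kap; rewrite linearB /= => h; case: o hu => [b|] /= hu.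
    by have := qD _ _ h hu; rewrite addrA subrK.
  by rewrite /coset_at /= subr0; apply/q_lattice_kap; rewrite subr0 in hu; have := qD _ _ h hu; rewrite subrK.
move=> h; apply/q_lattice_kap; rewrite linearB /=; case: o h hu => [b|] /= h hu.
  by have := qB _ _ h hu; rewrite opprB addrA subrK.
move/q_lattice_kap: h; rewrite subr0 => h.
by rewrite subr0 in hu; apply: qB.
Qed.

Section Reachable.
Variables (b : word) (I : seq idx).
Hypothesis hb : wfs I w = Some b.

Lemma word_class_coset : word_class b = coset_at reg v (fmon I).
Proof. by rewrite (coset_modP (o := Some b)) //; have := fmon_cong I; rewrite hb. Qed.

Lemma word_class_fmon : word_class b (fmon I).
Proof. by rewrite /word_class /=; have := fmon_cong I; rewrite hb. Qed.

Lemma word_class_neq0 : word_class b <> coset_at reg v 0.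
Proof.
move=> e; have := word_class_fmon; rewrite e => /q_lattice_kap; rewrite subr0 => h.
have h2 := word_class_fmon; rewrite /word_class /= in h2.
apply: (not_van1 vr).
have := qlatticeB vr h h2 b; rewrite opprB addrCA subrr addr0.
by rewrite deltaE eqxx.
Qed.

Lemma word_class_inj b' : word_class b = word_class b' -> b = b'.
Proof.
move=> e; have h := word_class_fmon; have : word_class b' (fmon I) by rewrite -e.
rewrite /word_class /= in h *; move=> h'.
apply: contrapT => bb; apply: (not_van1 vr).
have := qlatticeB vr h' h b; rewrite opprB addrC addrA subrK tB !deltaE eqxx.
by rewrite (_ : (b == b') = false) ?subr0 //; apply/eqP.
Qed.

(** Every member of the class has a nonzero coefficient at [b], so a weight vector in it can only
    have the weight of [b]. *)
Lemma word_class_wt nu : (forall i, coroot i nu = wwt i b) -> coset_wt_at (word_class b) = nu.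
Proof.
move=> hnu; have [_ Kb _] := Fts_spec vr ht erefl hw I.
have wI : weight_vector nu (fmon I).
  rewrite /weight_vector; apply/(kap_weight (fun i => coroot i nu)) => i.
  by rewrite kap_fmon Kb hnu (wfs_wwt i hb).
rewrite /coset_wt_at; case: xgetP => [nu' _ [u hu wu]|h]; last first.
  by case: (h nu); exists (fmon I) => //; apply: word_class_fmon.
apply: coroot_separates => i; rewrite hnu.
have := (kap_weight (fun i => coroot i nu') u).1 wu i.
move/(congr1 (fun x : X => x b)); rewrite tE /Kop => e; symmetry.
apply: (q_expzI vr); apply: (mulIf _ e).
apply: (cong1_neq0 vr); have := hu b.
by rewrite tB deltaE eqxx.
Qed.

Lemma induced_f i : induced_at reg v (kashiwara_f i) (word_class b) = word_class_opt (wf i b).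
Proof.
have H u : word_class b u -> in_qlattice (kap (kashiwara_f i u) - odelta F (wf i b)).
  by move=> hu; rewrite kap_kashiwara_f; apply: Ft_delta.
rewrite -(coset_modP (H _ word_class_fmon)); apply/seteqP; split=> y.
  move=> [u hu]; rewrite (coset_modP (H _ word_class_fmon)) -(coset_modP (H _ hu)).
  by [].
by move=> hy; exists (fmon I) => //; apply: word_class_fmon.
Qed.

Lemma induced_e i : induced_at reg v (kashiwara_e i) (word_class b) = word_class_opt (we i b).
Proof.
have H u : word_class b u -> in_qlattice (kap (kashiwara_e i u) - odelta F (we i b)).
  by move=> hu; rewrite kap_kashiwara_e; apply: Et_delta.
rewrite -(coset_modP (H _ word_class_fmon)); apply/seteqP; split=> y.
  move=> [u hu]; rewrite (coset_modP (H _ word_class_fmon)) -(coset_modP (H _ hu)).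
  by [].
by move=> hy; exists (fmon I) => //; apply: word_class_fmon.
Qed.

End Reachable.

Lemma kashiwara_elements C : cr_elts (crystal_at reg v) C <->
  exists b I, wfs I w = Some b /\ C = word_class b.
Proof.
split=> [[u [[I eI] -> n0]]|[b [I [hb ->]]]].
  rewrite -/(fmon I) in eI; rewrite eI in n0 *.
  case e: (wfs I w) => [b|].
    by exists b, I; split=> //; rewrite (word_class_coset e).
  by case: n0; rewrite (coset_modP (o := None)) //; have := fmon_cong I; rewrite e.
exists (fmon I); split; first by exists I.
  exact: word_class_coset.
exact: (word_class_neq0 hb).
Qed.

End Comparison.

(** * Reading words of ice models *)

Section LetterWords.
Variable s : nat.
Local Notation lword := (seq (letter * 'I_s)).
Local Open Scope nat_scope.

(* On reversed signatures: number of unmatched letters L, and columns of the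
   first unmatched L and of the last unmatched R. *)
Fixpoint phL (l : lword) : nat :=
  match l with
  | (L, _) :: l' => (phL l').+1
  | (R, _) :: l' => (phL l').-1
  | [::] => 0
  end.

Fixpoint fL (l : lword) : option 'I_s :=
  match l with
  | (L, q) :: l' => if phL l' == 0 then Some q else fL l'
  | (R, _) :: l' => if phL l' <= 1 then None else fL l'
  | [::] => None
  end.

Fixpoint eL (l : lword) : option 'I_s :=
  match l with
  | (L, _) :: l' => eL l'
  | (R, q) :: l' => if phL l' == 0 then Some q else eL l'
  | [::] => None
  end.

Lemma fL_None l : (fL l == None) = (phL l == 0).
Proof.
elim: l => [//|[[] q] l IH] /=; first by case: (phL l) IH.
by case: ltngtP => //=; case: (phL l) IH => [|[|m]].
Qed.

(** Signatures are reversed here, so a deleted L R shows up as R followed by L. *)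
Lemma LR_cancel (X Y : lword) a b :
  [/\ phL (X ++ (R, b) :: (L, a) :: Y) = phL (X ++ Y),
      fL (X ++ (R, b) :: (L, a) :: Y) = fL (X ++ Y)
    & eL (X ++ (R, b) :: (L, a) :: Y) = eL (X ++ Y)].
Proof.
elim: X => [|[[] q] X [IH1 IH2 IH3]] /=; rewrite ?IH1 ?IH2 ?IH3 //.
split=> //; rewrite ltnS leqn0; case: posnP => [p0|p0]; last by [].
by apply/esym/eqP; rewrite fL_None p0.
Qed.

Definition pairR (q : 'I_s) : letter * 'I_s := (R, q).
Definition pairL (q : 'I_s) : letter * 'I_s := (L, q).

Lemma delete_LR_spec (w : lword) :
  (exists X a b Y, w = X ++ (L, a) :: (R, b) :: Y /\ delete_LR w = X ++ Y) \/
  (exists rs ls, w = map pairR rs ++ map pairL ls /\ delete_LR w = w).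
Proof.
elim: w => [|[[] q] w IH]; first by right; exists [::], [::].
  case: w IH => [|[[] b] w] IH; first by right; exists [::], [:: q].
    have E : delete_LR [:: (L, q), (L, b) & w] = (L, q) :: delete_LR ((L, b) :: w) by [].
    case: IH => [[X [a [b' [Y [e1 e2]]]]]|[rs [ls [e1 e2]]]].
      by left; exists ((L, q) :: X), a, b', Y; rewrite E e2 e1.
    right; exists [::], (q :: ls); split; last by rewrite E e2.
    by case: rs e1 {e2} => [|r rs] //= ->.
  by left; exists [::], q, b, w.
case: IH => [[X [a [b' [Y [-> e2]]]]]|[rs [ls [e1 e2]]]].
  by left; exists ((R, q) :: X), a, b', Y; split=> //=; rewrite -e2.
by right; exists (q :: rs), ls; rewrite /= -e1 e2.
Qed.

(** Each effective deletion shortens the word and preserves [fL] and [eL]; the normal form R^a L^b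
    is fixed by [delete_LR], so surplus iterations are harmless. *)
Lemma iter_delete_LR k (w : lword) : size w <= k -> exists rs ls,
  [/\ iter k (@delete_LR s) w = map pairR rs ++ map pairL ls,
      fL (rev w) = fL (rev (map pairR rs ++ map pairL ls))
    & eL (rev w) = eL (rev (map pairR rs ++ map pairL ls))].
Proof.
elim: k w => [|k IH] w; first by rewrite leqn0 => /nilP ->; exists [::], [::].
move=> sw; rewrite iterSr.
case: (delete_LR_spec w) => [[X [a [b [Y [e1 e2]]]]]|[rs [ls [e1 e2]]]].
  have [|rs [ls [h1 h2 h3]]] := IH (X ++ Y).
    by move: sw; rewrite e1 !size_cat /=; lia.
  exists rs, ls; rewrite e2 h1 -h2 -h3 e1 !rev_cat !rev_cons -!cats1 -!catA /=.
  by have [_ -> ->] := LR_cancel (rev Y) (rev X) a b.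
exists rs, ls; rewrite e2 -e1; split=> //.
by elim: k {IH sw} => [|k IHk] /=; rewrite ?e1 // -e1 IHk e1 -?e1.
Qed.

Lemma fL_normal rs ls : fL (rev (map pairR rs ++ map pairL ls)) = ohead ls /\
  eL (rev (map pairR rs ++ map pairL ls)) = ohead (rev rs).
Proof.
have hR : [/\ phL (rev (map pairR rs)) = 0, fL (rev (map pairR rs)) = None
    & eL (rev (map pairR rs)) = ohead (rev rs)].
  rewrite -map_rev; elim: (rev rs) => [//|r l [h1 h2 h3]] /=.
  by rewrite h1.
rewrite rev_cat -map_rev; case: hR => h1 h2 h3.
rewrite -[in ohead ls](revK ls); elim: (rev ls) => [|q l [IH1 IH2]] //=.
rewrite IH1 IH2; split=> //.
have -> : phL (map pairL l ++ rev (map pairR rs)) = size l.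
  by elim: l {IH1 IH2} => [|a l IHl] //=; rewrite IHl.
rewrite rev_cons; case: l {IH1 IH2} => [|a l] //=.
by rewrite rev_cons -!cats1 -catA; case: (rev l).
Qed.

Definition cols (c : bool) (l : lword) : seq 'I_s := [seq x.2 | x <- l & is_L x.1 == c].

Lemma fL_mem l q : fL l = Some q -> q \in cols true l.
Proof.
rewrite /cols; elim: l => [//|[[] a] l IH] /=.
  by case: ifP => [_ [<-]|_ /IH h]; rewrite inE ?eqxx ?h ?orbT.
by case: ifP => // _ /IH.
Qed.

Lemma eL_mem l q : eL l = Some q -> q \in cols false l.
Proof.
rewrite /cols; elim: l => [//|[[] a] l IH] /=; first by move/IH.
by case: ifP => [_ [<-]|_ /IH h]; rewrite inE ?eqxx ?h ?orbT.
Qed.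

(** The L selected by [fL] is the first unmatched one of the signature: no unmatched L lies before
    it there (that is, in [Y]), and the letter just after it is not an R, which would cancel it. *)
Lemma fL_split X q Y : q \notin cols true X -> q \notin cols true Y ->
  fL (X ++ (L, q) :: Y) = Some q ->
  phL Y = 0 /\ forall X' a, X <> X' ++ [:: (R, a)].
Proof.
move=> + qY; elim: X => [|[[] a] X IH] qX /=.
- case: eqP => // p0; first by split=> // -[].
  by move/fL_mem => h; rewrite h in qY.
- rewrite /cols /= inE negb_or in qX; case/andP: qX => qa qX.
  case: ifP => [_ [e]|_ h]; first by rewrite e eqxx in qa.
  have [h1 h2] := IH qX h; split=> // -[|x X'] b; first by case.
  by case=> _; apply: h2.
case: ifP => // /negbT p h; have [h1 h2] := IH qX h; split=> // -[|x X'] b.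
  by case=> _ eX; move: p; rewrite eX /= h1.
by case=> _; apply: h2.
Qed.

Lemma eL_split X q Y : q \notin cols false X -> q \notin cols false Y ->
  eL (X ++ (R, q) :: Y) = Some q ->
  phL Y = 0 /\ forall X' a, X <> X' ++ [:: (R, a)].
Proof.
move=> + qY; elim: X => [|[[] a] X IH] qX /=.
- case: eqP => // p0; first by split=> // -[].
  by move/eL_mem => h; rewrite h in qY.
- move=> h; have [h1 h2] := IH qX h; split=> // -[|x X'] b; first by case.
  by case=> _; apply: h2.
rewrite /cols /= inE negb_or in qX; case/andP: qX => qa qX.
case: ifP => [_ [e]|/negbT p h]; first by rewrite e eqxx in qa.
have [h1 h2] := IH qX h; split=> // -[|x X'] b.
  by case=> _ eX; move: p; rewrite eX /= h1.
by case=> _; apply: h2.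
Qed.

Lemma eL_unmatched X q Y : cols true Y = [::] -> eL (X ++ (R, q) :: Y) <> None.
Proof.
move=> eY; have pY : phL Y = 0.
  by elim: Y eY => [//|[[] a] Y IH] //= /IH ->.
elim: X => [|[[] a] X IH] //=; first by rewrite pY.
by case: ifP.
Qed.

End LetterWords.

(** * Boxes in antidiagonal order *)

Section Boxes.
Variables (n s : nat).
Local Notation box := ('I_n * 'I_s)%type.
Local Notation idx := 'I_n.-1.
Implicit Types (M : ice n s) (i : idx) (l : seq box).
Local Open Scope nat_scope.

Definition swap_row i (q : 'I_s) (a b : 'I_n) (x : box) : 'I_n :=
  if x == (a, q) then b else x.1.

Definition letter_of i (x : box) : option (letter * 'I_s) :=
  if x.1 == fst_idx i then Some (L, x.2)
  else if x.1 == snd_idx i then Some (R, x.2) else None.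

Definition letters i l := pmap (letter_of i) l.

Lemma mem_cols_letters i l q :
  (q \in cols true (letters i l)) = ((fst_idx i, q) \in l) /\
  (q \in cols false (letters i l)) = ((snd_idx i, q) \in l).
Proof.
rewrite /cols; elim: l => [|[p a] l [IH1 IH2]] //=.
rewrite !inE !xpair_eqE /letter_of /=.
case: (eqVneq p (fst_idx i)) => [->|pf] /=.
  by rewrite ?snd_neq_fst /= IH2 inE IH1.
case: (eqVneq p (snd_idx i)) => [_|_] /=; last by rewrite IH1 IH2.
by rewrite IH1 inE IH2.
Qed.

Lemma wphi_letters i l : wphi i (map fst l) = phL (letters i l).
Proof.
elim: l => [//|[p a] l IH] /=; rewrite IH /letter_of /=.
by case: (p == fst_idx i) => //=; case: (p == snd_idx i).
Qed.

Lemma map_swap_notin i l a b q : (a, q) \notin l -> map (swap_row i q a b) l = map fst l.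
Proof.
move=> h; apply/eq_in_map => x xl; rewrite /swap_row; case: eqP => // e.
by rewrite -e xl in h.
Qed.

Lemma wf_letters i l : uniq l ->
  wf i (map fst l) =
  omap (fun q => map (swap_row i q (fst_idx i) (snd_idx i)) l) (fL (letters i l)).
Proof.
elim: l => [//|[p a] l IH] /= /andP[pl ul].
have {}IH := IH ul; rewrite wphi_letters {}IH /letter_of /=.
have swap_cons q : fL (letters i l) = Some q ->
    swap_row i q (fst_idx i) (snd_idx i) (p, a) = p.
  move/fL_mem; rewrite (mem_cols_letters i l q).1 /swap_row; case: eqP => // e h.
  by rewrite e h in pl.
case: (eqVneq p (fst_idx i)) => [ep|pf] /=.
  subst p; rewrite ?fst_neq_snd /=; case: eqP => [p0|p0] /=.
    by rewrite {1}/swap_row eqxx map_swap_notin.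
  by case e: (fL _) => [q|] //=; rewrite (swap_cons _ e).
case: (eqVneq p (snd_idx i)) => [ep|ps] /=.
  by case: ifP => // _; case e: (fL _) => [q|] //=; rewrite (swap_cons _ e).
by case e: (fL _) => [q|] //=; rewrite (swap_cons _ e).
Qed.

Lemma we_letters i l : uniq l ->
  we i (map fst l) =
  omap (fun q => map (swap_row i q (snd_idx i) (fst_idx i)) l) (eL (letters i l)).
Proof.
elim: l => [//|[p a] l IH] /= /andP[pl ul].
have {}IH := IH ul; rewrite wphi_letters {}IH /letter_of /=.
have swap_cons q : eL (letters i l) = Some q ->
    swap_row i q (snd_idx i) (fst_idx i) (p, a) = p.
  move/eL_mem; rewrite (mem_cols_letters i l q).2 /swap_row; case: eqP => // e h.
  by rewrite e h in pl.
case: (eqVneq p (fst_idx i)) => [ep|pf] /=.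
  subst p; rewrite ?fst_neq_snd /=.
  by case e: (eL _) => [q|] //=; rewrite (swap_cons _ e).
case: (eqVneq p (snd_idx i)) => [ep|ps] /=.
  subst p; case: eqP => [p0|p0] /=; first by rewrite {1}/swap_row eqxx map_swap_notin.
  by case e: (eL _) => [q|] //=; rewrite (swap_cons _ e).
by case e: (eL _) => [q|] //=; rewrite (swap_cons _ e).
Qed.

(* Boxes are read by decreasing antidiagonal, and by increasing row on each
   antidiagonal: a crystal operator moves one box along its antidiagonal past no
   other box, and the order of the boxes of rows i and i+1 is the reverse of
   that of the signature. *)
Definition diag (x : box) : nat := x.1 + x.2.
Definition leb_box (x y : box) : bool :=
  (diag y < diag x) || ((diag x == diag y) && (x.1 <= y.1)).

Lemma leb_box_total : total leb_box.
Proof. by move=> x y; rewrite /leb_box; lia. Qed.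
Lemma leb_box_trans : transitive leb_box.
Proof. by move=> x y z; rewrite /leb_box; lia. Qed.
Lemma leb_box_anti : antisymmetric leb_box.
Proof.
move=> [p a] [p' a']; rewrite /leb_box /diag /= => h.
by congr pair; apply: val_inj => /=; lia.
Qed.

Definition boxes M : seq box :=
  sort leb_box [seq x <- enum {: box} | is_box M x.1 x.2].

Lemma mem_boxes M x : (x \in boxes M) = is_box M x.1 x.2.
Proof. by rewrite mem_sort mem_filter mem_enum andbT. Qed.

Lemma boxes_uniq M : uniq (boxes M).
Proof. by rewrite sort_uniq filter_uniq // enum_uniq. Qed.

Lemma boxes_sorted M : sorted leb_box (boxes M).
Proof. exact/sort_sorted/leb_box_total. Qed.

Definition reading M : seq 'I_n := map fst (boxes M).

Lemma sorted_boxes_eq l1 l2 : sorted leb_box l1 -> sorted leb_box l2 ->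
  uniq l1 -> uniq l2 -> l1 =i l2 -> l1 = l2.
Proof.
move=> h1 h2 u1 u2 e; apply: (sorted_eq leb_box_trans leb_box_anti h1 h2).
exact: uniq_perm.
Qed.

Definition two_rows i (r : seq 'I_s) : seq box :=
  flatten [seq [:: (fst_idx i, q); (snd_idx i, q)] | q <- r].

Lemma mem_two_rows i r x : (x \in two_rows i r) =
  ((x.1 == fst_idx i) || (x.1 == snd_idx i)) && (x.2 \in r).
Proof.
case: x => p a; rewrite /two_rows; elim: r => [|q r IH] /=; first by rewrite andbF.
rewrite !inE IH !xpair_eqE /=.
by case: (p == _); case: (p == _); case: (a == q).
Qed.

Lemma two_rows_pairwise i r : pairwise (fun a b : 'I_s => a < b) r ->
  pairwise (fun x y => leb_box y x && (x != y)) (two_rows i r).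
Proof.
elim: r => [//|q r IH] /=; rewrite -/(two_rows i r) => /andP[/allP hq /IH ->].
rewrite xpair_eqE fst_neq_snd /= ?andbT -!andbA; apply/and3P; split.
- by rewrite /leb_box /diag /=; lia.
- apply/allP => -[p a]; rewrite mem_two_rows /= => /andP[hp /hq aq].
  rewrite xpair_eqE -!val_eqE /leb_box /diag /=.
  by case/orP: hp => /eqP -> /=; lia.
apply: (introT (@allP _ _ _)) => -[p a]; rewrite mem_two_rows /= => /andP[hp /hq aq].
rewrite xpair_eqE -!val_eqE /leb_box /diag /=.
by case/orP: hp => /eqP -> /=; lia.
Qed.

Lemma enum_ord_pairwise : pairwise (fun a b : 'I_s => a < b) (enum 'I_s).
Proof.
rewrite -(pairwise_map val ltn) val_enum_ord.
by rewrite -sorted_pairwise; [apply: iota_ltn_sorted | apply: ltn_trans].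
Qed.

Lemma signature_two_rows M i : signature M i =
  pmap (letter_of i) [seq x <- two_rows i (enum 'I_s) | is_box M x.1 x.2].
Proof.
rewrite /signature /two_rows; elim: (enum _) => [//|q r IH] /=.
rewrite IH; case: (is_box M (fst_idx i) q); case: (is_box M (snd_idx i) q) => /=;
  by rewrite /letter_of /= ?eqxx ?snd_neq_fst ?eqxx.
Qed.

(** On two adjacent rows, the order by decreasing antidiagonal, and increasing row within one, is
    exactly the reverse of the order by column and then row; sorted duplicate-free lists with the
    same elements coincide. *)
Lemma signature_boxes M i : rev (signature M i) = letters i (boxes M).
Proof.
have e : [seq x <- boxes M | (x.1 == fst_idx i) || (x.1 == snd_idx i)] =
    rev [seq x <- two_rows i (enum 'I_s) | is_box M x.1 x.2].
  have pw := two_rows_pairwise i enum_ord_pairwise.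
  apply: sorted_boxes_eq.
  - by apply: sorted_filter; [apply: leb_box_trans | apply: boxes_sorted].
  - rewrite rev_sorted; apply: sorted_filter; first by move=> x y z h1 h2; apply: leb_box_trans h2 h1.
    apply: pairwise_sorted; apply: sub_pairwise pw => x y /andP[h _]; exact: h.
  - exact/filter_uniq/boxes_uniq.
  - rewrite rev_uniq filter_uniq // uniq_pairwise.
    by apply: sub_pairwise pw => x y /andP[].
  move=> x; rewrite mem_filter mem_boxes mem_rev mem_filter mem_two_rows mem_enum.
  by rewrite andbT andbC.
have pf (r : seq box) : letters i r =
    letters i [seq x <- r | (x.1 == fst_idx i) || (x.1 == snd_idx i)].
  elim: r => [//|x r IH] /=; rewrite /letter_of.
  case: (eqVneq x.1 (fst_idx i)) => h1 /=; first by rewrite {1}/letter_of h1 eqxx /= -IH.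
  case: (eqVneq x.1 (snd_idx i)) => h2 /=; last by rewrite -IH.
  by rewrite {1}/letter_of (negPf h1) h2 eqxx /= -IH.
rewrite pf e signature_two_rows /letters.
elim: [seq x <- _ | _] => [//|x r IH] /=.
rewrite rev_cons -cats1 pmap_cat -IH /=.
by case: (letter_of i x) => [a|] /=; rewrite ?cats0 ?rev_cons ?cats1.
Qed.

Lemma ice_fE M i : ice_f i M = omap (flip_f M i) (fL (letters i (boxes M))).
Proof.
rewrite /ice_f -signature_boxes /reduced_signature.
have [rs [ls [-> -> _]]] := iter_delete_LR (leqnn (size (signature M i))).
rewrite (fL_normal rs ls).1 filter_cat map_cat.
have -> : [seq x <- map (@pairR s) rs | is_L x.1] = [::] by elim: rs.
have -> : [seq x <- map (@pairL s) ls | is_L x.1] = map (@pairL s) ls.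
  by elim: ls => //= a l ->.
by case: ls.
Qed.

Lemma ice_eE M i : ice_e i M = omap (flip_e M i) (eL (letters i (boxes M))).
Proof.
rewrite /ice_e -signature_boxes /reduced_signature.
have [rs [ls [-> _ ->]]] := iter_delete_LR (leqnn (size (signature M i))).
rewrite (fL_normal rs ls).2 filter_cat map_cat.
have -> : [seq x <- map (@pairL s) ls | ~~ is_L x.1] = [::] by elim: ls.
have -> : [seq x <- map (@pairR s) rs | ~~ is_L x.1] = map (@pairR s) rs.
  by elim: rs => //= a l ->.
rewrite cats0 -map_comp (eq_map (g := id)) // map_id.
by case: rs => //= q l; rewrite lastI rev_rcons.
Qed.

End Boxes.

(** * Crystal operators on ice models *)

Section Flips.
Variables (n s : nat).
Local Notation box := ('I_n * 'I_s)%type.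
Local Notation idx := 'I_n.-1.
Implicit Types (M : ice n s) (i : idx).
Local Open Scope nat_scope.

Definition valid_types := [:: type1; type2; type3; type4; type5].

Lemma right_left M p (q0 q : 'I_s) : q = q0.+1 :> nat -> Defs.right M p q0 = Defs.left M p q.
Proof. by move=> e; congr (M.2 (p, _)); apply: val_inj. Qed.

Lemma up_down M i q : Defs.up M (fst_idx i) q = Defs.down M (snd_idx i) q.
Proof. by congr (M.1 (_, q)); apply: val_inj. Qed.

Lemma cols_uniq i (l : seq box) c : uniq l -> uniq (cols c (letters i l)).
Proof.
elim: l => [//|[p a] l IH] /= /andP[pl /IH ul]; rewrite /letter_of /=.
case: eqP => [ep|_] /=.
  subst p; case: c {IH} ul => ul //=; rewrite /cols /= -/(cols true _) ul andbT.
  by rewrite (mem_cols_letters i l a).1.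
case: eqP => [ep|_] //=; subst p; case: c {IH} ul => ul //=.
by rewrite /cols /= -/(cols false _) ul andbT (mem_cols_letters i l a).2.
Qed.

Lemma fL_uniq_split X q Y : uniq (cols true (X ++ (L, q) :: Y)) ->
  fL (X ++ (L, q) :: Y) = Some q ->
  phL Y = 0 /\ forall X' (a : 'I_s), X <> X' ++ [:: (R, a)].
Proof.
rewrite /cols filter_cat map_cat cat_uniq /= => /and3P[_ /norP[qX _] /andP[qY _]].
exact: fL_split.
Qed.

Lemma eL_uniq_split X q Y : uniq (cols false (X ++ (R, q) :: Y)) ->
  eL (X ++ (R, q) :: Y) = Some q ->
  phL Y = 0 /\ forall X' (a : 'I_s), X <> X' ++ [:: (R, a)].
Proof.
rewrite /cols filter_cat map_cat cat_uniq /= => /and3P[_ /norP[qX _] /andP[qY _]].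
exact: eL_split.
Qed.

Definition block M i q : seq (letter * 'I_s) :=
  (if is_box M (fst_idx i) q then [:: (L, q)] else [::]) ++
  (if is_box M (snd_idx i) q then [:: (R, q)] else [::]).

Lemma letters_split M i e1 q e2 : enum 'I_s = e1 ++ q :: e2 ->
  letters i (boxes M) = rev (flatten (map (block M i) e2)) ++ rev (block M i q) ++
    rev (flatten (map (block M i) e1)).
Proof.
move=> e; rewrite -signature_boxes /signature e map_cat /= flatten_cat /=.
by rewrite rev_cat -/(block M i q) rev_cat catA.
Qed.

Lemma enum_ord_split (q : 'I_s) : exists e1 e2, enum 'I_s = e1 ++ q :: e2.
Proof.
have /splitPr [e1 e2] : q \in enum 'I_s by rewrite mem_enum.
by exists e1, e2.
Qed.

Lemma enum_ord_split2 (q0 q : 'I_s) : q = q0.+1 :> nat ->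
  exists e1 e2, enum 'I_s = e1 ++ q0 :: q :: e2.
Proof.
move=> e; exists (take q0 (enum 'I_s)), (drop q0.+2 (enum 'I_s)).
have d (x : 'I_s) : drop x (enum 'I_s) = x :: drop x.+1 (enum 'I_s).
  by rewrite (drop_nth x) ?nth_ord_enum // size_enum_ord.
rewrite -[LHS](cat_take_drop q0); congr (_ ++ _).
by rewrite d -e d e.
Qed.

Lemma fL_block M i q : fL (letters i (boxes M)) = Some q ->
  [/\ is_box M (fst_idx i) q, ~~ is_box M (snd_idx i) q
    & forall q0 : 'I_s, q = q0.+1 :> nat ->
      is_box M (fst_idx i) q0 -> is_box M (snd_idx i) q0].
Proof.
move=> hf; have bq : is_box M (fst_idx i) q.
  by have := fL_mem hf; rewrite (mem_cols_letters i _ q).1 mem_boxes.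
have uc := cols_uniq i true (boxes_uniq M).
have b0 : ~~ is_box M (snd_idx i) q.
  apply/negP => b2; have [e1 [e2 e]] := enum_ord_split q.
  have eb : block M i q = [:: (L, q); (R, q)] by rewrite /block bq b2.
  move: hf uc; rewrite (letters_split M i e) eb [rev [:: _; _]]/=.
  rewrite -[[:: (R, q); _] ++ _]/([:: (R, q)] ++ (L, q) :: _) catA.
  set X := _ ++ [:: (R, q)] => hf uX.
  have [_ h] := fL_uniq_split uX hf.
  exact: h erefl.
split=> // q0 eq0 b1; apply: contraT => b2; have [e1 [e2 e]] := enum_ord_split2 eq0.
have eb0 : block M i q0 = [:: (L, q0)] by rewrite /block b1 (negPf b2).
have eb : block M i q = [:: (L, q)] by rewrite /block bq (negPf b0).
move: hf uc; rewrite (letters_split M i e) /= rev_cat eb eb0 -!catA /=.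
set X := rev (flatten _) => hf uX.
by have [] := fL_uniq_split uX hf.
Qed.

Lemma eL_block M i q : eL (letters i (boxes M)) = Some q ->
  [/\ is_box M (snd_idx i) q, ~~ is_box M (fst_idx i) q
    & forall q1 : 'I_s, q1 = q.+1 :> nat ->
      is_box M (snd_idx i) q1 -> is_box M (fst_idx i) q1].
Proof.
move=> hf; have bq : is_box M (snd_idx i) q.
  by have := eL_mem hf; rewrite (mem_cols_letters i _ q).2 mem_boxes.
have uc := cols_uniq i false (boxes_uniq M).
have b0 : ~~ is_box M (fst_idx i) q.
  apply/negP => b2; have [e1 [e2 e]] := enum_ord_split q.
  have eb : block M i q = [:: (L, q); (R, q)] by rewrite /block bq b2.
  move: hf uc; rewrite (letters_split M i e) eb [rev [:: _; _]]/=.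
  set X := rev (flatten _) => hf uX.
  by have [] := eL_uniq_split uX hf.
split=> // q1 eq1 b1; apply: contraT => b2; have [e1 [e2 e]] := enum_ord_split2 eq1.
have eb1 : block M i q1 = [:: (R, q1)] by rewrite /block b1 (negPf b2).
have eb : block M i q = [:: (R, q)] by rewrite /block bq (negPf b0).
move: hf uc; rewrite (letters_split M i e) [map _ (_ :: _)]/= [flatten (_ :: _)]/=.
rewrite rev_cat eb eb1 [rev [:: (R, q1)]]/= [rev [:: (R, q)]]/=.
rewrite -[[:: (R, q)] ++ _]/((R, q) :: _).
set X := _ ++ [:: (R, q1)] => hf uX.
have [_ h] := eL_uniq_split uX hf.
by case: (h _ q1 (erefl X)).
Qed.

Lemma flip_f_edges M i (q q0 : 'I_s) p c : q = q0.+1 :> nat ->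
  [/\ Defs.up (flip_f M i q) p c =
        (if p == fst_idx i then if c == q0 then true
          else if c == q then false else Defs.up M p c else Defs.up M p c),
      Defs.left (flip_f M i q) p c =
        (if c == q then if p == snd_idx i then false
          else if p == fst_idx i then true else Defs.left M p c else Defs.left M p c),
      Defs.right (flip_f M i q) p c =
        (if c == q0 then if p == snd_idx i then false
          else if p == fst_idx i then true else Defs.right M p c else Defs.right M p c)
    & Defs.down (flip_f M i q) p c =
        (if p == snd_idx i then if c == q0 then true
          else if c == q then false else Defs.down M p c else Defs.down M p c)].
Proof.
move=> eq0; rewrite /Defs.up /Defs.left /Defs.right /Defs.down !ffunE /= -!val_eqE /=.
rewrite /bump /= !add1n eq0 !eqSS.
by split; do ?[case: (_ == _ :> nat) => //=].
Qed.

Lemma flip_e_edges M i (q q1 : 'I_s) p c : q1 = q.+1 :> nat ->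
  [/\ Defs.up (flip_e M i q) p c =
        (if p == fst_idx i then if c == q then false
          else if c == q1 then true else Defs.up M p c else Defs.up M p c),
      Defs.left (flip_e M i q) p c =
        (if c == q1 then if p == snd_idx i then true
          else if p == fst_idx i then false else Defs.left M p c else Defs.left M p c),
      Defs.right (flip_e M i q) p c =
        (if c == q then if p == snd_idx i then true
          else if p == fst_idx i then false else Defs.right M p c else Defs.right M p c)
    & Defs.down (flip_e M i q) p c =
        (if p == snd_idx i then if c == q then false
          else if c == q1 then true else Defs.down M p c else Defs.down M p c)].
Proof.
move=> eq0; rewrite /Defs.up /Defs.left /Defs.right /Defs.down !ffunE /= -!val_eqE /=.
rewrite /bump /= !add1n eq0 !eqSS.
by split; do ?[case: (_ == _ :> nat) => //=].
Qed.

End Flips.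

Ltac by_edges M := rewrite /vertex; case: (Defs.up M _ _); case: (Defs.left M _ _);
  case: (Defs.right M _ _); case: (Defs.down M _ _).

Section IceModels.
Variables (n : nat) (lam : n.-tuple nat).
Local Notation s := (ncols lam).
Implicit Types (M : ice n s) (i : 'I_n.-1).
Local Open Scope nat_scope.

(** The left boundary excludes the first column, since a box has a minus on its left. The conditions
    of [fL_block] and the five valid types then force the signs inside the two by two block, by
    inspection of all cases. *)
Lemma fL_vertices M i q : ice_models lam M -> fL (letters i (boxes M)) = Some q ->
  exists q0 : 'I_s, [/\ q = q0.+1 :> nat, vertex M (fst_idx i) q = type2,
    vertex M (fst_idx i) q0 \in [:: type4; type5], vertex M (snd_idx i) q0 = type3
    & vertex M (snd_idx i) q \in [:: type1; type4]].
Proof.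
move=> [h5 _ hl _ _] /fL_block [/eqP B nD hA].
have q_gt0 : 0 < q.
  case: posnP => // q0; have := hl (fst_idx i) q q0.
  by case: B => _ -> _.
have q0s : q.-1 < s by apply: leq_ltn_trans (leq_pred q) (ltn_ord q).
pose q0 := Ordinal q0s; have eq0 : q = q0.+1 :> nat by rewrite /= prednK.
exists q0; move: (hA q0 eq0) (h5 (fst_idx i) q0) (h5 (snd_idx i) q0) (h5 (snd_idx i) q) nD B.
rewrite /is_box /vertex !(right_left M _ eq0) !up_down.
move: (Defs.down M (snd_idx i) q) (Defs.left M (fst_idx i) q) => [] [] // + + + + + [].
move: (Defs.down M (snd_idx i) q0) (Defs.left M (snd_idx i) q).
move: (Defs.left M (fst_idx i) q0) (Defs.down M (fst_idx i) q0).
move: (Defs.up M (snd_idx i) q0) (Defs.left M (snd_idx i) q0).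
move: (Defs.up M (snd_idx i) q) (Defs.right M (snd_idx i) q).
by move=> [] [] [] [] [] [] [] [] // hx ? ? ? ? -> -> //; move: hx => /(_ isT).
Qed.

Lemma eL_vertices M i q : ice_models lam M -> eL (letters i (boxes M)) = Some q ->
  exists q1 : 'I_s, [/\ q1 = q.+1 :> nat, vertex M (snd_idx i) q = type2,
    vertex M (fst_idx i) q \in [:: type1; type3], vertex M (fst_idx i) q1 = type4
    & vertex M (snd_idx i) q1 \in [:: type3; type5]].
Proof.
move=> [h5 _ _ _ hr] /eL_block [/eqP D nB hC].
have q1s : q.+1 < s.
  (* In the last column the vertex of row i would have plus on top, from the box above it, and minus
     on the right, from the boundary: this is type 2, a box that [nB] excludes. *)
  rewrite ltn_neqAle ltn_ord andbT; apply/eqP => qs.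
  move: (hr (fst_idx i) q qs) (h5 (fst_idx i) q) nB D.
  rewrite /is_box /vertex up_down.
  move: (Defs.down M (snd_idx i) q) (Defs.right M (fst_idx i) q) => [] [] // _ + + [] //.
  by move: (Defs.down M (fst_idx i) q) (Defs.left M (fst_idx i) q) => [] [].
pose q1 := Ordinal q1s; have eq1 : q1 = q.+1 :> nat by [].
exists q1; move: (hC q1 eq1) (h5 (fst_idx i) q1) (h5 (snd_idx i) q1) (h5 (fst_idx i) q) nB D.
rewrite /is_box /vertex !(right_left M _ eq1) !up_down.
move: (Defs.down M (snd_idx i) q) (Defs.left M (snd_idx i) q1) => [] [] // + + + + + [].
move: (Defs.down M (snd_idx i) q1) (Defs.left M (fst_idx i) q1).
move: (Defs.left M (fst_idx i) q) (Defs.down M (fst_idx i) q).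
move: (Defs.up M (snd_idx i) q1) (Defs.right M (snd_idx i) q1).
move: (Defs.down M (fst_idx i) q1) (Defs.right M (fst_idx i) q1).
by move=> [] [] [] [] [] [] [] [] // hx ? ? ? ? -> -> //; move: hx => /(_ isT).
Qed.

Lemma flip_f_vertices M i (q q0 : 'I_s) p c : q = q0.+1 :> nat ->
  vertex M (fst_idx i) q = type2 ->
  vertex M (fst_idx i) q0 \in [:: type4; type5] ->
  vertex M (snd_idx i) q0 = type3 ->
  vertex M (snd_idx i) q \in [:: type1; type4] ->
  vertex M p c \in valid_types ->
  vertex (flip_f M i q) p c \in valid_types /\
  is_box (flip_f M i q) p c =
    ((p, c) == (snd_idx i, q0)) || ((p, c) != (fst_idx i, q)) && is_box M p c.
Proof.
move=> eq0; rewrite /is_box [vertex (flip_f M i q) p c]/vertex.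
have [-> -> -> ->] := flip_f_edges M i p c eq0.
have nq : q0 == q = false by rewrite -val_eqE /= eq0; lia.
have nq' : q == q0 = false by rewrite eq_sym.
rewrite !xpair_eqE; case: (eqVneq p (fst_idx i)) => [->|pf].
  rewrite fst_neq_snd; case: (eqVneq c q0) => [->|c0].
    by rewrite nq => _ + _ _ _; by_edges M.
  by case: (eqVneq c q) => [->|//] + _ _ _ _; by_edges M.
case: (eqVneq p (snd_idx i)) => [->|_]; last by rewrite !if_same.
case: (eqVneq c q0) => [->|c0]; first by rewrite nq => _ _ + _ _; by_edges M.
by case: (eqVneq c q) => [->|//] _ _ _ + _; by_edges M.
Qed.

Lemma flip_e_vertices M i (q q1 : 'I_s) p c : q1 = q.+1 :> nat ->
  vertex M (snd_idx i) q = type2 ->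
  vertex M (fst_idx i) q \in [:: type1; type3] ->
  vertex M (fst_idx i) q1 = type4 ->
  vertex M (snd_idx i) q1 \in [:: type3; type5] ->
  vertex M p c \in valid_types ->
  vertex (flip_e M i q) p c \in valid_types /\
  is_box (flip_e M i q) p c =
    ((p, c) == (fst_idx i, q1)) || ((p, c) != (snd_idx i, q)) && is_box M p c.
Proof.
move=> eq0; rewrite /is_box [vertex (flip_e M i q) p c]/vertex.
have [-> -> -> ->] := flip_e_edges M i p c eq0.
have nq : q1 == q = false by rewrite -val_eqE /= eq0; lia.
have nq' : q == q1 = false by rewrite eq_sym.
rewrite !xpair_eqE; case: (eqVneq p (fst_idx i)) => [->|pf].
  rewrite fst_neq_snd; case: (eqVneq c q) => [->|c0].
    by rewrite nq' => _ + _ _ _; by_edges M.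
  by case: (eqVneq c q1) => [->|//] _ _ + _ _; by_edges M.
case: (eqVneq p (snd_idx i)) => [->|_]; last by rewrite !if_same.
case: (eqVneq c q) => [->|c0]; first by rewrite nq' => + _ _ _ _; by_edges M.
by case: (eqVneq c q1) => [->|//] _ _ _ + _; by_edges M.
Qed.

Lemma ice_models_flip_f M i q : ice_models lam M -> fL (letters i (boxes M)) = Some q ->
  ice_models lam (flip_f M i q).
Proof.
move=> hM /(fL_vertices hM) [q0 [eq0 B A C D]]; case: hM => h5 hu hl hd hr; split.
- by move=> p c; have [] := flip_f_vertices eq0 B A C D (h5 p c).
- move=> p c e; have [-> _ _ _] := flip_f_edges M i p c eq0.
  case: eqP => [ep|_]; last exact: hu.
  by have := ltn_succ_pred i; rewrite ep /= in e; rewrite e ltnn.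
- move=> p c e; have [_ -> _ _] := flip_f_edges M i p c eq0.
  case: eqP => [ep|_]; last exact: hl.
  by rewrite ep eq0 in e.
- move=> p c e; have [_ _ _ ->] := flip_f_edges M i p c eq0.
  case: eqP => [ep|_]; last exact: hd.
  by rewrite ep in e.
move=> p c e; have [_ _ -> _] := flip_f_edges M i p c eq0.
case: eqP => [ep|_]; last exact: hr.
by have := ltn_ord q; rewrite eq0 -ep e ltnn.
Qed.

Lemma ice_models_flip_e M i q : ice_models lam M -> eL (letters i (boxes M)) = Some q ->
  ice_models lam (flip_e M i q).
Proof.
move=> hM /(eL_vertices hM) [q1 [eq1 B A C D]]; case: hM => h5 hu hl hd hr; split.
- by move=> p c; have [] := flip_e_vertices eq1 B A C D (h5 p c).
- move=> p c e; have [-> _ _ _] := flip_e_edges M i p c eq1.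
  case: eqP => [ep|_]; last exact: hu.
  by have := ltn_succ_pred i; rewrite ep /= in e; rewrite e ltnn.
- move=> p c e; have [_ -> _ _] := flip_e_edges M i p c eq1.
  case: eqP => [ep|_]; last exact: hl.
  by rewrite ep eq1 in e.
- move=> p c e; have [_ _ _ ->] := flip_e_edges M i p c eq1.
  case: eqP => [ep|_]; last exact: hd.
  by rewrite ep in e.
move=> p c e; have [_ _ -> _] := flip_e_edges M i p c eq1.
case: eqP => [ep|_]; last exact: hr.
by have := ltn_ord q1; rewrite eq1 -ep e ltnn.
Qed.

Lemma boxes_move M M' (a b : 'I_n) (c d : 'I_s) : is_box M a c -> ~~ is_box M b d ->
  (forall p q, is_box M' p q = ((p, q) == (b, d)) || ((p, q) != (a, c)) && is_box M p q) ->
  a + c = b + d -> (a == b.+1 :> nat) || (b == a.+1 :> nat) ->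
  boxes M' = [seq if x == (a, c) then (b, d) else x | x <- boxes M].
Proof.
move=> Bac Bbd BM' ediag eab.
have nbd x : x \in boxes M -> x != (b, d).
  by rewrite mem_boxes; case: eqP => // ->; rewrite (negPf Bbd).
apply: sorted_boxes_eq; first exact: boxes_sorted.
- apply: (homo_sorted_in (P := mem (boxes M)) (e := @leb_box n s)); last exact: boxes_sorted.
    move=> [p q] [p' q'] /nbd + /nbd; rewrite !xpair_eqE -!val_eqE /leb_box /diag /=.
    case: ifP => h1; case: ifP => h2 //=; lia.
  exact/allP.
- exact: boxes_uniq.
- rewrite map_inj_in_uniq ?boxes_uniq // => x y /nbd hx /nbd hy.
  case: eqP => [->|_]; case: eqP => [->|_] // e; first by rewrite -e eqxx in hy.
  by rewrite e eqxx in hx.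
move=> [p q]; rewrite mem_boxes BM' /=; apply/idP/mapP => [/orP[/eqP e|/andP[ne B]]|].
- by exists (a, c); rewrite ?mem_boxes // eqxx.
- by exists (p, q); rewrite ?mem_boxes // (negPf ne).
case=> x; case: eqP => [_ _ ->|ne]; first by rewrite eqxx.
by rewrite mem_boxes => B e; case: x ne B e => p' q' /= ne B [-> ->]; apply/orP; right; rewrite B andbT; apply/eqP.
Qed.

Lemma reading_f M i : ice_models lam M ->
  wf i (reading M) = omap (@reading n s) (ice_f i M).
Proof.
move=> hM; rewrite ice_fE wf_letters ?boxes_uniq //.
case e: (fL _) => [q|] //=; congr Some; case/(fL_vertices hM): (e) => q0 [eq0 B A C D].
rewrite /reading (@boxes_move M (flip_f M i q) (fst_idx i) (snd_idx i) q q0) ?eqxx ?orbT //.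
- by rewrite -map_comp; apply: eq_map => x /=; rewrite /swap_row; case: ifP.
- by rewrite /is_box B.
- by rewrite /is_box C.
- by move=> p c; case: hM => h5 _ _ _ _; have [] := flip_f_vertices eq0 B A C D (h5 p c).
by rewrite /= eq0 addSnnS.
Qed.

Lemma boxes_flip_e M i (q q1 : 'I_s) : ice_models lam M ->
  q1 = q.+1 :> nat -> vertex M (snd_idx i) q = type2 ->
  vertex M (fst_idx i) q \in [:: type1; type3] ->
  vertex M (fst_idx i) q1 = type4 ->
  vertex M (snd_idx i) q1 \in [:: type3; type5] ->
  boxes (flip_e M i q) =
    [seq if x == (snd_idx i, q) then (fst_idx i, q1) else x | x <- boxes M].
Proof.
move=> [h5 _ _ _ _] eq1 B A C D; apply: boxes_move; rewrite /= ?eqxx //.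
- by rewrite /is_box B.
- by rewrite /is_box C.
- by move=> p c; have [] := flip_e_vertices eq1 B A C D (h5 p c).
by rewrite eq1 addSnnS.
Qed.

Lemma reading_e M i : ice_models lam M ->
  we i (reading M) = omap (@reading n s) (ice_e i M).
Proof.
move=> hM; rewrite ice_eE we_letters ?boxes_uniq //.
case e: (eL _) => [q|] //=; congr Some; case/(eL_vertices hM): (e) => q1 [eq1 B A C D].
rewrite /reading (boxes_flip_e hM eq1 B A C D) -map_comp.
by apply: eq_map => x /=; rewrite /swap_row; case: ifP.
Qed.

Lemma flip_f_e M i (q q1 : 'I_s) : q1 = q.+1 :> nat ->
  vertex M (snd_idx i) q = type2 -> vertex M (fst_idx i) q1 = type4 ->
  vertex M (snd_idx i) q1 \in [:: type3; type5] ->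
  flip_f (flip_e M i q) i q1 = M.
Proof.
move=> eq1; rewrite /vertex -!up_down -!(right_left M _ eq1) => -[_ _ h1 h2] [h3 h4 _ _] h5.
have h6 : M.2 (snd_idx i, lift ord0 q) = false by exact: h1.
have h7 : M.2 (fst_idx i, lift ord0 q) = true by exact: h4.
have h8 : M.1 (lift ord0 (fst_idx i), q) = true by exact: h2.
have h9 : M.1 (lift ord0 (fst_idx i), q1) = false by exact: h3.
case: M {h1 h2 h3 h4 h5} h6 h7 h8 h9 => U H /= h6 h7 h8 h9; congr pair.
  apply/ffunP => -[p c]; rewrite !ffunE /= -[c == q1]val_eqE -[c == q]val_eqE /= eq1 eqSS.
  case: (eqVneq (p : nat) i.+1) => //= ep.
  have {ep} -> : p = lift ord0 (fst_idx i) by apply: val_inj.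
  case: (eqVneq (c : nat) q) => [ec|_]; first by rewrite (val_inj ec : c = q).
  case: (eqVneq (c : nat) q.+1) => [ec|//].
  by have {ec} -> : c = q1 by apply: val_inj; rewrite /= ec.
apply/ffunP => -[p c]; rewrite !ffunE /= eq1.
case: (eqVneq (c : nat) q.+1) => ec; rewrite ?andbF // !andbT.
have {ec} -> : c = lift ord0 q by apply: val_inj.
by case: eqP => [->|_] //; case: eqP => [->|_].
Qed.

(** On reading words f undoes e. Comparing the two words at the position of the box that e moved
    shows that f selects precisely this box, and flipping it back restores [M]. *)
Lemma ice_f_e M M' i : ice_models lam M -> ice_e i M = Some M' -> ice_f i M' = Some M.
Proof.
move=> hM eM'; have := reading_e i hM; rewrite eM' /=.
move: eM'; rewrite ice_eE; case e: (eL _) => [q|] //= [<-] {M'}.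
case/(eL_vertices hM): (e) => q1 [eq1 B A C D].
move/we_Some; rewrite ice_fE /reading wf_letters ?boxes_uniq //.
case: (fL _) => [q'|] //=; rewrite (boxes_flip_e hM eq1 B A C D) -map_comp.
move=> [/eq_in_map/(_ (snd_idx i, q))]; rewrite mem_boxes /is_box B eqxx => /(_ isT).
rewrite /= eqxx /swap_row; case: eqP => [[<-] _|_ /= /eqP]; last by rewrite fst_neq_snd.
by rewrite (flip_f_e eq1 B C D).
Qed.

End IceModels.

(** * Highest weight ice models *)

Section HighestWeightModels.
Variables (n : nat) (lam : n.-tuple nat).
Hypothesis n_gt0 : (0 < n)%N.
Local Notation s := (ncols lam).
Implicit Types (M : ice n s) (i : 'I_n.-1).
Local Open Scope nat_scope.

Lemma ncols_gt0 : 0 < s.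
Proof. by rewrite /ncols addn_gt0 n_gt0 orbT. Qed.

Lemma ice_ext M M' : (forall p q, vertex M p q = vertex M' p q) -> M = M'.
Proof.
move=> e; case: M e => U H; case: M' => U' H' e; congr pair; apply/ffunP.
  move=> [P q]; case: (unliftP ord0 P) => [p ->|->].
    by have [] := e p q.
  have [_ _ _] := e (Ordinal n_gt0) q; rewrite /Defs.down /=.
  by have -> : widen_ord (leqnSn n) (Ordinal n_gt0) = ord0 by apply: val_inj.
move=> [p Q]; case: (unliftP ord0 Q) => [q ->|->].
  by have [] := e p q.
have [_ + _ _] := e p (Ordinal ncols_gt0); rewrite /Defs.left /=.
by have -> : widen_ord (leqnSn s) (Ordinal ncols_gt0) = ord0 by apply: val_inj.
Qed.

(* In a highest weight model no path leaves a row downwards to the right of a box. *)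
Definition no_exit M := forall p (q q' : 'I_s), is_box M p q -> q < q' -> Defs.down M p q' = true.

(** Where the horizontal sign changes from minus to plus the vertex has type 3, and its bottom edge
    is minus. *)
Lemma exit_between M p (c : 'I_s) k (hk : k < s) : ice_models lam M -> c < k ->
  Defs.right M p c = false -> Defs.left M p (Ordinal hk) = true ->
  exists2 q : 'I_s, c < q & Defs.down M p q = false.
Proof.
move=> [h5 _ _ _ _]; elim: k hk => [//|k IH] hk; rewrite ltnS leq_eqVlt.
have hk' := ltnW hk; rewrite -(@right_left n s M p (Ordinal hk')) //.
case/orP => [/eqP ck|ck].
  by have -> : Ordinal hk' = c by [apply: val_inj]; move=> ->.
move=> rc rk; case e: (Defs.left M p (Ordinal hk')); first exact: IH e.
exists (Ordinal hk') => //; move: (h5 p (Ordinal hk')).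
rewrite /vertex e rk; case: (Defs.up _ _ _); by case: (Defs.down _ _ _).
Qed.

(** Induction from the bottom row. If a path left row p in column q' to the right of a box in column
    q, the row below would have no box up to column q, so the R of that box would stay unmatched and
    e would not be 0. *)
Lemma hw_no_exit M : ice_models lam M -> (forall i, ice_e i M = None) -> no_exit M.
Proof.
move=> hM hw p; have [k ek] := ubnP (p : nat); elim: k p ek => // k IH p pk q q' B qq'.
case: (hM) => h5 hu hl hd hr.
case e: (Defs.down M p q') => //; case p0: (p : nat) => [|j].
  by rewrite hd in e.
have jn : j < n.-1 by have := ltn_ord p; lia.
pose i := Ordinal jn; have ep : p = snd_idx i by apply: val_inj; rewrite /= p0.
(* After a box in column c of the row below, no path leaves that row, by induction. The path
   entering it in column q' therefore sits at a vertex of type 4, with plus on the left; but the box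
   has minus on its right, so some path leaves in between. *)
have nb (c : 'I_s) : c <= q -> ~~ is_box M (fst_idx i) c.
  move=> cq; apply/negP => Bc; have cq' : c < q' := leq_ltn_trans cq qq'.
  have no (c' : 'I_s) : c < c' -> Defs.down M (fst_idx i) c' = true.
    by move=> cc'; apply: (IH (fst_idx i)) Bc cc'; rewrite /=; lia.
  have := h5 (fst_idx i) q'; have := no q' cq'; rewrite /vertex up_down -ep e => ->.
  case el: (Defs.left M (fst_idx i) q'); last by case: (Defs.right _ _ _).
  have rc : Defs.right M (fst_idx i) c = false.
    by move/eqP: Bc; rewrite /vertex => -[].
  have el' : Defs.left M (fst_idx i) (Ordinal (ltn_ord q')) = true.
    by rewrite -el; congr Defs.left; apply: val_inj.
  by have [c' /no ->] := exit_between hM cq' rc el'.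
have := hw i; rewrite ice_eE.
have epw := @enum_ord_pairwise s; have [e1 [e2 ee]] := enum_ord_split q.
rewrite (letters_split M i ee) {2}/block -ep B (negPf (nb q (leqnn _))) /=.
case eE: (eL _) => //; case: (@eL_unmatched _ _ _ _ _ eE).
have : all (fun c : 'I_s => c < q) e1.
  move: epw; rewrite ee pairwise_cat => /andP[/allrelP h _].
  by apply/allP => c ce; apply: h ce _; rewrite inE eqxx.
elim: e1 {ee eE} => [//|c e1 IH1] /= /andP[cq /IH1 h].
rewrite rev_cat /cols filter_cat map_cat -/(cols true _) h /=.
by rewrite {1}/block (negPf (nb c (ltnW cq))) /=; case: (is_box _ _ _).
Qed.

Lemma row_boxes M p (q : 'I_s) k (hk : k < s) : ice_models lam M -> no_exit M ->
  is_box M p q -> q <= k -> is_box M p (Ordinal hk).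
Proof.
move=> [h5 _ _ _ _] hx B; elim: k hk => [|k IH] hk; rewrite leq_eqVlt => /orP[/eqP qk|] //.
- by have <- : q = Ordinal hk by apply: val_inj.
- by have <- : q = Ordinal hk by apply: val_inj.
rewrite ltnS => qk; have hk' := ltnW hk; have := IH hk' qk.
move: (h5 p (Ordinal hk)) (hx p q (Ordinal hk) B qk); rewrite /is_box /vertex.
rewrite (@right_left n s M p (Ordinal hk') (Ordinal hk)) // => + dk /eqP [_ _ lk _].
by rewrite dk lk; case: (Defs.up _ _ _); case: (Defs.right _ _ _).
Qed.

(** Top and left signs determine the vertex, except that plus on top and minus on the left allow
    types 2 and 3. Type 3 in [M'] is impossible: further right all tops are plus, because [M] has
    boxes up to the end of the row, so the plus would propagate to the right boundary, which is
    minus. *)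
Lemma no_exit_row M M' p : ice_models lam M -> ice_models lam M' -> no_exit M ->
  (forall q, Defs.up M p q = Defs.up M' p q) ->
  forall q, is_box M p q -> Defs.left M p q = Defs.left M' p q -> vertex M' p q = type2.
Proof.
move=> hM hM' hx hu q B hl; case: (hM') => h5 _ _ _ hr.
move: (h5 p q); rewrite /vertex -hu -hl; move/eqP: (B); rewrite /vertex => -[-> -> _ _].
case er: (Defs.right M' p q); last by case: (Defs.down _ _ _).
have hs : s.-1 < s by rewrite prednK ?ncols_gt0.
have qs : q <= s.-1 by rewrite -ltnS prednK ?ncols_gt0.
suff h k (hk : k < s) : q <= k -> Defs.right M' p (Ordinal hk) = true.
  by have := h _ hs qs; rewrite hr //= prednK ?ncols_gt0.
elim: k hk => [|k IH] hk; rewrite leq_eqVlt => /orP[/eqP qk|] //.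
- by have <- : q = Ordinal hk by apply: val_inj.
- by have <- : q = Ordinal hk by apply: val_inj.
rewrite ltnS => qk; have hk' := ltnW hk; have := IH hk' qk.
have := row_boxes hk hM hx B (leqW qk); rewrite /is_box /vertex hu => /eqP[uk _ _ _].
rewrite (@right_left n s M' p (Ordinal hk') (Ordinal hk)) // => lk.
move: (h5 p (Ordinal hk)); rewrite /vertex uk lk.
by case: (Defs.right _ _ _); case: (Defs.down _ _ _).
Qed.

Lemma no_exit_eq_row M M' p : ice_models lam M -> ice_models lam M' ->
  no_exit M -> no_exit M' ->
  (forall q, Defs.up M p q = Defs.up M' p q) ->
  forall q, vertex M p q = vertex M' p q.
Proof.
move=> hM hM' hx hx' hu [k hk].
have eqV q : Defs.left M p q = Defs.left M' p q -> vertex M p q = vertex M' p q.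
  move=> hl; case B: (is_box M p q).
    by rewrite (eqP B) (no_exit_row hM hM' hx hu B hl).
  case B': (is_box M' p q).
    by rewrite (eqP B') (no_exit_row hM' hM hx' (fun q => esym (hu q)) B' (esym hl)).
  case: hM hM' => h5 _ _ _ _ [h5' _ _ _ _].
  move: (h5 p q) (h5' p q) B B'; rewrite /is_box /vertex hl hu.
  case: (Defs.up _ _ _); case: (Defs.left _ _ _); case: (Defs.right _ _ _);
  case: (Defs.down _ _ _) => //;
  by case: (Defs.right _ _ _); case: (Defs.down _ _ _).
apply: (eqV); elim: k hk => [|k IH] hk.
  by case: hM hM' => _ _ hl _ _ [_ _ hl' _ _]; rewrite hl // hl'.
have hk' := ltnW hk; have [_ _ h _] := eqV (Ordinal hk') (IH hk').
by rewrite -!(@right_left n s _ p (Ordinal hk') (Ordinal hk)).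
Qed.

Lemma no_exit_unique M M' : ice_models lam M -> ice_models lam M' ->
  no_exit M -> no_exit M' -> M = M'.
Proof.
move=> hM hM' hx hx'.
suff hu k (p : 'I_n) : p + k.+1 = n -> forall q, Defs.up M p q = Defs.up M' p q.
  apply: ice_ext => p; apply: no_exit_eq_row => //; apply: (hu (n.-1 - p)).
  by have := ltn_ord p; lia.
elim: k p => [|k IH] p pk q.
  case: hM hM' => _ h _ _ _ [_ h' _ _ _]; rewrite addn1 in pk.
  move: (h p q pk) (h' p q pk) => -[a b] [a' b'].
  case e: (Defs.up M p q); case e': (Defs.up M' p q) => //.
    by rewrite (b (a' e')) in e.
  by rewrite (b' (a e)) in e'.
have pn : p < n.-1 by lia.
pose i := Ordinal pn; have -> : p = fst_idx i by apply: val_inj.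
rewrite !up_down; have h : snd_idx i + k.+1 = n by rewrite /=; lia.
by have [] := no_exit_eq_row hM hM' hx hx' (IH _ h) q.
Qed.

End HighestWeightModels.

(** * The explicit highest weight model *)

Section HighestWeightModel.
Variables (n : nat) (lam : n.-tuple nat).
Hypotheses (n_gt0 : (0 < n)%N) (lam_sorted : sorted geq lam).
Local Notation s := (ncols lam).
Local Notation lam1 := (nth 0 lam 0)%N.
Implicit Types (p k : 'I_n).
Local Open Scope nat_scope.

Lemma lam_mono k p : k <= p -> tnth lam p <= tnth lam k.
Proof.
move=> kp; rewrite !(tnth_nth 0).
have := sorted_leq_nth (fun a b c h1 h2 => leq_trans h2 h1) leqnn 0 lam_sorted.
by apply=> //; rewrite inE size_tuple.
Qed.

Lemma lam_le p : tnth lam p <= lam1.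
Proof. by have := @lam_mono (Ordinal n_gt0) p (leq0n _); rewrite [X in _ <= X](tnth_nth 0). Qed.

(* In the highest weight model, the path entering at the top in the column
   [lam1 + k - lam_k] moves one column to the right in each row, down to row k,
   where it leaves to the right from the column [turn k]. *)
Definition crosses (P q : nat) : bool :=
  [exists k : 'I_n, (k < P) && (q == lam1 + k - tnth lam k + (n - P))].

Definition turn p : nat := lam1 - tnth lam p + n.-1.

Definition hw_model : ice n s :=
  ([ffun x : 'I_n.+1 * 'I_s => ~~ crosses x.1 x.2],
   [ffun x : 'I_n * 'I_s.+1 => ~~ (crosses x.1 x.2 || (turn x.1 < x.2))]).

Lemma crosses_lt p q : crosses p q.+1 -> q < turn p.
Proof.
case/existsP => k /andP[kp /eqP e]; have := ltn_ord p.
by have := lam_mono (ltnW kp); have := lam_le k; rewrite /turn; lia.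
Qed.

Lemma crosses_le p q : crosses p q -> q <= turn p.
Proof. by case: q => // q; apply: crosses_lt. Qed.

Lemma crosses_up p q : crosses p.+1 q = crosses p q.+1 || (q == turn p).
Proof.
have pn := ltn_ord p; apply/existsP/orP => [[k /andP[]]|].
  rewrite ltnS leq_eqVlt => /orP[/eqP/val_inj ->|kp] /eqP e.
    by right; have := lam_le p; rewrite e /turn; lia.
  by left; apply/existsP; exists k; rewrite kp e; lia.
case=> [/existsP[k /andP[kp /eqP e]]|/eqP e].
  by exists k; rewrite ltnS ltnW //=; lia.
by exists p; rewrite ltnSn /=; have := lam_le p; rewrite e /turn; lia.
Qed.

Lemma hw_model_vertex p (q : 'I_s) : vertex hw_model p q =
  (~~ (crosses p q.+1 || (q == turn p :> nat)), ~~ (crosses p q || (turn p < q)),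
   ~~ (crosses p q.+1 || (turn p <= q)), ~~ crosses p q).
Proof.
by rewrite /vertex /Defs.up /Defs.left /Defs.right /Defs.down !ffunE /= -crosses_up.
Qed.

Lemma hw_model_box p (q : 'I_s) : is_box hw_model p q = (turn p < q).
Proof.
rewrite /is_box hw_model_vertex; case: (ltngtP (turn p) q) => h.
- case e: (crosses p q); first by have := crosses_le e; lia.
  by case e': (crosses p q.+1); first by have := crosses_lt e'; lia.
- by rewrite !orbF; case: (crosses p q); case: (crosses p q.+1).
by rewrite orbT.
Qed.

Lemma hw_model_no_exit : no_exit hw_model.
Proof.
move=> p q q'; rewrite hw_model_box => h qq'; have [] := hw_model_vertex p q'.
move=> _ _ _ ->; apply/negP => /crosses_le; lia.
Qed.

Lemma turn_lt p : turn p < s.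
Proof. by have := lam_le p; rewrite /turn /ncols; lia. Qed.

Lemma hw_model_ice : ice_models lam hw_model.
Proof.
split=> [p q|p q e|p q e|p q e|p q e]; have [hu hl hr hd] := hw_model_vertex p q.
- rewrite hw_model_vertex; case: (ltngtP (turn p) q) => h.
  + case e: (crosses p q); first by have := crosses_le e; lia.
    by case e': (crosses p q.+1); first by have := crosses_lt e'; lia.
  + by rewrite !orbF; case: (crosses p q); case: (crosses p q.+1).
  by rewrite !orbT orbF; case: (crosses p q).
- rewrite hu -crosses_up e; split=> [/negbFE/existsP[k /andP[_ /eqP h]]|[k h]].
    by exists k; rewrite h subnn addn0.
  by apply/negbTE; rewrite negbK; apply/existsP; exists k; rewrite ltn_ord h subnn addn0 /=.
- rewrite hl e ltn0 orbF; apply/existsP => -[k /andP[kp /eqP h]].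
  by have := lam_le k; have := ltn_ord p; lia.
- by rewrite hd; apply/existsP => -[k]; rewrite e.
have h : turn p <= q by rewrite -ltnS e turn_lt.
by rewrite hr h orbT.
Qed.

Lemma hw_model_row p : #|[set q | is_box hw_model p q]%SET| = tnth lam p.
Proof.
rewrite -sum1dep_card; under eq_bigl => q do rewrite hw_model_box.
rewrite -(big_mkord (fun q => turn p < q) (fun=> 1)).
rewrite (big_cat_nat (n := (turn p).+1)) ?turn_lt //=.
rewrite big_nat_cond big_pred0 ?add0n => [|q]; last by case: (ltngtP (turn p) q) => h; lia.
rewrite big_nat_cond (eq_bigl (fun q => (turn p < q < s) && true)) => [|q]; last by lia.
rewrite -big_nat_cond sum_nat_const_nat muln1.
by have := lam_le p; have := ltn_ord p; rewrite /turn /ncols; lia.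
Qed.

End HighestWeightModel.

(** * The isomorphism *)

Lemma coroot_ice_wt n s (M : ice n s) (i : 'I_n.-1) :
  coroot i (ice_wt M) = wwt i (reading M).
Proof.
rewrite /ice_wt coroot_sum /wwt /reading big_map.
transitivity (\sum_(x : 'I_n * 'I_s | is_box M x.1 x.2) lwt i x.1).
  rewrite -(pair_big_dep predT (fun p q => is_box M p q) (fun p _ => lwt i p)) /=.
  apply: eq_bigr => p _; rewrite corootMn coroot_eps sumr_const cardsE.
  by congr (_ *+ _); apply: eq_card => q; rewrite !inE.
by rewrite (perm_big _ (permEl (perm_sort _ _))) big_filter big_enum_cond.
Qed.

Section IceCrystal.
Variables (n : nat) (lam : n.-tuple nat).
Hypotheses (n_gt0 : (0 < n)%N) (lam_sorted : sorted geq lam).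
Local Notation s := (ncols lam).
Implicit Types (M : ice n s) (i : 'I_n.-1).
Local Notation M0 := (hw_model lam).
Local Notation height M := (\sum_(k <- reading M) (k : nat))%N.

Lemma ice_models_f M M' i : ice_models lam M -> ice_f i M = Some M' -> ice_models lam M'.
Proof.
move=> hM; rewrite ice_fE; case e: (fL _) => [q|] //= [<-]; exact: ice_models_flip_f e.
Qed.

Lemma ice_models_e M M' i : ice_models lam M -> ice_e i M = Some M' -> ice_models lam M'.
Proof.
move=> hM; rewrite ice_eE; case e: (eL _) => [q|] //= [<-]; exact: ice_models_flip_e e.
Qed.

Lemma height_e M M' i : ice_models lam M -> ice_e i M = Some M' -> height M = (height M').+1.
Proof. by move=> hM e; have := reading_e i hM; rewrite e => /we_Some/wf_sum. Qed.

Lemma ice_e_case M : (exists i M', ice_e i M = Some M') \/ (forall i, ice_e i M = None).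
Proof.
case: (pselect (exists i M', ice_e i M = Some M')) => h; [by left | right => i].
by case e: (ice_e i M) => [M'|] //; case: h; exists i, M'.
Qed.

Lemma hw_model_reaches M : ice_models lam M ->
  exists2 I, wfs I (reading M0) = Some (reading M) & height M = (height M0 + size I)%N.
Proof.
move: {2}(height M).+1 (ltnSn (height M)) => k; elim: k M => // k IH M hk hM.
case: (ice_e_case M) => [[i [M' e]]|hw].
  have hM' := ice_models_e hM e; have hh := height_e hM e.
  have [|I eI hI] := IH M' _ hM'; first by rewrite hh in hk.
  exists (i :: I); last by rewrite hh hI addnS.
  by rewrite /= eI /= (reading_f i hM') (ice_f_e hM e).
have -> : M = M0.
  apply: (no_exit_unique n_gt0 hM (hw_model_ice n_gt0 lam_sorted)).
    exact: hw_no_exit.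
  exact: hw_model_no_exit.
by exists [::] => //=; rewrite addn0.
Qed.

(** A model obtained from [M0] by e would have smaller height, yet every model is reached from [M0]
    by f's and so has at least its height. *)
Lemma hw_model_hw : is_hw (reading M0).
Proof.
move=> i; have h0 := hw_model_ice n_gt0 lam_sorted; rewrite (reading_e i h0).
case e: (ice_e i M0) => [M|] //; have hM := ice_models_e h0 e.
by have [I _ hI] := hw_model_reaches hM; have := height_e h0 e; lia.
Qed.

(** Induction on the height. Equal words admit the same e_i, and f_i recovers each model from its
    image; if no e_i applies, both are the unique model without exits. *)
Lemma reading_inj M M' : ice_models lam M -> ice_models lam M' ->
  reading M = reading M' -> M = M'.
Proof.
move: {2}(height M).+1 (ltnSn (height M)) => k; elim: k M M' => // k IH M M' hk hM hM' eM.
case: (ice_e_case M) => [[i [N e]]|hw].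
  have := reading_e i hM; rewrite eM (reading_e i hM') e /=.
  case e': (ice_e i M') => [N'|] //= [eN].
  have eNN : N' = N.
    apply/esym/IH => //; [|exact: ice_models_e e|exact: ice_models_e e'].
    by have := height_e hM e; lia.
  by have := ice_f_e hM' e'; rewrite eNN (ice_f_e hM e) => -[].
have hw' i : ice_e i M' = None.
  by have := reading_e i hM; rewrite eM (reading_e i hM') hw /=; case: (ice_e i M').
by apply: (no_exit_unique n_gt0 hM hM'); apply: hw_no_exit.
Qed.

Lemma hw_model_wt i : wwt i (reading M0) = coroot i (partition_weight lam).
Proof.
rewrite -coroot_ice_wt /ice_wt; congr coroot; apply: eq_bigr => p _.
by rewrite hw_model_row.
Qed.

Lemma wfs_ice I b : wfs I (reading M0) = Some b ->
  exists2 M, ice_models lam M & b = reading M.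
Proof.
elim: I b => [|i I IH] b /=.
  by case=> <-; exists M0 => //; apply: hw_model_ice.
case e: (wfs I _) => [c|] //=; have [M hM ->] := IH _ e.
rewrite (reading_f i hM); case eM: (ice_f i M) => [M'|] //= [<-].
by exists M' => //; apply: ice_models_f eM.
Qed.

Variables (F : fieldType) (q : F) (reg : F -> Prop).
Hypothesis vr : valuation_ring_at q reg.
Variables (V : uq_module q n) (v : V).
Hypotheses (irrV : uq_irreducible V) (hwV : highest_weight_vector (partition_weight lam) v).

Lemma ice_crystal_at : crystal_isomorphic (ice_crystal lam) (crystal_at reg v).
Proof.
have [t ht] := hw_system_exists n vr (size (reading M0)).
pose wc := word_class vr irrV hwV hw_model_hw ht hw_model_wt.
pose wco := word_class_opt vr irrV hwV hw_model_hw ht hw_model_wt.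
exists (fun o => wco (omap (@reading n s) o)); split => //.
- split=> [o [M hM <-]|o o'|C].
  + apply/(kashiwara_elements vr irrV hwV hw_model_hw ht hw_model_wt); have [I hI _] := hw_model_reaches hM.
    by exists (reading M), I; split.
  + move=> /set_mem [M hM <-] /set_mem [M' hM' <-] /= e; congr Some.
    have [I hI _] := hw_model_reaches hM.
    by apply: reading_inj => //; apply: (word_class_inj hI e).
  move/(kashiwara_elements vr irrV hwV hw_model_hw ht hw_model_wt) => [b [I [hb ->]]].
  by have [M hM eb] := wfs_ice hb; exists (Some M); [exists M | rewrite /= -eb].
- move=> o [M hM <-] /=; have [I hI _] := hw_model_reaches hM.
  by apply: (word_class_wt vr irrV hwV hw_model_hw ht hw_model_wt hI) => i; apply: coroot_ice_wt.
- move=> i o [M hM <-] /=; have [I hI _] := hw_model_reaches hM.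
  by rewrite (induced_e vr irrV hwV hw_model_hw ht hw_model_wt hI) reading_e.
move=> i o [M hM <-] /=; have [I hI _] := hw_model_reaches hM.
by rewrite (induced_f vr irrV hwV hw_model_hw ht hw_model_wt hI) reading_f.
Qed.

End IceCrystal.

Theorem theorem5p9 (RR : realType) (n : nat) (lam : n.-tuple nat)
    (V : uq_module (qvar (complex RR)) n) (v : V) :
  (0 < n)%N ->
  sorted geq lam ->
  nth 0%N lam n.-1 = 0%N ->
  uq_irreducible V ->
  highest_weight_vector (partition_weight lam) v ->
  crystal_isomorphic (ice_crystal lam) (kashiwara_crystal v).
Proof.
move=> n_gt0 slam _ irrV hwV; rewrite kashiwara_crystal_at.
exact: (ice_crystal_at n_gt0 slam (regular0_valuation_ring _)).
Qed.
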